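(* Let $d_1\ge d\ge1$, let $\Lambda=\{l_1,\dots,l_{d_1}\}\subset\mathbb{Z}^d$ with $l_k=e_k$ for $k=1,\dots,d$, let $0<\delta_1^*\le\delta_2^*$, and let $\lambda_1,\dots,\lambda_{d_1}:\mathbb{Z}\to[\delta_1^*,\delta_2^*]$ be deterministic functions. Put $a^{ij}(t)=\sum_{k=1}^{d_1}\lambda_k(t)l_k^il_k^j$, and assume that there are $\delta_1,\delta_2>0$ such that $\delta_1|\xi|^2\le\sum_{i,j}a^{ij}(t)\xi^i\xi^j\le\delta_2|\xi|^2$ for all $t$ and $\xi\in\mathbb{R}^d$. Let $\rho\in(0,(2d_1\delta_2^* )^{-1})$ and let $G$ be the discrete heat kernel defined in the context. Let $f$ be a real function on $\mathbb{Z}^{d+1}$ with compact (i.e. finite) support. Then for any $p>1$, $$\sum_{n\in\mathbb{Z}}\Big[\sum_{j=-\infty}^{n-1}G(j,n,\cdot)\ast_1f(j,\cdot)\Big]^p_{2,p;1}\le N\sum_{(t,x)\in\mathbb{Z}^{d+1}}|f(t,x)|^p,$$ where $N$ depends only on $p,d,d_1,\rho,\delta_1^*,\delta_2^*,\Lambda$.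
   Context: $e_1,\dots,e_d$ is the standard basis of $\mathbb{R}^d$. For a function $f$ on $\mathbb{Z}^d$ and $\xi\in\mathbb{Z}^d$: $\delta_{\xi,1}f(x)=f(x+\xi)-f(x)$, $\Delta_{\xi,1}f(x)=f(x+\xi)-2f(x)+f(x-\xi)$; $\delta_1^\alpha=\delta_{e_1,1}^{\alpha_1}\cdots\delta_{e_d,1}^{\alpha_d}$ for a multi-index $\alpha\in\mathbb{Z}_+^d$; $(f\ast_1g)(x)=\sum_{y\in\mathbb{Z}^d}f(x-y)g(y)$; $[f]_{2,p;1}=\sum_{|\alpha|=2}(\sum_{x\in\mathbb{Z}^d}|\delta_1^\alpha f(x)|^p)^{1/p}$. For each $m\in\mathbb{Z}$, $G(m,\cdot,\cdot)$ is the solution $z(n,y)$ of $$z(n+1,y)-z(n,y)=\rho\sum_{k=1}^{d_1}\lambda_k(n)\Delta_{l_k,1}z(n,y),\quad z(m,y)=I_{y=0},\quad n\in[m,\infty)\cap\mathbb{Z},\ y\in\mathbb{Z}^d.$$ *)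

(* Defs.v *)
From HB Require Import structures.
From mathcomp Require Import all_boot all_order all_algebra.
From mathcomp Require Import all_classical all_reals all_analysis.

Set Implicit Arguments.
Unset Strict Implicit.
Unset Printing Implicit Defensive.

Import Order.TTheory GRing.Theory Num.Theory.

Local Open Scope classical_set_scope.
Local Open Scope ring_scope.

Section Lattice.
Context {R : realType} {d : nat}.
Implicit Types (f g : 'rV[int]_d -> R) (xi x y : 'rV[int]_d).

Definition fdiff xi f : 'rV[int]_d -> R := fun x => f (x + xi) - f x.

Definition sdiff xi f : 'rV[int]_d -> R :=
  fun x => f (x + xi) - 2 * f x + f (x - xi).

Definition mdiff (alpha : 'I_d -> nat) f : 'rV[int]_d -> R :=
  foldr (fun i g => iter (alpha i) (fdiff (delta_mx 0 i)) g) f (enum 'I_d).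

(* The sum over all y is a sum over the support of the summand, with value 0
   when that support is infinite; it is meant for f or g of finite support. *)
Definition zconv f g : 'rV[int]_d -> R :=
  fun x => \sum_(y \in [set: 'rV[int]_d]) (f (x - y) * g y).

(* The seminorm takes values in [0, +oo].  The entries of a multi-index of
   length 2 are at most 2, so {ffun 'I_d -> 'I_3} contains all of them. *)
Definition seminorm2 (p : R) f : \bar R :=
  (\sum_(alpha : {ffun 'I_d -> 'I_3} | (\sum_(i < d) alpha i == 2)%N)
     ((\esum_(x in [set: 'rV[int]_d])
         (`|mdiff (fun i => alpha i) f x| `^ p)%:E)%R `^ p^-1))%E.

End Lattice.

Section HeatKernel.
Context {R : realType} {d d1 : nat}.
Variables (rho : R) (l : 'I_d1 -> 'rV[int]_d) (lambda : 'I_d1 -> int -> R).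

Definition diffusion_mx (t : int) : 'M[R]_d :=
  \matrix_(i, j) \sum_(k < d1) lambda k t * (l k 0 i)%:~R * (l k 0 j)%:~R.

(* G m n is only constrained for n >= m. *)
Definition heat_kernel (G : int -> int -> 'rV[int]_d -> R) : Prop :=
  forall m : int,
    (forall y, G m m y = (y == 0)%:R) /\
    (forall (n : int) y, m <= n ->
       G m (n + 1) y - G m n y =
       rho * \sum_(k < d1) lambda k n * sdiff (l k) (G m n) y).

Lemma heat_kernel_exists : exists G, heat_kernel G.
Proof.
pose K (m : int) := fix K (k : nat) (y : 'rV[int]_d) : R :=
  if k is k'.+1 then
    K k' y + rho * \sum_(k < d1) lambda k (m + k'%:Z) * sdiff (l k) (K k') y
  else (y == 0)%:R.
exists (fun m n => K m `|n - m|%N) => m; split=> [y|n y mn].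
  by rewrite subrr.
have [k ->] : exists k : nat, n = m + k%:Z.
  by exists `|n - m|%N; rewrite gez0_abs ?subr_ge0// addrCA subrr addr0.
have -> : m + k%:Z + 1 - m = k.+1%:Z.
  by rewrite addrAC [m + _]addrC addrK -addn1 PoszD.
have -> : m + k%:Z - m = k%:Z by rewrite addrAC subrr add0r.
by rewrite /= addrAC subrr add0r.
Qed.

Lemma heat_kernel_unique G G' : heat_kernel G -> heat_kernel G' ->
  forall m n y, m <= n -> G m n y = G' m n y.
Proof.
move=> hG hG' m n y mn.
have [k ->] : exists k : nat, n = m + k%:Z.
  by exists `|n - m|%N; rewrite gez0_abs ?subr_ge0// addrCA subrr addr0.
elim: k y => [|k IH] y; first by rewrite addr0 (hG m).1 (hG' m).1.
have mk : m <= m + k%:Z by rewrite lerDl.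
rewrite -addn1 PoszD addrA.
move: ((hG m).2 _ y mk) => /eqP; rewrite subr_eq => /eqP ->.
move: ((hG' m).2 _ y mk) => /eqP; rewrite subr_eq => /eqP ->.
by rewrite IH; congr (_ * _ + _); apply: eq_bigr => i _; rewrite /sdiff !IH.
Qed.

End HeatKernel.

(* Main.v *)
Require Import Defs.
From HB Require Import structures.
From mathcomp Require Import all_boot all_order all_algebra.
From mathcomp Require Import all_classical all_reals all_analysis.
From mathcomp Require Import finmap ring lra zify.

(** Let P_n = 1 + rho * sum_k lambda_k(n) Delta_(l_k), so that
    u(n+1) = P_n (u(n) + f(n)).  The maps f |-> delta_i delta_j u are uniformly
    bounded on l^2 by an energy estimate, and the condition on rho makes every
    P_n an average with holding probability bounded below.  The variance gained
    at each step of the walk gives the reverse Poincare inequality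
    (m + 1) |delta_v P^m phi|^2 <= C P^m phi^2, hence all the kernel bounds that
    are needed (m^(-r/2) for r differences, and one weighted bound away from the
    diagonal), without Fourier analysis or heat kernel asymptotics.  They say
    that the operator maps bounded functions vanishing near a parabolic cube to
    functions of bounded oscillation on that cube.  The adjoint is an operator
    of the same class with time reversed, so the Calderon-Zygmund decomposition
    gives weak type (1,1), interpolation gives 1 < p < 2, and duality p > 2.
    As f is finitely supported, everything is done on one finite dyadic
    parabolic box, with constants that do not depend on the box. *)

Set Implicit Arguments.
Unset Strict Implicit.
Unset Printing Implicit Defensive.

Import Order.TTheory GRing.Theory Num.Theory.

Local Open Scope classical_set_scope.
Local Open Scope ring_scope.

(** * Calderon-Zygmund decomposition and weak type (1,1) *)

(** The rates depend on time only, so all [P_n] are convolutions in space and commute with one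
    another and with differences; this lets a bound for one difference be iterated over successive
    portions of the elapsed time. In the oscillation estimate on a cell of side $h$ and duration
    $h^2$, the obstacle is that second differences decay only like $m^{-1}$ in the age $m$ of the
    source, so that absolute values alone would produce a logarithm. Sources of age $m \le h^2$ lie
    farther than $h$ from the evaluation point, and the weight $|x-z|^2/h^2$ replaces $m^{-1}$ by
    $h^{-1}m^{-1/2}$, with sum $O(1)$. Old sources are treated through increments: a further spatial
    difference gives $m^{-3/2}$, a time step $m^{-2}$. The tails past $h^2$ are $O(h^{-1})$ and
    $O(h^{-2})$, which exactly balances $O(h)$ steps in space and $h^2$ steps in time. *)

Section Pairing.
Context {R : realFieldType} {X : finType}.
Implicit Types f g : X -> R.

Definition adjoint_ops (T T' : (X -> R) -> X -> R) : Prop :=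
  forall f g, \sum_z T f z * g z = \sum_z f z * T' g z.

Lemma sum_mul_delta f z : \sum_w f w * (w == z)%:R = f z.
Proof.
rewrite (bigD1 z)//= eqxx mulr1 big1 ?addr0// => w /negPf ->.
by rewrite mulr0.
Qed.

Lemma adjoint_ops_sym T T' : adjoint_ops T T' -> adjoint_ops T' T.
Proof.
move=> adjT f g; under eq_bigr do rewrite mulrC.
by rewrite -adjT; apply: eq_bigr => z _; rewrite mulrC.
Qed.

(** Testing the pairing against point masses shows that each value [T f z] is a linear functional of
    [f]. An operator with an adjoint is thus additive, and linearity is never assumed separately. *)
Lemma adjoint_opsD T T' f g h : adjoint_ops T T' ->
  (forall z, h z = f z + g z) -> forall z, T h z = T f z + T g z.
Proof.
move=> adjT hE z; rewrite -[LHS]sum_mul_delta -[X in X + _]sum_mul_delta.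
rewrite -[X in _ + X]sum_mul_delta !adjT -big_split/=.
by apply: eq_bigr => w _; rewrite hE mulrDl.
Qed.

Lemma sum_indicator_card (P : pred X) : \sum_z (P z)%:R = #|P|%:R :> R.
Proof.
rewrite -sum1_card natr_sum [RHS]big_mkcond/=; apply: eq_bigr => z _.
by rewrite unfold_in; case: (P z).
Qed.

End Pairing.

Section CalderonZygmund.
Context {R : realFieldType} {X : finType} {Y : eqType}.
Variables (K A B : nat) (cell : nat -> X -> Y) (vol : nat -> nat)
  (near : nat -> rel X).
Hypothesis cell0_inj : injective (cell 0).
Hypothesis cell_nested : forall k z z', cell k z = cell k z' ->
  cell k.+1 z = cell k.+1 z'.
Hypothesis cell_top : forall z z', cell K z = cell K z'.
Hypothesis cell_card : forall k z, (k <= K)%N ->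
  #|[pred z' | cell k z' == cell k z]| = vol k.
Hypothesis vol_gt0 : forall k, (0 < vol k)%N.
Hypothesis volS : forall k, vol k.+1 = (A * vol k)%N.
Hypothesis vol0 : vol 0 = 1%N.
Hypothesis near_cell : forall k z z' w, cell k z = cell k z' ->
  near k z w = near k z' w.
Hypothesis near_card : forall k z, (k <= K)%N ->
  (#|[pred w | near k z w]| <= B * vol k)%N.

Variables (T T' : (X -> R) -> X -> R) (M : R).
Hypothesis adjT : adjoint_ops T T'.
Hypothesis T_l2 : forall f, \sum_z T f z ^+ 2 <= M * \sum_z f z ^+ 2.
(** Dual form of the Hörmander condition. If [T] has kernel $k(w,z)$, the supremum of the left side
    over all such [psi] is the sum of $|k(w,z)-k(w,z')|$ over the [w] that are not near the cell. *)
Hypothesis T'_osc : forall k psi z z', (forall w, `|psi w| <= 1) ->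
  cell k z = cell k z' -> (forall w, near k z w -> psi w = 0) ->
  `|T' psi z - T' psi z'| <= M.
Hypothesis M_ge0 : 0 <= M.

Let v k : R := (vol k)%:R.
Let v_gt0 k : 0 < v k. Proof. by rewrite /v ltr0n. Qed.
Let vi_ge0 k : 0 <= (v k)^-1. Proof. by rewrite invr_ge0 ler0n. Qed.

Definition cell_avg k (g : X -> R) z :=
  (\sum_(w | cell k w == cell k z) g w) / v k.

Lemma cell_avg_cell k g z z' : cell k z = cell k z' ->
  cell_avg k g z = cell_avg k g z'.
Proof. by move=> e; rewrite /cell_avg e. Qed.

Lemma cell_le k j z z' : (k <= j)%N -> cell k z = cell k z' ->
  cell j z = cell j z'.
Proof.
move=> /subnKC <- e; elim: (j - k)%N => [|n IH]; first by rewrite addn0.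
by rewrite addnS; apply: cell_nested.
Qed.

Lemma sum_cell_avg (P : pred X) k g : (k <= K)%N ->
  (forall z z', cell k z = cell k z' -> P z = P z') ->
  \sum_(z | P z) cell_avg k g z = \sum_(z | P z) g z.
Proof.
move=> kK Pcell; rewrite /cell_avg -mulr_suml.
rewrite (exchange_big_dep P)/=; last first.
  by move=> z w Pz /eqP e; rewrite (Pcell _ _ e).
rewrite mulr_suml; apply: eq_bigr => w Pw.
rewrite (eq_bigl (fun z => cell k z == cell k w)); last first.
  move=> z; rewrite [RHS]eq_sym andbC.
  by case: eqP => //= e; rewrite -(Pcell _ _ e).
rewrite sumr_const cell_card// -[X in X / _]mulr_natr mulfK//.
by rewrite gt_eqF ?v_gt0.
Qed.

Lemma cell_avg_selfadj k f g :
  \sum_z f z * cell_avg k g z = \sum_z cell_avg k f z * g z.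
Proof.
rewrite /cell_avg; under eq_bigr do rewrite mulrA big_mkcond/= mulr_sumr.
under [RHS]eq_bigr do rewrite mulrAC big_mkcond/= mulr_suml.
rewrite -!mulr_suml; congr (_ / _); rewrite exchange_big/=.
apply: eq_bigr => z _; apply: eq_bigr => w _.
by rewrite eq_sym; case: ifP; rewrite ?mulr0 ?mul0r.
Qed.

Lemma cell_avg_norm k g z :
  `|cell_avg k g z| <= cell_avg k (fun w => `|g w|) z.
Proof.
rewrite /cell_avg normrM (ger0_norm (_ : 0 <= (v k)^-1)) ?vi_ge0//.
by rewrite ler_wpM2r ?vi_ge0// ler_norm_sum.
Qed.

Lemma cell_avg_const k c z : (k <= K)%N -> cell_avg k (fun=> c) z = c.
Proof.
move=> kK; rewrite /cell_avg sumr_const cell_card// -[X in X / _]mulr_natr.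
by rewrite mulfK// gt_eqF ?v_gt0.
Qed.

Lemma cell_avg_osc k g z e : (k <= K)%N ->
  (forall z', cell k z = cell k z' -> `|g z - g z'| <= e) ->
  `|g z - cell_avg k g z| <= e.
Proof.
move=> kK osc; rewrite -{1}(cell_avg_const (g z) z kK) /cell_avg -mulrBl.
rewrite normrM (ger0_norm (_ : 0 <= (v k)^-1)) ?vi_ge0//.
rewrite ler_pdivrMr// -sumrB; apply: le_trans (ler_norm_sum _ _ _) _.
rewrite mulrC /v -(cell_card z kK) -sum1_card natr_sum mulr_suml.
by apply: ler_sum => w /eqP e1; rewrite mul1r osc.
Qed.

(** * Decomposition at a fixed level *)

Section Level.
Variables (f : X -> R) (a : R).
Hypothesis a_gt0 : 0 < a.
Let a_ge0 : 0 <= a := ltW a_gt0.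
Hypothesis top_le : forall z, cell_avg K (fun w => `|f w|) z <= a.

Let av k := cell_avg k (fun w => `|f w|).

(* [k] is the largest scale at which the average around [z] exceeds [a]. *)
Definition selected k z :=
  (a < av k z) && [forall j : 'I_K.+1, (k < j)%N ==> (av j z <= a)].

Lemma selected_cell k z z' : cell k z = cell k z' ->
  selected k z = selected k z'.
Proof.
move=> e; rewrite /selected /av (cell_avg_cell _ e); congr (_ && _).
apply: eq_forallb => j; case: ltnP => //= kj.
by rewrite (cell_avg_cell _ (cell_le (ltnW kj) e)).
Qed.

Lemma selected_uniq k k' z : (k < K)%N -> (k' < K)%N ->
  selected k z -> selected k' z -> k = k'.
Proof.
move=> kK kK' /andP[a1 /forallP h1] /andP[a2 /forallP h2].
case: (ltngtP k k') => // kk'.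
  have := h1 (Ordinal (ltnW kK' : (k' < K.+1)%N)).
  by rewrite kk'/= leNgt a2.
have := h2 (Ordinal (ltnW kK : (k < K.+1)%N)).
by rewrite kk'/= leNgt a1.
Qed.

(** By maximality the cell one scale up has average at most [a]; it contains this cell and is [A]
    times as large. *)
Lemma selected_avg_le k z : (k < K)%N -> selected k z -> av k z <= A%:R * a.
Proof.
move=> kK /andP[_ /forallP/(_ (Ordinal (kK : (k.+1 < K.+1)%N)))]/=.
rewrite ltnSn/= /av /cell_avg !ler_pdivrMr// => h.
apply: (@le_trans _ _ (a * v k.+1)); last first.
  by rewrite /v volS natrM mulrCA mulrA.
apply: le_trans h; rewrite big_mkcond [leRHS]big_mkcond/=.
apply: ler_sum => w _; case: (eqVneq (cell k w) (cell k z)) => [e|_].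
  by rewrite (cell_nested e) eqxx.
by case: ifP.
Qed.

(** Going down from the top scale, the first average to exceed [a] would belong to a selected cell.
    At scale 0 cells are single points, so the average is [|f z|] itself. *)
Lemma not_selected_le z : (forall k, (k < K)%N -> ~~ selected k z) ->
  `|f z| <= a.
Proof.
move=> nsel.
have : forall n, (n <= K)%N -> forall j, (K - n <= j <= K)%N -> av j z <= a.
  elim=> [_ j|n IH nK j /andP[]].
    by rewrite subn0 => jK; rewrite (_ : j = K) ?top_le//; lia.
  rewrite leq_eqVlt => /predU1P[e jK|Kj jK]; last by apply: IH; lia.
  rewrite leNgt; apply/negP => aj.
  have /negP := nsel j ltac:(lia); apply; rewrite /selected aj/=.
  by apply/forallP => i; apply/implyP => ji; apply: IH; have := ltn_ord i; lia.
move=> /(_ K (leqnn _) 0%N); rewrite subnn/= => /(_ isT).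
rewrite /av /cell_avg /v vol0 divr1 (big_pred1 z)// => w.
by apply/eqP/eqP => [/cell0_inj//|->].
Qed.

Definition bad_part k z := if selected k z then f z - cell_avg k f z else 0.
Definition bad z := \sum_(k < K) bad_part k z.
Definition good z := f z - bad z.

Let N1 := \sum_z `|f z|.

Lemma sum_selected_le : \sum_(k < K) \sum_(z | selected k z) `|f z| <= N1.
Proof.
under eq_bigr do rewrite big_mkcond/=.
rewrite exchange_big/=; apply: ler_sum => z _.
case: (pickP (fun k : 'I_K => selected k z)) => [k sk|ns]; last first.
  by rewrite big1 ?normr_ge0// => k _; rewrite ns.
rewrite (bigD1 k)//= sk big1 ?addr0// => j jk.
case: ifP => // sj; case/eqP: jk; apply: val_inj.
exact: selected_uniq (ltn_ord j) (ltn_ord k) sj sk.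
Qed.

Lemma bad_part_sum_le k : (k < K)%N ->
  \sum_z `|bad_part k z| <= 2 * \sum_(z | selected k z) `|f z|.
Proof.
move=> kK; have hk := ltnW kK.
rewrite mulr2n mulrDl mul1r -{2}(sum_cell_avg _ hk (@selected_cell k)).
rewrite -big_split/= [leRHS]big_mkcond/=; apply: ler_sum => z _.
rewrite /bad_part; case: ifP => _; last by rewrite normr0.
by apply: le_trans (ler_normB _ _) _; rewrite lerD2l cell_avg_norm.
Qed.

Lemma sum_bad_parts_le : \sum_(k < K) \sum_z `|bad_part k z| <= 2 * N1.
Proof.
apply: (@le_trans _ _ (2 * \sum_(k < K) \sum_(z | selected k z) `|f z|)).
  by rewrite mulr_sumr; apply: ler_sum => k _; rewrite bad_part_sum_le.
by rewrite ler_pM2l// sum_selected_le.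
Qed.

Lemma good_sum_le : \sum_z `|good z| <= 3 * N1.
Proof.
apply: (@le_trans _ _ (\sum_z (`|f z| + \sum_(k < K) `|bad_part k z|))).
  apply: ler_sum => z _; apply: le_trans (ler_normB _ _) _.
  by rewrite lerD2l ler_norm_sum.
rewrite big_split/= exchange_big/=.
have := sum_bad_parts_le; rewrite -/N1; lra.
Qed.

Lemma good_bound z : (0 < A)%N -> `|good z| <= A%:R * a.
Proof.
move=> A0; rewrite /good /bad.
case: (pickP (fun k : 'I_K => selected k z)) => [k sk|ns]; last first.
  rewrite big1 ?subr0; last by move=> k _; rewrite /bad_part ns.
  apply: (@le_trans _ _ a); last by rewrite ler_peMl// ler1n.
  by apply: not_selected_le => k kK; rewrite (ns (Ordinal kK)).
rewrite (bigD1 k)//= big1 ?addr0 => [|j jk].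
  rewrite /bad_part sk opprB addrC subrK.
  by apply: le_trans (cell_avg_norm _ _ _) _; apply: selected_avg_le.
rewrite /bad_part; case: ifP => // sj; case/eqP: jk; apply: val_inj.
exact: selected_uniq (ltn_ord j) (ltn_ord k) sj sk.
Qed.

Definition exceptional w :=
  [exists k : 'I_K, exists z, selected k z && near k z w].

(** A union bound that needs no list of the selected cells: a cell is counted through its points,
    each with weight [1 / v k], hence with total weight 1. Its neighbourhood has at most [B * vol k]
    points, and [a < av k z] turns the resulting volumes into $\ell^1$ mass of [f]. *)
Lemma exceptional_card : a * #|exceptional|%:R <= B%:R * N1.
Proof.
rewrite -sum_indicator_card.
pose J w := \sum_(k < K) \sum_(z | selected k z) (near k z w)%:R / v k.
have J_ge w : (exceptional w)%:R <= J w.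
  have term_ge0 (k : nat) (z : X) : 0 <= (near k z w)%:R / v k.
    by rewrite mulr_ge0 ?ler0n.
  case/boolP: (exceptional w) => [/existsP[k /existsP[z /andP[sz nz]]]|_]/=; last first.
    by apply: sumr_ge0 => k _; apply: sumr_ge0.
  rewrite /J (bigD1 k)//= -[leLHS]addr0; apply: lerD; last first.
    by apply: sumr_ge0 => j _; apply: sumr_ge0.
  apply: (@le_trans _ _ (\sum_(z' | cell k z' == cell k z) (v k)^-1)).
    rewrite sumr_const cell_card; last exact: ltnW.
    by rewrite -[leRHS]mulr_natr mulVf// gt_eqF ?v_gt0.
  rewrite big_mkcond [leRHS]big_mkcond/=; apply: ler_sum => z' _.
  case: eqP => [e|_]; last by case: ifP.
  by rewrite (selected_cell e) sz (near_cell _ e) nz mul1r.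
apply: (@le_trans _ _ (a * \sum_w J w)).
  by rewrite ler_pM2l//; apply: ler_sum => w _.
apply: (@le_trans _ _ (B%:R * \sum_(k < K) \sum_(z | selected k z) `|f z|)); last first.
  by rewrite ler_wpM2l ?ler0n// sum_selected_le.
rewrite /J exchange_big/= mulr_sumr [leRHS]mulr_sumr; apply: ler_sum => k _.
have kK := ltnW (ltn_ord k).
rewrite exchange_big/= -(sum_cell_avg (fun w => `|f w|) kK (@selected_cell k)).
rewrite mulr_sumr [leRHS]mulr_sumr.
apply: ler_sum => z /andP[az _]; rewrite -mulr_suml sum_indicator_card.
apply: (@le_trans _ _ (a * ((B * vol k)%:R / v k))).
  by rewrite ler_pM2l// ler_wpM2r// ler_nat near_card.
rewrite natrM mulfK ?gt_eqF ?v_gt0// mulrC.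
by rewrite ler_wpM2l ?ler0n// ltW.
Qed.

Lemma bad_part_avg0 k z : (k < K)%N -> cell_avg k (bad_part k) z = 0.
Proof.
move=> kK; have hk := ltnW kK.
rewrite /cell_avg; case/boolP: (selected k z) => sz; last first.
  rewrite big1 ?mul0r// => w /eqP e.
  by rewrite /bad_part (selected_cell e) (negPf sz).
rewrite (eq_bigr (fun w => f w - cell_avg k f z)) => [|w /eqP e].
  rewrite sumrB sumr_const cell_card// -[X in _ - X]mulr_natr.
  by rewrite -/(v k) divrK ?unitfE ?gt_eqF// subrr mul0r.
by rewrite /bad_part (selected_cell e) sz (cell_avg_cell _ e).
Qed.

(** Pairing with the sign [psi] of [T bad] off the exceptional set moves the problem to [T' psi]. By
    construction [psi] vanishes near every selected cell, as [T'_osc] demands. *)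
Lemma bad_off_exceptional :
  \sum_(w | ~~ exceptional w) `|T bad w| <= 2 * M * N1.
Proof.
pose psi w := if exceptional w then 0 else Num.sg (T bad w).
have psi1 w : `|psi w| <= 1.
  by rewrite /psi; case: ifP; rewrite ?normr0// normr_sg; case: (_ != 0).
have -> : \sum_(w | ~~ exceptional w) `|T bad w| = \sum_w T bad w * psi w.
  rewrite big_mkcond/=; apply: eq_bigr => w _; rewrite /psi.
  by case: (exceptional w) => /=; rewrite ?mulr0// normrEsg mulrC.
rewrite adjT /bad; under eq_bigr do rewrite mulr_suml.
rewrite exchange_big/=; apply: (@le_trans _ _ (\sum_(k < K) M * \sum_z
  `|bad_part k z|)).
  apply: ler_sum => k _; have kK := ltn_ord k.
  (* Cancellation: [bad_part k] has mean zero on cells and averaging is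
     self-adjoint, so only the oscillation of [T' psi] on cells matters. *)
  rewrite -[leLHS]subr0 -[X in _ - X](_ : \sum_z bad_part k z * cell_avg k (T'
    psi) z = 0).
    rewrite -sumrB mulr_sumr; apply: ler_sum => z _.
    rewrite -mulrBr; apply: le_trans (ler_norm _) _; rewrite normrM mulrC.
    rewrite /bad_part; case: ifP => sz; last by rewrite normr0 !mulr0.
    rewrite ler_wpM2r// cell_avg_osc// 1?ltnW// => z' e.
    apply: (T'_osc (k := k)) => // w nw; rewrite /psi ifT//.
    by apply/existsP; exists k; apply/existsP; exists z; rewrite sz.
  rewrite cell_avg_selfadj big1// => z _.
  by rewrite bad_part_avg0// mul0r.
by rewrite -mulr_sumr [2 * M]mulrC -mulrA ler_wpM2l// sum_bad_parts_le.
Qed.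

Lemma good_l2 : (0 < A)%N ->
  \sum_w T good w ^+ 2 <= 3 * A%:R * M * a * N1.
Proof.
move=> A0; apply: le_trans (T_l2 _) _.
rewrite [leRHS](_ : _ = M * ((A%:R * a) * (3 * N1))); last by ring.
rewrite ler_wpM2l//; apply: (@le_trans _ _ (A%:R * a * \sum_z `|good z|)).
  rewrite mulr_sumr; apply: ler_sum => z _.
  by rewrite -real_normK ?num_real// expr2 ler_wpM2r// good_bound.
by rewrite ler_wpM2l ?good_sum_le// mulr_ge0 ?ler0n.
Qed.

Lemma weak_level : (0 < A)%N ->
  a * #|[pred w | a < `|T f w|]|%:R <= (B%:R + 4 * M + 12 * A%:R * M) * N1.
Proof.
move=> A0; rewrite -sum_indicator_card.
have TE w : T f w = T bad w + T good w.
  by apply: (adjoint_opsD adjT) => z; rewrite /good addrC subrK.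
(* Pointwise Chebyshev: off the exceptional set, [a < |T f w|] forces [|T bad w|] or [|T good w|] to
   be at least [a / 2]. Together with the bounds [2 * M * N1] and [3 * A * M * a * N1] this produces
   the terms [4 * M] and [12 * A * M]. *)
apply: (@le_trans _ _ (\sum_w (a * (exceptional w)%:R +
   (2 * (if ~~ exceptional w then `|T bad w| else 0)
    + 4 / a * T good w ^+ 2)))).
  rewrite mulr_sumr; apply: ler_sum => w _ /=.
  have g_ge0 : 0 <= 4 / a * T good w ^+ 2.
    by rewrite mulr_ge0 ?divr_ge0 ?sqr_ge0.
  have a0 := ltW a_gt0.
  case: (exceptional w) => /=.
    rewrite !mulr1 mulr0 add0r.
    by case: (_ < _) => /=; rewrite ?mulr1 ?mulr0 ?addr_ge0// lerDl.
  have [G GE] : exists G, G = 4 / a * T good w ^+ 2 by eexists.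
  rewrite -GE in g_ge0 *.
  case: ltrP => /=; rewrite ?mulr0 ?mulr1 add0r => h; last first.
    by rewrite addr_ge0// mulr_ge0.
  have [h1|h1] := lerP a (2 * `|T bad w|); first lra.
  have h2 : a < 2 * `|T good w|.
    have := ler_normD (T bad w) (T good w); rewrite -TE; lra.
  suff : a <= G by have := normr_ge0 (T bad w); lra.
  rewrite GE mulrAC ler_pdivlMr// -[T good w ^+ 2]real_normK ?num_real//.
  nra.
rewrite 2!big_split/= -!mulr_sumr sum_indicator_card -big_mkcond/=.
have h1 := exceptional_card; have h2 := bad_off_exceptional.
have h3 : 4 / a * (\sum_w T good w ^+ 2) <= 12 * A%:R * M * N1.
  rewrite mulrAC ler_pdivrMr//; have := good_l2 A0; lra.
lra.
Qed.

End Level.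

Theorem weak_type_1_1 (f : X -> R) (a : R) : (0 < A)%N -> 0 < a ->
  a * #|[pred w | a < `|T f w|]|%:R <=
  (1 + B%:R + 4 * M + 12 * A%:R * M) * \sum_z `|f z|.
Proof.
move=> A0 a0; set C := B%:R + 4 * M + 12 * A%:R * M.
have N1_ge0 : 0 <= \sum_z `|f z| by apply: sumr_ge0.
have C_ge0 : 0 <= C by rewrite !addr_ge0 ?mulr_ge0 ?ler0n.
rewrite (_ : 1 + _ + _ + _ = 1 + C); last by rewrite /C; ring.
(* If already the average over the whole space exceeds [a], counting all points is good enough; this
   case is the summand 1 of the constant. *)
case: (pickP (fun z => a < cell_avg K (fun w => `|f w|) z)) => [z az|le_a].
  apply: (@le_trans _ _ (a * v K)).
    rewrite ler_pM2l// /v ler_nat -(cell_card z (leqnn K)).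
    apply: subset_leq_card; apply/fintype.subsetP => w _.
    by rewrite inE (cell_top w z).
  move: az; rewrite ltr_pdivlMr// => /ltW/le_trans; apply.
  rewrite (eq_bigl xpredT) => [|w]; last by rewrite (cell_top w z) eqxx.
  by rewrite ler_peMl// lerDl.
apply: (@le_trans _ _ (C * \sum_z `|f z|)).
  by apply: weak_level => // z; rewrite leNgt le_a.
by rewrite ler_wpM2r// lerDr.
Qed.

End CalderonZygmund.

(** * Interpolation and duality *)

Section GeometricSums.
Context {R : realType}.
Implicit Types (s y a : R).

(** Sum of the geometric series of ratio $2^{-s}$. *)
Definition geom_const s : R := (1 - 2 `^ (- s))^-1.

Lemma powR2N_lt1 s : 0 < s -> 2 `^ (- s) < 1.
Proof.
move=> s0; rewrite powRN invf_lt1 ?powR_gt0//.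
rewrite -[ltLHS](powRr0 (2 : R)) /powR pnatr_eq0/= ltr_expR mul0r.
by rewrite mulr_gt0// ln_gt0// ltr1n.
Qed.

Lemma geom_const_gt0 s : 0 < s -> 0 < geom_const s.
Proof. by move=> /powR2N_lt1 h; rewrite invr_gt0 subr_gt0. Qed.

Lemma geom_constE s : 0 < s -> 1 + geom_const s * 2 `^ (- s) = geom_const s.
Proof.
move=> s0; have h := powR2N_lt1 s0; rewrite /geom_const.
by field; rewrite subr_eq0 eq_sym lt_eqF.
Qed.

Lemma geom_sum_below s y a n : 0 < s -> 0 <= y -> 0 < a ->
  \sum_(i < n | a * 2 ^+ i < y) (a * 2 ^+ i) `^ s <= geom_const s * y `^ s.
Proof.
move=> s0 y0 a0; have c0 := geom_const_gt0 s0.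
(* Strengthened for the induction: [a * 2 ^+ n / 2] is the last dyadic level summed over, so the
   bound is in terms of the largest term, and the recursion is [geom_constE]. *)
suff H : \sum_(i < n | a * 2 ^+ i < y) (a * 2 ^+ i) `^ s
    <= geom_const s * (Num.min (a * 2 ^+ n / 2) y) `^ s.
  apply: le_trans H _; rewrite ler_pM2l//; apply: ge0_ler_powR; rewrite ?nnegrE.
  - exact: ltW.
  - by rewrite le_min y0 divr_ge0// mulr_ge0 ?exprn_ge0 ?ltW.
  - by [].
  - by rewrite ge_min lexx orbT.
elim: n => [|n IH]; first by rewrite big_ord0 mulr_ge0 ?powR_ge0// ltW.
have b0 : 0 < a * 2 ^+ n by rewrite mulr_gt0 ?exprn_gt0.
rewrite big_mkcond big_ord_recr/= -big_mkcond/=.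
rewrite exprSr mulrA mulfK ?pnatr_eq0//.
move: (a * 2 ^+ n) b0 IH => b b0 IH; case: ltrP => by_.
  move: IH; rewrite (min_idPl _); last by lra.
  move=> IH; apply: le_trans (lerD IH (lexx _)) _.
  rewrite powRM ?invr_ge0//; last exact: ltW.
  rewrite -[in leRHS](geom_constE s0) powRN -[2^-1]powR_inv1// -powRrM mulN1r powRN.
  by rewrite le_eqVlt; apply/orP; left; apply/eqP; ring.
rewrite addr0; apply: le_trans IH _; rewrite ler_pM2l//.
apply: ge0_ler_powR; rewrite ?nnegrE ?ge_min ?lexx ?orbT ?(ltW s0)//.
by rewrite le_min y0 divr_ge0// ltW.
Qed.

Lemma geom_sum_above s y a n : 0 < s -> 0 < y -> 0 < a ->
  \sum_(i < n | y <= a * 2 ^+ i) (a * 2 ^+ i) `^ (- s)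
  <= geom_const s * y `^ (- s).
Proof.
move=> s0 y0 a0; have c0 := geom_const_gt0 s0.
have antitone b c : 0 < b -> b <= c -> c `^ (- s) <= b `^ (- s).
  move=> b0 bc; have c1 : 0 < c by apply: lt_le_trans bc.
  rewrite !powRN lef_pV2 ?posrE ?powR_gt0//.
  by apply: ge0_ler_powR; rewrite ?nnegrE// ltW.
(* Here the largest term comes first, so the induction peels off the lowest level and replaces [a]
   by [a * 2]. *)
suff H : \sum_(i < n | y <= a * 2 ^+ i) (a * 2 ^+ i) `^ (- s)
    <= geom_const s * (Num.max a y) `^ (- s).
  apply: le_trans H _; rewrite ler_pM2l//; apply: antitone => //.
  by rewrite le_max lexx orbT.
elim: n a a0 => [|n IH] a a0.
  by rewrite big_ord0 mulr_ge0 ?powR_ge0// ltW.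
rewrite big_mkcond big_ord_recl/= -big_mkcond/= expr0 mulr1.
have -> : \sum_(i < n | y <= a * 2 ^+ bump 0 i) (a * 2 ^+ bump 0 i) `^ (- s)
   = \sum_(i < n | y <= a * 2 * 2 ^+ i) (a * 2 * 2 ^+ i) `^ (- s).
  by apply: eq_big => i; rewrite /bump/= add1n exprS mulrA.
have /IH {}IH : 0 < a * 2 by rewrite mulr_gt0.
case: ifP => ya.
  move: IH; rewrite !(max_idPl _)//; last by move: ya a0; lra.
  move=> IH; apply: le_trans (lerD (lexx _) IH) _.
  rewrite powRM ?(ltW a0)// -[in leRHS](geom_constE s0).
  by rewrite le_eqVlt; apply/orP; left; apply/eqP; ring.
rewrite add0r; apply: le_trans IH _; rewrite ler_pM2l//.
by apply: antitone; rewrite ?lt_max ?a0// ge_max !le_max !lexx !orbT/= andbT; lra.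
Qed.

End GeometricSums.

Section Marcinkiewicz.
Context {R : realType} {X : finType}.
Variables (T T' : (X -> R) -> X -> R) (C M : R).
Hypothesis adjT : adjoint_ops T T'.
Hypothesis T_weak : forall f a, 0 < a ->
  a * #|[pred w | a < `|T f w|]|%:R <= C * \sum_z `|f z|.
Hypothesis T_l2 : forall f, \sum_z T f z ^+ 2 <= M * \sum_z f z ^+ 2.
Hypotheses (C_ge0 : 0 <= C) (M_ge0 : 0 <= M).

(** [f] is cut at the same height [a] as the level being counted. The large values go through the
    weak bound, the small ones through the $\ell^2$ bound and Chebyshev, both at level [a / 2]. *)
Lemma level_count f a : 0 < a ->
  #|[pred w | a < `|T f w|]|%:R <=
  2 * C / a * (\sum_(z | a < `|f z|) `|f z|) +
  4 * M / a ^+ 2 * (\sum_(z | `|f z| <= a) `|f z| ^+ 2).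
Proof.
move=> a0; pose f1 z := if a < `|f z| then f z else 0.
pose f0 z := if a < `|f z| then 0 else f z.
have TE w : T f w = T f1 w + T f0 w.
  apply: (adjoint_opsD adjT) => z; rewrite /f1 /f0.
  by case: ifP; rewrite ?addr0 ?add0r.
have a2 : 0 < a / 2 by lra.
have h1 := T_weak f1 a2.
have h0 := T_l2 f0.
have s1 : \sum_z `|f1 z| = \sum_(z | a < `|f z|) `|f z|.
  rewrite [RHS]big_mkcond/=; apply: eq_bigr => z _; rewrite /f1.
  by case: ifP; rewrite ?normr0.
have s0 : \sum_z f0 z ^+ 2 = \sum_(z | `|f z| <= a) `|f z| ^+ 2.
  rewrite [RHS]big_mkcond/=; apply: eq_bigr => z _; rewrite /f0.
  by case: ltrP; rewrite ?expr0n//= real_normK ?num_real.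
rewrite -{}s1 -{}s0.
apply: (@le_trans _ _ (#|[pred w | a / 2 < `|T f1 w|]|%:R +
   4 / a ^+ 2 * \sum_z T f0 z ^+ 2)).
  rewrite -!sum_indicator_card mulr_sumr -big_split/=.
  apply: ler_sum => w _ /=.
  have t0 : 0 <= 4 / a ^+ 2 * T f0 w ^+ 2.
    by rewrite mulr_ge0 ?divr_ge0 ?sqr_ge0.
  case: (ltrP a) => [h|_]/=; last by rewrite addr_ge0 ?ler0n.
  case: ltrP => /= h'; first by rewrite lerDl.
  have h2 : a / 2 <= `|T f0 w|.
    by have := ler_normD (T f1 w) (T f0 w); rewrite -TE; lra.
  rewrite add0r mulrAC ler_pdivlMr ?exprn_gt0// mul1r.
  by rewrite -[T f0 w ^+ 2]real_normK ?num_real//; nra.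
apply: lerD.
  by rewrite mulrAC ler_pdivlMr//; lra.
rewrite [leRHS](_ : _ = 4 / a ^+ 2 * (M * \sum_z f0 z ^+ 2)); last by ring.
by rewrite ler_wpM2l ?divr_ge0 ?sqr_ge0.
Qed.

Theorem marcinkiewicz (p : R) f : 1 < p -> p < 2 ->
  \sum_z `|T f z| `^ p <=
  2 `^ p * (2 * C * geom_const (p - 1) + 4 * M * geom_const (2 - p)) *
  \sum_z `|f z| `^ p.
Proof.
move=> p1 p2; have p0 : 0 < p by lra.
(* Since [X] is finite, the nonzero values of [|T f|] lie between some [e] and [e * 2 ^+ n]. The
   layer-cake integral can therefore be replaced by a finite sum over dyadic levels: the largest
   level below a value is at least half of it, whence the factor $2^p$. *)
have [e e0 he] : exists2 e : R, 0 < e & forall z, T f z != 0 -> e < `|T f z|.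
  pose e := \big[Num.min/1]_(z | T f z != 0) (`|T f z| / 2).
  have e0 : 0 < e.
    apply: (big_ind (fun x : R => 0 < x)) => // [x y x0 y0|z nz];
      first by rewrite lt_min x0.
    by rewrite divr_gt0// normr_gt0.
  exists (e / 2) => [|z nz]; first by rewrite divr_gt0.
  have : e <= `|T f z| / 2 by apply: bigmin_le_cond.
  by lra.
have [n hn] : exists n, forall z, `|T f z| <= e * 2 ^+ n.
  pose b := \big[Num.max/0]_z `|T f z|.
  have [n hn] : exists n, b / e <= n%:R.
    by exists (Num.truncn (b / e)).+1; rewrite ltW// truncnS_gt.
  exists n => z; apply: (@le_trans _ _ b); first exact: le_bigmax.
  rewrite mulrC -ler_pdivrMr//; apply: le_trans hn _.
  by rewrite -natrX ler_nat ltnW// ltn_expl.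
have b_gt0 i : 0 < e * 2 ^+ i by rewrite mulr_gt0// exprn_gt0.
have pointwise z :
    `|T f z| `^ p <= 2 `^ p * \sum_(i < n | e * 2 ^+ i < `|T f z|) (e * 2 ^+ i) `^ p.
  have [->|nz] := eqVneq (T f z) 0.
    rewrite normr0 powR0 ?gt_eqF// mulr_ge0 ?powR_ge0//.
    by apply: sumr_ge0 => i _; rewrite powR_ge0.
  have : e * 2 ^+ 0 < `|T f z| by rewrite expr0 mulr1 he.
  have := hn z; elim: n {hn} => [|m IH] hm h0.
    by have := le_lt_trans hm h0; rewrite ltxx.
  rewrite big_mkcond big_ord_recr/= -big_mkcond/=; case: ltrP => /= h.
    rewrite mulrDr -[leLHS]add0r lerD//.
      by rewrite mulr_ge0 ?powR_ge0//; apply: sumr_ge0 => i _; rewrite powR_ge0.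
    rewrite -powRM ?(ltW (b_gt0 _))//.
    have b_ge0 := ltW (b_gt0 m).
    apply: ge0_ler_powR; rewrite ?nnegrE ?(ltW p0)//.
      by rewrite mulr_ge0.
    by move: hm; rewrite exprS mulrCA.
  by rewrite addr0; apply: IH.
apply: (@le_trans _ _ (\sum_z 2 `^ p *
    \sum_(i < n | e * 2 ^+ i < `|T f z|) (e * 2 ^+ i) `^ p)).
  exact: ler_sum.
rewrite -mulr_sumr -[leRHS]mulrA ler_pM2l ?powR_gt0//.
rewrite [leLHS](_ : _ = \sum_(i < n) (e * 2 ^+ i) `^ p *
    #|[pred w | e * 2 ^+ i < `|T f w|]|%:R); last first.
  under [LHS]eq_bigr do rewrite big_mkcond/=.
  rewrite exchange_big/=; apply: eq_bigr => i _.
  rewrite -sum_indicator_card mulr_sumr; apply: eq_bigr => z _ /=.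
  by case: ifP; rewrite ?mulr1 ?mulr0.
(* Contribution of one point after the sums over levels and points are exchanged. Levels below
   [|f z|] carry the exponent [p - 1 > 0], levels above it [p - 2 < 0]; this is where [1 < p < 2]
   makes both geometric sums converge. *)
pose F z := 2 * C * (`|f z| * \sum_(i < n | e * 2 ^+ i < `|f z|) (e * 2 ^+ i) `^
  (p - 1))
  + 4 * M * (`|f z| ^+ 2 * \sum_(i < n | `|f z| <= e * 2 ^+ i) (e * 2 ^+ i) `^
    (- (2 - p))).
apply: (@le_trans _ _ (\sum_z F z)).
  rewrite /F big_split/= -!mulr_sumr.
  apply: (@le_trans _ _ (\sum_(i < n) (
      2 * C * (\sum_(z | e * 2 ^+ i < `|f z|) `|f z| * (e * 2 ^+ i) `^ (p - 1)) +
      4 * M * (\sum_(z | `|f z| <= e * 2 ^+ i) `|f z| ^+ 2 * (e * 2 ^+ i) `^ (-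
        (2 - p)))))).
    apply: ler_sum => i _; move: (e * 2 ^+ i) (b_gt0 i) => b b0.
    apply: le_trans (ler_wpM2l (powR_ge0 _ _) (level_count f b0)) _.
    rewrite -!mulr_suml mulrDr powRB ?gt_eqF ?implybT// powRr1 ?(ltW b0)//.
    rewrite opprB powRB ?(gt_eqF b0) ?implybT// (powR_mulrn 2)// ?(ltW b0)//.
    by rewrite le_eqVlt; apply/orP; left; apply/eqP; ring.
  rewrite big_split/= -!mulr_sumr le_eqVlt; apply/orP; left; apply/eqP.
  congr (_ * _ + _ * _).
    under [LHS]eq_bigr do rewrite big_mkcond/=.
    rewrite exchange_big/=; apply: eq_bigr => z _.
    by rewrite [in RHS]big_mkcond mulr_sumr; apply: eq_bigr => i _; case: ifP;
      rewrite ?mulr0.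
  under [LHS]eq_bigr do rewrite big_mkcond/=.
  rewrite exchange_big/=; apply: eq_bigr => z _.
  by rewrite [in RHS]big_mkcond mulr_sumr; apply: eq_bigr => i _; case: ifP;
    rewrite ?mulr0.
rewrite mulr_sumr; apply: ler_sum => z _; rewrite /F [leRHS]mulrDl.
have [->|nz] := eqVneq `|f z| 0.
  by rewrite !mul0r expr0n/= !mul0r !mulr0 addr0 powR0 ?gt_eqF// !mulr0 ?add0r.
have y0 : 0 < `|f z| by rewrite lt_neqAle eq_sym nz normr_ge0.
have q1 : 0 < p - 1 by rewrite subr_gt0.
have q2 : 0 < 2 - p by rewrite subr_gt0.
apply: lerD.
  rewrite -[leRHS]mulrA ler_wpM2l ?mulr_ge0// -(mulr_powRB1 (ltW y0) p0).
  by rewrite mulrCA ler_pM2l//; apply: geom_sum_below => //; exact: ltW.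
rewrite -[leRHS]mulrA ler_wpM2l ?mulr_ge0//.
have -> : `|f z| `^ p = `|f z| ^+ 2 * `|f z| `^ (- (2 - p)).
  by rewrite -powR_mulrn ?ltW// -powRD ?nz ?implybT//; congr (_ `^ _); ring.
by rewrite mulrCA ler_pM2l ?exprn_gt0//; apply: geom_sum_above.
Qed.

End Marcinkiewicz.

(** The test function [psi] satisfies $|\psi|^q = |Tf|^p$. Young's inequality with the weight [e],
    chosen so that $e^q = 1/(2C)$, bounds the term with [T' psi] by half of [S], which is then
    absorbed on the left. *)
Theorem lp_duality {R : realType} {X : finType} (T T' : (X -> R) -> X -> R)
    (C p q : R) : adjoint_ops T T' -> 0 < C -> 1 < p -> q = p / (p - 1) ->
  (forall g, \sum_z `|T' g z| `^ q <= C * \sum_z `|g z| `^ q) ->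
  forall f, \sum_z `|T f z| `^ p
    <= 2 * (2 * C) `^ (p / q) * \sum_z `|f z| `^ p.
Proof.
move=> adjT C0 p1 qE Tq f.
have p0 : 0 < p by lra.
have p10 : 0 < p - 1 by lra.
have q0 : 0 < q by rewrite qE divr_gt0.
have q1 : 1 < q by rewrite qE ltr_pdivlMr// mul1r; lra.
have pq1 : p^-1 + q^-1 = 1.
  by rewrite qE; field; rewrite !gt_eqF.
set S := \sum_z `|T f z| `^ p; set N := \sum_z `|f z| `^ p.
pose psi z := Num.sg (T f z) * `|T f z| `^ (p - 1).
have SE : S = \sum_z T f z * psi z.
  apply: eq_bigr => z _; rewrite /psi mulrA -[T f z * _]mulrC -normrEsg.
  by rewrite mulr_powRB1.
have psiS : \sum_z `|psi z| `^ q = S.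
  apply: eq_bigr => z _; rewrite /psi normrM normr_sg.
  have [->|nz] := eqVneq (T f z) 0.
    by rewrite mul0r normr0 !powR0// gt_eqF.
  rewrite mul1r ger0_norm ?powR_ge0// -powRrM; congr (_ `^ _).
  by rewrite qE; field; rewrite gt_eqF.
pose e := (2 * C) `^ (- q^-1).
have CC : 0 < 2 * C by rewrite mulr_gt0.
have e0 : 0 < e by rewrite powR_gt0.
have eq : e `^ q = (2 * C)^-1.
  by rewrite /e -powRrM mulNr mulVf ?gt_eqF// powR_inv1 ?ltW.
have ep : e^-1 `^ p = (2 * C) `^ (p / q).
  by rewrite /e -powRN opprK -powRrM [q^-1 * p]mulrC.
have S_ge0 : 0 <= S by apply: sumr_ge0 => z _; apply: powR_ge0.
have N_ge0 : 0 <= N by apply: sumr_ge0 => z _; apply: powR_ge0.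
suff : S <= (2 * C) `^ (p / q) * N + S / 2 by rewrite -mulrA; lra.
rewrite {1}SE adjT.
apply: (@le_trans _ _ (\sum_z (e^-1 `^ p * `|f z| `^ p + e `^ q * `|T' psi z| `^ q))).
  apply: ler_sum => z _; apply: le_trans (ler_norm _) _; rewrite normrM.
  have -> : `|f z| * `|T' psi z| = (e^-1 * `|f z|) * (e * `|T' psi z|).
    by field; rewrite gt_eqF.
  have a0 : 0 <= e^-1 * `|f z| by rewrite mulr_ge0// invr_ge0 ltW.
  have b0 : 0 <= e * `|T' psi z| by rewrite mulr_ge0// ltW.
  apply: le_trans (conjugate_powR a0 b0 p0 q0 pq1) _.
  rewrite !powRM ?invr_ge0 ?(ltW e0)//.
  apply: lerD; rewrite ler_piMr ?mulr_ge0 ?powR_ge0// invf_le1// ltW//.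
rewrite big_split/= -!mulr_sumr ep lerD// eq.
have := Tq psi; rewrite psiS => h.
rewrite mulrC ler_pdivrMr//; lra.
Qed.

(** * Reverse Poincare inequality for the inhomogeneous walk *)

Section Walk.
Context {R : realType} {d d1 : nat}.
Variables (l : 'I_d1 -> 'rV[int]_d) (rho : R).
Implicit Types (phi psi : 'rV[int]_d -> R) (w : 'I_d1 -> R) (x y v : 'rV[int]_d).

Definition walk_step w phi : 'rV[int]_d -> R :=
  fun x => phi x + rho * \sum_(k < d1) w k * sdiff (l k) phi x.

Definition nbr_sum phi : 'rV[int]_d -> R :=
  fun x => phi x + \sum_(k < d1) (phi (x + l k) + phi (x - l k)).

Definition is_step v := exists k, v = l k \/ v = - l k.

(** Propagator from time [s] to time [s + m] for the rates [W]; the latest step is the outermost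
    one. *)
Fixpoint heat_flow (W : nat -> 'I_d1 -> R) (s m : nat) phi : 'rV[int]_d -> R :=
  if m is m'.+1 then walk_step (W (s + m')%N) (heat_flow W s m' phi) else phi.

Lemma walk_stepE w phi x : walk_step w phi x =
  (1 - 2 * rho * \sum_k w k) * phi x +
  \sum_k rho * w k * (phi (x + l k) + phi (x - l k)).
Proof.
rewrite /walk_step mulrBl mul1r -addrA; congr (_ + _).
rewrite mulr_sumr [in RHS]mulr_sumr mulr_suml -sumrN -big_split/=.
by apply: eq_bigr => k _; rewrite /sdiff; ring.
Qed.

Lemma walk_step_sum w (I : Type) (r : seq I) (P : pred I) (F : I -> 'rV[int]_d -> R) x :
  walk_step w (fun y => \sum_(i <- r | P i) F i y) x =
  \sum_(i <- r | P i) walk_step w (F i) x.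
Proof.
rewrite /walk_step big_split/= -mulr_sumr; congr (_ + _ * _).
rewrite exchange_big/=; apply: eq_bigr => k _; rewrite -mulr_sumr.
by rewrite /sdiff !big_split/= sumrN -mulr_sumr.
Qed.

Lemma walk_stepD w phi psi x :
  walk_step w (fun y => phi y + psi y) x = walk_step w phi x + walk_step w psi x.
Proof.
rewrite /walk_step addrACA -mulrDr -big_split/=; congr (_ + _ * _).
by apply: eq_bigr => k _; rewrite /sdiff; ring.
Qed.

Lemma walk_stepZ w c phi x :
  walk_step w (fun y => c * phi y) x = c * walk_step w phi x.
Proof.
rewrite /walk_step mulrDr mulrCA [c * \sum_k _]mulr_sumr; congr (_ + _ * _).
by apply: eq_bigr => k _; rewrite /sdiff; ring.
Qed.

Lemma walk_step_cst w c x : walk_step w (fun=> c) x = c.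
Proof.
rewrite /walk_step big1 ?mulr0 ?addr0// => k _.
by rewrite /sdiff; ring.
Qed.

Lemma walk_stepB w phi psi x :
  walk_step w (fun y => phi y - psi y) x = walk_step w phi x - walk_step w psi x.
Proof.
rewrite -[- walk_step _ _ _]mulN1r -walk_stepZ -walk_stepD.
by congr (walk_step _ _ _); apply/funext => y; rewrite mulN1r.
Qed.

Lemma walk_step_shift w phi v x :
  walk_step w (fun y => phi (y + v)) x = walk_step w phi (x + v).
Proof.
rewrite /walk_step; congr (_ + _ * _); apply: eq_bigr => k _.
by rewrite /sdiff ![x + _ + v]addrAC.
Qed.

Lemma walk_step_fdiff w v phi :
  walk_step w (fdiff v phi) = fdiff v (walk_step w phi).
Proof.
by apply/funext => x; rewrite /fdiff walk_stepB walk_step_shift.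
Qed.

Lemma walk_step_nbr_sum w phi x :
  walk_step w (nbr_sum phi) x = nbr_sum (walk_step w phi) x.
Proof.
rewrite /nbr_sum walk_stepD walk_step_sum; congr (_ + _).
by apply: eq_bigr => k _; rewrite walk_stepD !walk_step_shift.
Qed.

Lemma heat_flow_fdiff W s m v phi :
  heat_flow W s m (fdiff v phi) = fdiff v (heat_flow W s m phi).
Proof. by elim: m => [//|m IH]/=; rewrite IH walk_step_fdiff. Qed.

Lemma heat_flow_comp W s m n phi :
  heat_flow W s (m + n) phi = heat_flow W (s + m) n (heat_flow W s m phi).
Proof.
by elim: n => [|n IH]; [rewrite addn0|rewrite addnS/= IH addnA].
Qed.

Lemma fdiffC u v phi : fdiff u (fdiff v phi) = fdiff v (fdiff u phi).
Proof.
by apply/funext => x; rewrite /fdiff [x + u + v]addrAC; ring.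
Qed.

Lemma nbr_sumD phi psi x :
  nbr_sum (fun y => phi y + psi y) x = nbr_sum phi x + nbr_sum psi x.
Proof.
rewrite /nbr_sum addrACA -big_split/=; congr (_ + _).
by apply: eq_bigr => k _; ring.
Qed.

Lemma nbr_sumZ c phi x : nbr_sum (fun y => c * phi y) x = c * nbr_sum phi x.
Proof.
rewrite /nbr_sum mulrDr mulr_sumr; congr (_ + _).
by apply: eq_bigr => k _; ring.
Qed.

Lemma nbr_sum_cst c x : nbr_sum (fun=> c) x = (2 * d1%:R + 1) * c.
Proof.
rewrite /nbr_sum sumr_const card_ord -mulr_natr; ring.
Qed.

Lemma nbr_sum_le phi psi x : (forall y, phi y <= psi y) ->
  nbr_sum phi x <= nbr_sum psi x.
Proof. by move=> h; rewrite lerD//; apply: ler_sum => k _; rewrite lerD. Qed.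

Lemma nbr_sum_ge phi x v : (forall y, 0 <= phi y) -> is_step v ->
  phi x + phi (x + v) <= nbr_sum phi x.
Proof.
move=> h [k vE]; rewrite lerD2l (bigD1 k)//= -[leLHS]addr0 lerD//; last first.
  by apply: sumr_ge0 => j _; rewrite addr_ge0.
by case: vE => ->; rewrite ?lerDl ?lerDr.
Qed.

(** * Positivity, variance and second moments under uniform bounds on the rates *)

Section Elliptic.
Variables (ds1 ds2 : R).
Hypotheses (d1_gt0 : (0 < d1)%N) (ds1_gt0 : 0 < ds1) (rho_gt0 : 0 < rho).
Hypothesis rho_lt : rho < (2 * d1%:R * ds2)^-1.

Definition admissible w := forall k, ds1 <= w k <= ds2.

(** Lower bound, over all admissible rates, of the coefficient of [phi x] in [walk_stepE]; for
    [0 < ds2] its positivity is exactly the restriction on [rho]. *)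
Definition hold_prob : R := 1 - 2 * rho * (d1%:R * ds2).
Definition var_const : R := Num.min hold_prob (rho * ds1) / 2.

Lemma ds2_gt0 w : admissible w -> 0 < ds2.
Proof.
by move=> /(_ (Ordinal d1_gt0))/andP[h1 h2]; apply: lt_le_trans (le_trans h1 h2).
Qed.

Lemma hold_prob_gt0 : 0 < ds2 -> 0 < hold_prob.
Proof.
move=> h2; have d1R : 0 < d1%:R :> R by rewrite ltr0n.
have h : 0 < 2 * d1%:R * ds2 by rewrite !mulr_gt0.
by move: rho_lt; rewrite -[_^-1]mul1r ltr_pdivlMr// /hold_prob; lra.
Qed.

Lemma hold_prob_le w : admissible w -> hold_prob <= 1 - 2 * rho * \sum_k w k.
Proof.
move=> aw; rewrite lerD2l lerN2 ler_pM2l ?mulr_gt0//.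
rewrite mulr_natl -[X in _ *+ X]card_ord -sumr_const.
by apply: ler_sum => k _; case/andP: (aw k).
Qed.

Lemma var_const_gt0 : 0 < ds2 -> 0 < var_const.
Proof.
by move=> h; rewrite divr_gt0// lt_min hold_prob_gt0//= mulr_gt0.
Qed.

Lemma walk_step_ge0 w phi x : admissible w -> (forall y, 0 <= phi y) ->
  0 <= walk_step w phi x.
Proof.
move=> aw h; rewrite walk_stepE addr_ge0// ?mulr_ge0//.
  by rewrite ltW// (lt_le_trans _ (hold_prob_le aw))// hold_prob_gt0// (ds2_gt0 aw).
apply: sumr_ge0 => k _; rewrite !mulr_ge0 ?addr_ge0// ?(ltW rho_gt0)//.
by case/andP: (aw k) => /(lt_le_trans ds1_gt0)/ltW.
Qed.

Lemma walk_step_le w phi psi x : admissible w -> (forall y, phi y <= psi y) ->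
  walk_step w phi x <= walk_step w psi x.
Proof.
move=> aw h; rewrite -subr_ge0 -walk_stepB walk_step_ge0// => y.
by rewrite subr_ge0.
Qed.

Lemma walk_step_ge w phi x v : admissible w -> (forall y, 0 <= phi y) ->
  is_step v ->
  hold_prob * phi x + rho * ds1 * phi (x + v) <= walk_step w phi x.
Proof.
move=> aw h [k vE]; rewrite walk_stepE lerD ?ler_wpM2r ?hold_prob_le//.
have w_ge0 j : 0 <= rho * w j.
  by case/andP: (aw j) => /(lt_le_trans ds1_gt0)/ltW w0 _; rewrite mulr_ge0// ltW.
rewrite (bigD1 k)//= -[leLHS]addr0 lerD//; last first.
  by apply: sumr_ge0 => j _; rewrite mulr_ge0// addr_ge0.
have wk : rho * ds1 <= rho * w k by rewrite ler_pM2l//; case/andP: (aw k).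
have t0 y : 0 <= rho * w k * phi y := mulr_ge0 (w_ge0 k) (h y).
have t1 y : rho * ds1 * phi y <= rho * w k * phi y by rewrite ler_wpM2r.
rewrite mulrDr; have := (t0 (x + l k), t0 (x - l k)).
by case: vE => -> [u1 u2]; have := (t1 (x + l k), t1 (x - l k)) => -[]; lra.
Qed.

Lemma walk_step_le_nbr_sum w phi x : admissible w -> (forall y, 0 <= phi y) ->
  walk_step w phi x <= nbr_sum phi x.
Proof.
move=> aw h; have s2 := ds2_gt0 aw.
have w_ge0 j : 0 <= w j.
  by case/andP: (aw j) => /(lt_le_trans ds1_gt0)/ltW.
rewrite walk_stepE lerD//.
  rewrite ler_piMl// gerBl !mulr_ge0 ?(ltW rho_gt0)//.
  by apply: sumr_ge0 => k _.
apply: ler_sum => k _; rewrite ler_piMl ?addr_ge0//.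
have := hold_prob_gt0 s2; rewrite /hold_prob => hp.
have /andP[_ wk] := aw k.
have d1R : 1 <= d1%:R :> R by rewrite ler1n.
have : rho * w k <= rho * (d1%:R * ds2).
  by rewrite ler_pM2l// (le_trans wk)// ler_peMl// ltW.
have : 0 <= rho * (d1%:R * ds2) by rewrite !mulr_ge0 ?(ltW rho_gt0) ?(ltW s2).
by lra.
Qed.

(** The variance of [phi] under one step is at least the part carried by the two points [x] and
    [x + v], whose masses are at least [hold_prob] and [rho * ds1]. With both masses lowered to
    their minimum [m], the inequality $(a-c)^2+(b-c)^2 \ge (a-b)^2/2$ gives the constant [m / 2]. *)
Lemma walk_step_variance w phi x v : admissible w -> is_step v ->
  walk_step w phi x ^+ 2 + var_const * fdiff v phi x ^+ 2 <=
  walk_step w (fun y => phi y ^+ 2) x.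
Proof.
move=> aw dv; set c := walk_step w phi x.
have -> : walk_step w (fun y => phi y ^+ 2) x =
    c ^+ 2 + walk_step w (fun y => (phi y - c) ^+ 2) x.
  have -> : (fun y => (phi y - c) ^+ 2) =
      (fun y => phi y ^+ 2 + (- (2 * c) * phi y + c ^+ 2)).
    by apply/funext => y; ring.
  by rewrite !walk_stepD walk_step_cst walk_stepZ -/c; ring.
rewrite lerD2l; apply: le_trans (walk_step_ge x aw _ dv); last first.
  by move=> y; apply: sqr_ge0.
have s2 := ds2_gt0 aw; rewrite /var_const /fdiff.
set m := Num.min _ _.
have m1 : m <= hold_prob by rewrite ge_min lexx.
have m2 : m <= rho * ds1 by rewrite ge_min lexx orbT.
have m0 : 0 <= m by rewrite le_min !ltW ?hold_prob_gt0 ?mulr_gt0.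
move: (phi x) (phi (x + v)) => a b.
have := ler_wpM2r (sqr_ge0 (a - c)) m1.
have := ler_wpM2r (sqr_ge0 (b - c)) m2.
have : m / 2 * (b - a) ^+ 2 <= m * (a - c) ^+ 2 + m * (b - c) ^+ 2.
  rewrite -mulrDr -mulrA ler_wpM2l//.
  by have := sqr_ge0 (a + b - 2 * c); nra.
by lra.
Qed.

Lemma walk_step_jensen w phi x : admissible w ->
  walk_step w phi x ^+ 2 <= walk_step w (fun y => phi y ^+ 2) x.
Proof.
move=> aw; have dv : is_step (l (Ordinal d1_gt0)).
  by exists (Ordinal d1_gt0); left.
apply: le_trans (walk_step_variance phi x aw dv).
by rewrite lerDl mulr_ge0 ?sqr_ge0// ltW// var_const_gt0// (ds2_gt0 aw).
Qed.

Section Flow.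
Variable W : nat -> 'I_d1 -> R.
Hypothesis aW : forall n, admissible (W n).
Let s2 : 0 < ds2 := ds2_gt0 (aW 0).
Let kappa_gt0 := var_const_gt0 s2.

Lemma heat_flow_le s m phi psi : (forall y, phi y <= psi y) ->
  forall x, heat_flow W s m phi x <= heat_flow W s m psi x.
Proof. by move=> h; elim: m => [//|m IH] x /=; apply: walk_step_le. Qed.

(* The gain [var_const * (fdiff v g)^2] of each step is averaged by the later
   steps; [nbr_sum] dominates every one of the time-dependent averages. *)
Lemma reverse_poincare_aux s m phi v x : is_step v ->
  var_const * m%:R * fdiff v (heat_flow W s m phi) x ^+ 2
    + nbr_sum (fun y => heat_flow W s m phi y ^+ 2) x
  <= nbr_sum (heat_flow W s m (fun y => phi y ^+ 2)) x.
Proof.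
move=> dv; elim: m x => [|m IH] x; first by rewrite mulr0 mul0r add0r.
set g := heat_flow W s m phi in IH *.
have aw := aW (s + m); rewrite [heat_flow W s m.+1]/=.
rewrite -/g -walk_step_nbr_sum -walk_step_fdiff.
apply: (le_trans _ (walk_step_le (phi := fun y => var_const * m%:R *
  fdiff v g y ^+ 2 + nbr_sum (fun z => g z ^+ 2) y) _ aw IH)).
rewrite [leRHS]walk_stepD (walk_stepZ _ (var_const * m%:R)) walk_step_nbr_sum -/g.
set D := walk_step (W (s + m)%N) (fdiff v g) x ^+ 2.
have hD : D <= walk_step (W (s + m)%N) (fun y => fdiff v g y ^+ 2) x.
  exact: walk_step_jensen.
have h1 : var_const * m%:R * D <=
    var_const * m%:R * walk_step (W (s + m)%N) (fun y => fdiff v g y ^+ 2) x.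
  by rewrite ler_wpM2l// mulr_ge0 ?ler0n// ltW.
have h2 : nbr_sum (fun y => walk_step (W (s + m)%N) g y ^+ 2) x +
    var_const * nbr_sum (fun y => fdiff v g y ^+ 2) x <=
    nbr_sum (walk_step (W (s + m)%N) (fun y => g y ^+ 2)) x.
  rewrite -nbr_sumZ -nbr_sumD; apply: nbr_sum_le => y.
  exact: walk_step_variance.
have h3 : var_const * D <= var_const * nbr_sum (fun y => fdiff v g y ^+ 2) x.
  rewrite ler_pM2l//; apply: le_trans hD _.
  by apply: walk_step_le_nbr_sum => // y; apply: sqr_ge0.
rewrite -natr1; lra.
Qed.

Lemma reverse_poincare s m phi v x : is_step v ->
  m.+1%:R * fdiff v (heat_flow W s m phi) x ^+ 2 <=
  (var_const^-1 + 2) * nbr_sum (heat_flow W s m (fun y => phi y ^+ 2)) x.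
Proof.
move=> dv; have := reverse_poincare_aux s m phi x dv.
set Z := nbr_sum (heat_flow _ _ _ _) _; set D := fdiff _ _ _ ^+ 2.
set Q := nbr_sum _ _ => h.
(* This trivial bound turns the factor [m] of the auxiliary inequality into [m.+1], at the price of
   the summand 2 in the constant, and so covers [m = 0]. *)
have D_le : D <= 2 * Q.
  apply: (@le_trans _ _ (2 * (heat_flow W s m phi x ^+ 2
      + heat_flow W s m phi (x + v) ^+ 2))).
    rewrite /D /fdiff; have := sqr_ge0 (heat_flow W s m phi (x + v) + heat_flow
      W s m phi x).
    nra.
  by rewrite ler_pM2l// /Q; apply: (nbr_sum_ge x _ dv) => y; apply: sqr_ge0.
have D_ge0 : 0 <= D by apply: sqr_ge0.
have kD : 0 <= var_const * m%:R * D.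
  exact: mulr_ge0 (mulr_ge0 (ltW kappa_gt0) (ler0n _ _)) D_ge0.
have h1 : m%:R * D <= var_const^-1 * Z.
  rewrite [leRHS]mulrC ler_pdivlMr//; move: h D_le; lra.
rewrite -natr1; move: h h1 D_le; lra.
Qed.

Definition dist2 x y : R := \sum_(i < d) ((y 0 i - x 0 i)%:~R) ^+ 2.

Lemma dist2_ge0 x y : 0 <= dist2 x y.
Proof. by apply: sumr_ge0 => i _; apply: sqr_ge0. Qed.

Lemma dist2xx x : dist2 x x = 0.
Proof. by apply: big1 => i _; rewrite subrr expr0n. Qed.

Definition norm2 v : R := \sum_(i < d) ((v 0 i)%:~R) ^+ 2.

Lemma dist2_parallelogram x y v :
  dist2 x (y + v) + dist2 x (y - v) = 2 * dist2 x y + 2 * norm2 v.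
Proof.
rewrite /dist2 /norm2 !mulr_sumr -!big_split/=; apply: eq_bigr => i _.
by rewrite !mxE !(rmorphB, rmorphD)/= ; ring.
Qed.

Definition steps_norm2 : R := \sum_k norm2 (l k).

Lemma steps_norm2_ge0 : 0 <= steps_norm2.
Proof.
by apply: sumr_ge0 => k _; apply: sumr_ge0 => i _; apply: sqr_ge0.
Qed.

Lemma nbr_sum_dist2 x y :
  nbr_sum (dist2 x) y = (2 * d1%:R + 1) * dist2 x y + 2 * steps_norm2.
Proof.
rewrite /nbr_sum; under eq_bigr do rewrite dist2_parallelogram.
rewrite big_split/= sumr_const card_ord -mulr_sumr -/steps_norm2.
by rewrite -[_ *+ d1]mulr_natr; ring.
Qed.

(** The second difference of [dist2 x] along [v] is the constant [2 * norm2 v], so every step adds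
    at most one and the same amount: the walk is diffusive. *)
Lemma heat_flow_dist2 s m x y : heat_flow W s m (dist2 x) y <=
  dist2 x y + m%:R * (2 * rho * ds2 * steps_norm2).
Proof.
elim: m y => [|m IH] y; first by rewrite mul0r addr0.
apply: le_trans (walk_step_le _ (aW _) IH) _.
rewrite walk_stepD walk_step_cst -natr1.
suff : walk_step (W (s + m)%N) (dist2 x) y <=
    dist2 x y + 2 * rho * ds2 * steps_norm2 by lra.
rewrite /walk_step lerD2l -[2 * rho]mulrC -!mulrA ler_pM2l//.
rewrite /steps_norm2 !mulr_sumr; apply: ler_sum => k _.
rewrite /sdiff addrAC dist2_parallelogram addrAC subrr add0r mulrCA ler_pM2l//.
have /andP[_ wk] := aW (s + m) k.
by rewrite ler_wpM2r//; apply: sumr_ge0 => i _; apply: sqr_ge0.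
Qed.

Lemma heat_flow_add s m phi psi x : heat_flow W s m (fun y => phi y + psi y) x =
  heat_flow W s m phi x + heat_flow W s m psi x.
Proof.
elim: m x => [//|m IH] x /=; rewrite -walk_stepD; congr (walk_step _ _ _).
exact/funext.
Qed.

Lemma heat_flowZ s m c phi x :
  heat_flow W s m (fun y => c * phi y) x = c * heat_flow W s m phi x.
Proof.
elim: m x => [//|m IH] x /=; rewrite -walk_stepZ; congr (walk_step _ _ _).
exact/funext.
Qed.

Lemma heat_flow_cst s m c x : heat_flow W s m (fun=> c) x = c.
Proof.
elim: m x => [//|m IH] x /=; rewrite -[RHS](walk_step_cst (W (s + m)%N) c x).
by congr (walk_step _ _ _); exact/funext.
Qed.

End Flow.

Definition moment_const : R :=
  (var_const^-1 + 2) *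
  ((2 * d1%:R + 1) * (1 + 2 * rho * ds2 * steps_norm2) + 2 * steps_norm2).

Lemma moment_const_ge0 : 0 < ds2 -> 0 <= moment_const.
Proof.
move=> s2; have k0 := var_const_gt0 s2; have n0 := steps_norm2_ge0.
by rewrite /moment_const !(mulr_ge0, addr_ge0) ?invr_ge0 ?ler0n ?(ltW k0) ?(ltW
  rho_gt0) ?(ltW s2).
Qed.

(** Reverse Poincare followed by the linear growth of second moments. With [b = 0] it yields the
    decay of differences of bounded data; with [b > 0] it keeps track of data that are small near
    [x]. The quadratic shape of the bound is preserved, so the estimate can be iterated. *)
Lemma fdiff_flow_weighted W (aW : forall n, admissible (W n)) s m phi v x y a b :
  is_step v -> 0 <= a -> 0 <= b -> (forall z, phi z ^+ 2 <= a + b * dist2 x z) ->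
  fdiff v (heat_flow W s m phi) y ^+ 2 <=
  moment_const * (a + b * (m.+1%:R + dist2 x y)) / m.+1%:R.
Proof.
move=> dv a0 b0 h; have s2 := ds2_gt0 (aW 0).
rewrite ler_pdivlMr ?ltr0n// mulrC.
apply: le_trans (reverse_poincare aW s m phi y dv) _.
rewrite /moment_const -[leRHS]mulrA ler_wpM2l//.
  by rewrite addr_ge0// invr_ge0 ltW// var_const_gt0.
have n0 := steps_norm2_ge0.
set D := 2 * rho * ds2 * steps_norm2.
have D0 : 0 <= D by rewrite !mulr_ge0 ?(ltW rho_gt0) ?(ltW s2).
apply: (@le_trans _ _ (nbr_sum (fun z => (a + b * (m%:R * D)) + b * dist2 x z) y)).
  apply: nbr_sum_le => z.
  apply: (@le_trans _ _ (heat_flow W s m (fun z => a + b * dist2 x z) z)).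
    exact: heat_flow_le.
  rewrite heat_flow_add heat_flow_cst heat_flowZ -addrA lerD2l -mulrDr ler_wpM2l//.
  by rewrite addrC heat_flow_dist2.
rewrite nbr_sumD nbr_sum_cst nbr_sumZ nbr_sum_dist2.
have q0 := dist2_ge0 x y; have m0 : 0 <= m%:R :> R by rewrite ler0n.
have d0 : 0 <= d1%:R :> R by rewrite ler0n.
rewrite -(natr1 m); move: (dist2 x y) q0 => q q0; move: (m%:R : R) m0 => n n0'.
set e := 2 * d1%:R + 1; have e0 : 0 <= e by rewrite /e; lra.
rewrite -subr_ge0 [leRHS](_ : _ = e * (D * a) + e * (b * n) + e * b + e * (b *
  (D * q)) + e * (b * D) + 2 * steps_norm2 * a + 2 * steps_norm2 * b * n
   + 2 * steps_norm2 * b * q); last by ring.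
by clearbody D e; rewrite !addr_ge0 ?mulr_ge0//.
Qed.

End Elliptic.
End Walk.

(** * Oscillation of solutions *)

Section RealSums.
Context {R : realType}.

(** Tail sums are evaluated by a discrete primitive [g]. Index [m] stands for age [m.+1], as a
    source is at least one step old when it is first seen. *)
Lemma telescoping_tail (t g : nat -> R) (H n : nat) : (0 < H)%N ->
  (forall m, t m <= g m.+1 - g m.+2) -> (forall m, 0 <= g m) ->
  \sum_(m < n | (H <= m.+1)%N) t m <= g H.
Proof.
move=> H0 tg g0.
suff h : \sum_(m < n | (H <= m.+1)%N) t m <= g H - g (maxn H n.+1).
  by apply: le_trans h _; rewrite gerBl.
elim: n => [|n IH]; first by rewrite big_ord0 (maxn_idPl _)// subrr.
rewrite big_mkcond big_ord_recr/= -big_mkcond/=; case: leqP => h.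
  move: IH; rewrite !(maxn_idPr _)//; last exact: leq_trans h _.
  by have := tg n; lra.
by rewrite addr0 [maxn H n.+2](maxn_idPl _)//; move: IH; rewrite (maxn_idPl _)// ltnW.
Qed.

Lemma sqrtn_gt0 (m : nat) : 0 < Num.sqrt m.+1%:R :> R.
Proof. by rewrite sqrtr_gt0 ltr0n. Qed.

Lemma sum_inv_sqrt (n : nat) :
  \sum_(m < n) (Num.sqrt m.+2%:R)^-1 <= 2 * Num.sqrt n%:R :> R.
Proof.
elim: n => [|n IH]; first by rewrite big_ord0 sqrtr0 mulr0.
rewrite big_ord_recr/=; apply: le_trans (lerD IH (lexx _)) _.
set a := Num.sqrt n%:R; set b := Num.sqrt n.+1%:R; set c := Num.sqrt n.+2%:R.
have b0 : 0 < b by apply: sqrtn_gt0.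
have bc : b <= c by rewrite ler_sqrt// ler_nat.
have a0 : 0 <= a by apply: sqrtr_ge0.
have a2 : a ^+ 2 = n%:R by rewrite sqr_sqrtr.
have b2 : b ^+ 2 = n%:R + 1 by rewrite sqr_sqrtr// natr1.
have ab : a <= b by rewrite ler_sqrt// ler_nat.
have : c^-1 <= b^-1 by rewrite lef_pV2 ?posrE// (lt_le_trans b0).
suff : b^-1 <= 2 * b - 2 * a by lra.
rewrite -[leLHS]mul1r ler_pdivrMr//; nra.
Qed.

Lemma inv_sqrt3_tele (m : nat) :
  (Num.sqrt m.+2%:R)^-1 ^+ 3 <= 2 * (Num.sqrt m.+1%:R)^-1 - 2 * (Num.sqrt
    m.+2%:R)^-1 :> R.
Proof.
set a := Num.sqrt m.+1%:R; set b := Num.sqrt m.+2%:R.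
have a0 : 0 < a by apply: sqrtn_gt0.
have b0 : 0 < b by apply: sqrtn_gt0.
have a2 : a ^+ 2 = m.+1%:R by rewrite sqr_sqrtr.
have b2 : b ^+ 2 = a ^+ 2 + 1 by rewrite a2 sqr_sqrtr// natr1.
have ab : a <= b by rewrite ler_sqrt// ler_nat.
rewrite -subr_ge0.
have -> : 2 / a - 2 / b - b^-1 ^+ 3 = (2 * (b - a) * b ^+ 2 - a) / (a * b ^+ 3).
  by field; rewrite !gt_eqF.
rewrite divr_ge0//; last by rewrite mulr_ge0 ?exprn_ge0 ?ltW.
have h : (b - a) * (b + a) = 1 by rewrite -subr_sqr b2; ring.
nra.
Qed.

Lemma inv_sqr_tele (m : nat) : m.+2%:R^-1 ^+ 2 <= m.+1%:R^-1 - m.+2%:R^-1 :> R.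
Proof.
rewrite -(natr1 m.+1); have : 0 < m.+1%:R :> R by rewrite ltr0n.
move: (m.+1%:R) => a a0; rewrite -subr_ge0.
have a1 : 0 < a + 1 by lra.
have -> : a^-1 - (a + 1)^-1 - (a + 1)^-1 ^+ 2 = (a * (a + 1) ^+ 2)^-1.
  by field; rewrite !gt_eqF.
by rewrite invr_ge0 mulr_ge0 ?exprn_ge0 ?ltW.
Qed.

Lemma sqr_le_abs (t B : R) : 0 <= B -> t ^+ 2 <= B ^+ 2 -> `|t| <= B.
Proof. by move=> B0 h; rewrite -ler_sqr ?nnegrE// real_normK ?num_real. Qed.

Lemma halves_ge (m : nat) :
  (m.+1%:R <= 2 * (m %/ 2).+1%:R :> R) * (m.+1%:R <= 2 * (m - m %/ 2).+1%:R :> R).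
Proof. by split; rewrite -natrM ler_nat; lia. Qed.

Lemma sum_rev (n : nat) (F : nat -> R) :
  \sum_(j < n) F (n - j)%N = \sum_(m < n) F m.+1.
Proof.
rewrite (reindex_inj rev_ord_inj)/=; apply: eq_bigr => i _.
by rewrite subKn.
Qed.

End RealSums.

Section Lipschitz.
Context {R : realType} {d : nat}.
Implicit Types (g : 'rV[int]_d -> R).

Lemma lipschitz_line g (L : R) i x (k : int) :
  (forall y, `|fdiff (delta_mx 0 i) g y| <= L) ->
  `|g (x + k *: delta_mx 0 i) - g x| <= L * `|k|%:~R.
Proof.
move=> gL; have pos (n : nat) y : `|g (y + n%:Z *: delta_mx 0 i) - g y| <= L * n%:R.
  elim: n => [|n IH]; first by rewrite scale0r addr0 subrr normr0 mulr0.
  rewrite -[n.+1]addn1 PoszD scalerDl scale1r addrA natrD mulrDr mulr1.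
  apply: le_trans (ler_distD (g (y + n%:Z *: delta_mx 0 i)) _ _) _.
  by rewrite [leRHS]addrC lerD//; exact: gL.
case: k => n; first by rewrite (ger0_norm (_ : 0 <= n%:Z))//; apply: pos.
rewrite NegzE normrN (ger0_norm (_ : 0 <= n.+1%:Z))// scaleNr distrC.
by have := pos n.+1 (x - n.+1%:Z *: delta_mx 0 i); rewrite subrK.
Qed.

Lemma lipschitz_lattice g (L : R) x y :
  (forall i z, `|fdiff (delta_mx 0 i) g z| <= L) ->
  `|g y - g x| <= L * \sum_(i < d) `|y 0 i - x 0 i|%:~R.
Proof.
move=> gL.
have path (a : 'I_d -> int) : `|g (x + \sum_(i < d) a i *: delta_mx 0 i) - g x|
    <= L * \sum_(i < d) `|a i|%:~R.
  elim/big_rec2: _ => [|i s z _ IH]; first by rewrite addr0 subrr normr0 mulr0.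
  rewrite mulrDr addrCA [_ + (x + z)]addrC.
  apply: le_trans (ler_distD (g (x + z)) _ _) _.
  by rewrite lerD// lipschitz_line.
have := path (fun i => y 0 i - x 0 i).
suff -> : \sum_(i < d) (y 0 i - x 0 i) *: delta_mx 0 i = y - x.
  by rewrite [x + _]addrC subrK.
by rewrite [RHS]row_sum_delta; apply: eq_bigr => i _; rewrite !mxE.
Qed.

End Lipschitz.

(** * Decay of differences of the heat flow *)

Section FlowBounds.
Context {R : realType} {d d1 : nat}.
Variables (l : 'I_d1 -> 'rV[int]_d) (rho ds1 ds2 : R).
Hypotheses (d1_gt0 : (0 < d1)%N) (ds1_gt0 : 0 < ds1) (rho_gt0 : 0 < rho).
Hypotheses (ds2_gt0 : 0 < ds2) (rho_lt : rho < (2 * d1%:R * ds2)^-1).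
Implicit Types (phi psi : 'rV[int]_d -> R) (x y z v : 'rV[int]_d).

Let c := moment_const l rho ds1 ds2.
Let c_ge0 : 0 <= c. Proof. exact: moment_const_ge0. Qed.

Definition diffs (vs : seq 'rV[int]_d) phi : 'rV[int]_d -> R := foldr fdiff phi vs.

Lemma diffs_sum vs (I : finType) (P : pred I) (F : I -> 'rV[int]_d -> R) x :
  diffs vs (fun y => \sum_(i | P i) F i y) x = \sum_(i | P i) diffs vs (F i) x.
Proof.
elim: vs x => [//|v vs IH] x /=.
by rewrite /fdiff !IH sumrB.
Qed.

Lemma diffs0 vs x : diffs vs (fun=> 0) x = 0.
Proof. by elim: vs x => [//|v vs IH] x /=; rewrite /fdiff !IH subrr. Qed.

Lemma diffsD vs phi psi x :
  diffs vs (fun y => phi y + psi y) x = diffs vs phi x + diffs vs psi x.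
Proof. by elim: vs x => [//|v vs IH] x /=; rewrite /fdiff !IH; ring. Qed.

Section Flow.
Variable W : nat -> 'I_d1 -> R.
Hypothesis aW : forall n, admissible ds1 ds2 (W n).

Let H := heat_flow l rho W.

Lemma heat_flow_diffs vs s m phi : H s m (diffs vs phi) = diffs vs (H s m phi).
Proof.
elim: vs => [//|v vs IH] /=.
by rewrite -[in RHS]IH; exact: heat_flow_fdiff.
Qed.

Fixpoint flow_const (r : nat) : R :=
  if r is r'.+1 then 2 ^+ r'.+1 * c * flow_const r' else 1.

Lemma flow_const_ge0 r : 0 <= flow_const r.
Proof.
by elim: r => [|r IH] //; rewrite [flow_const _]/= mulr_ge0// mulr_ge0// exprn_ge0.
Qed.

(** The elapsed time is halved. Since differences commute with the flow, the outermost one is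
    estimated over the second half, with the remaining differences of the flow over the first half
    as bounded datum. The powers of 2 in [flow_const] pay for the halvings; the case without
    differences is the maximum principle. *)
Lemma diffs_flow_sqr vs s m phi a y :
  (forall v, v \in vs -> is_step l v) -> 0 <= a -> (forall z, phi z ^+ 2 <= a) ->
  diffs vs (H s m phi) y ^+ 2 <= flow_const (size vs) * a / m.+1%:R ^+ size vs.
Proof.
elim: vs s m y => [|v vs IH] s m y steps a0 pa.
  rewrite /= mul1r divr1 /H.
  have pz z : - Num.sqrt a <= phi z <= Num.sqrt a.
    by rewrite -ler_norml; apply: sqr_le_abs; rewrite ?sqrtr_ge0// sqr_sqrtr.
  have le := heat_flow_le l d1_gt0 ds1_gt0 rho_gt0 rho_lt aW s m.
  have h : `|heat_flow l rho W s m phi y| <= Num.sqrt a.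
    rewrite ler_norml; apply/andP; split.
      rewrite -[leLHS](heat_flow_cst l rho W s m _ y).
      by apply: le => z; case/andP: (pz z).
    rewrite -[leRHS](heat_flow_cst l rho W s m _ y).
    by apply: le => z; case/andP: (pz z).
  rewrite -(sqr_sqrtr a0) -[leLHS]real_normK ?num_real//.
  by rewrite ler_sqr ?nnegrE ?sqrtr_ge0.
have vstep : is_step l v by apply: steps; rewrite mem_head.
have {}IH s' m' y' := IH s' m' y' (fun u hu => steps u (mem_behead (s := v ::
  vs) hu)) a0 pa.
have mE : m = (m %/ 2 + (m - m %/ 2))%N by lia.
have [h1 h2] := halves_ge (R := R) m.
rewrite [in leLHS]mE /H heat_flow_comp /= -/H.
set m1 := (m %/ 2)%N in h1 *; set m2 := (m - m1)%N in h2 *.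
rewrite -[diffs vs _]heat_flow_diffs.
set g := diffs vs _; set b := flow_const (size vs) * a / m1.+1%:R ^+ size vs.
have b0 : 0 <= b by rewrite divr_ge0 ?mulr_ge0 ?flow_const_ge0 ?exprn_ge0.
have gb z : g z ^+ 2 <= b + 0 * dist2 0 z by rewrite mul0r addr0; apply: IH.
apply: le_trans (fdiff_flow_weighted d1_gt0 ds1_gt0 rho_gt0 rho_lt aW _ _ _
  vstep b0 (lexx 0) gb) _.
rewrite mul0r addr0 -/c /b.
have p0 : 0 < m.+1%:R :> R by rewrite ltr0n.
have p1 : 0 < m1.+1%:R :> R by rewrite ltr0n.
have p2 : 0 < m2.+1%:R :> R by rewrite ltr0n.
have F0 := flow_const_ge0 (size vs).
have : m.+1%:R ^+ (size vs) <= 2 ^+ (size vs) * m1.+1%:R ^+ (size vs) :> R.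
  by rewrite -exprMn lerXn2r ?nnegrE ?mulr_ge0// ltW.
rewrite !exprS; have X10 := exprn_gt0 (size vs) p1.
have X0 := exprn_gt0 (size vs) p0; have t0 := exprn_gt0 (size vs) (ltr0Sn R 1).
move: X0 X10 t0 p0 p2 h2 F0.
move: (m.+1%:R ^+ size vs) (m1.+1%:R ^+ size vs) (2 ^+ size vs).
move: (flow_const (size vs)) (m.+1%:R : R) (m2.+1%:R : R).
move=> F p p2' X X1 t X0 X10 t0 p0 p20 h2 F0 hX.
rewrite [leLHS](_ : _ = c * F * a * (X1 * p2')^-1); last first.
  by field; rewrite !gt_eqF.
rewrite [leRHS](_ : _ = c * F * a * (2 * t / (p * X))); last first.
  by field; rewrite !gt_eqF.
have cF : 0 <= c * F * a by rewrite mulr_ge0// mulr_ge0.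
rewrite ler_wpM2l// ler_pdivlMr ?mulr_gt0// mulrC ler_pdivrMr ?mulr_gt0//.
rewrite [leRHS](_ : _ = (2 * p2') * (t * X1)); last by ring.
by rewrite ler_pM// ltW.
Qed.

Lemma diffs_flow_abs vs s m phi y :
  (forall v, v \in vs -> is_step l v) -> (forall z, `|phi z| <= 1) ->
  `|diffs vs (H s m phi) y| <=
  Num.sqrt (flow_const (size vs)) * (Num.sqrt m.+1%:R)^-1 ^+ size vs.
Proof.
move=> steps p1; apply: sqr_le_abs.
  by rewrite mulr_ge0 ?exprn_ge0 ?invr_ge0 ?sqrtr_ge0.
apply: le_trans (diffs_flow_sqr s m y steps ler01 _) _.
  by move=> z; rewrite -real_normK ?num_real// exprn_ile1.
rewrite mulr1 exprMn sqr_sqrtr ?flow_const_ge0// exprAC exprVn sqr_sqrtr//.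
by rewrite exprVn.
Qed.

(** Halving again: after the first half the squared difference is at most [c * b] times $1 +
    |x-z|^2/(m_1+1)$, a datum of the same quadratic shape, and the second half is evaluated at the
    centre [x], where the weight vanishes. *)
Lemma diffs2_flow_weighted u v s m phi x b : is_step l u -> is_step l v ->
  0 <= b -> (forall z, phi z ^+ 2 <= b * dist2 x z) ->
  fdiff u (fdiff v (H s m phi)) x ^+ 2 <= 4 * c ^+ 2 * b / m.+1%:R.
Proof.
move=> su sv b0 pb.
have mE : m = (m %/ 2 + (m - m %/ 2))%N by lia.
have [h1 h2] := halves_ge (R := R) m.
rewrite [in leLHS]mE /H heat_flow_comp -heat_flow_fdiff.
set m1 := (m %/ 2)%N in h1 *; set m2 := (m - m1)%N in h2 *.
set g := fdiff v _.
have p0 : 0 < m.+1%:R :> R by rewrite ltr0n.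
have p1 : 0 < m1.+1%:R :> R by rewrite ltr0n.
have p2 : 0 < m2.+1%:R :> R by rewrite ltr0n.
have gb z : g z ^+ 2 <= c * b + c * b / m1.+1%:R * dist2 x z.
  have pb' z' : phi z' ^+ 2 <= 0 + b * dist2 x z' by rewrite add0r.
  apply: le_trans (fdiff_flow_weighted d1_gt0 ds1_gt0 rho_gt0 rho_lt aW _ _ _ sv
    (lexx 0) b0 pb') _.
  rewrite -/c le_eqVlt; apply/orP; left; apply/eqP.
  by field; rewrite ?gt_eqF.
have e0 : 0 <= c * b by rewrite mulr_ge0.
have e1 : 0 <= c * b / m1.+1%:R by rewrite divr_ge0.
apply: le_trans (fdiff_flow_weighted d1_gt0 ds1_gt0 rho_gt0 rho_lt aW _ _ _ su
  e0 e1 gb) _.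
rewrite dist2xx addr0 -/c.
move: h1 h2 p0 p1 p2; move: (m.+1%:R : R) (m1.+1%:R : R) (m2.+1%:R : R) => p q r
  h1 h2 p0 p1 p2.
rewrite [leLHS](_ : _ = c ^+ 2 * b * (r^-1 + q^-1)); last by field; rewrite !gt_eqF.
rewrite [leRHS](_ : _ = c ^+ 2 * b * (4 / p)); last by field; rewrite !gt_eqF.
have cb : 0 <= c ^+ 2 * b by rewrite mulr_ge0// sqr_ge0.
apply: ler_wpM2l => //.
have : r^-1 <= 2 / p by rewrite ler_pdivlMr// mulrC ler_pdivrMr.
have : q^-1 <= 2 / p by rewrite ler_pdivlMr// mulrC ler_pdivrMr.
by move: p^-1 q^-1 r^-1 => p' q' r'; lra.
Qed.

(** A function bounded by 1 and vanishing within distance [h] of [x] satisfies $\phi(z)^2 \le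
    |x-z|^2/h^2$. For ages below $h^2$ the result beats the unweighted $m^{-1}$ decay. *)
Lemma diffs2_flow_offdiag u v s m phi x h : is_step l u -> is_step l v ->
  (0 < h)%N -> (forall z, `|phi z| <= 1) ->
  (forall z, (forall i, `|z 0 i - x 0 i| <= h%:Z) -> phi z = 0) ->
  `|fdiff u (fdiff v (H s m phi)) x| <= 2 * c / h%:R * (Num.sqrt m.+1%:R)^-1.
Proof.
move=> su sv h0 p1 pv; have h0R : 0 < h%:R :> R by rewrite ltr0n.
apply: sqr_le_abs; first by rewrite mulr_ge0 ?invr_ge0 ?sqrtr_ge0// divr_ge0// mulr_ge0.
have pb z : phi z ^+ 2 <= h%:R^-1 ^+ 2 * dist2 x z.
  have [near|] := pselect (forall i, `|z 0 i - x 0 i| <= h%:Z).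
    by rewrite pv// expr0n/= mulr_ge0 ?sqr_ge0 ?dist2_ge0.
  move=> /existsNP[i /negP]; rewrite -ltNge => hi.
  apply: (@le_trans _ _ 1).
    by rewrite -real_normK ?num_real// exprn_ile1.
  rewrite exprVn mulrC ler_pdivlMr ?exprn_gt0// mul1r.
  apply: (@le_trans _ _ ((z 0 i - x 0 i)%:~R ^+ 2)).
    rewrite -[leRHS]real_normK ?num_real// -intr_norm ler_sqr ?nnegrE ?ler0n//.
    by rewrite pmulrn ler_int ltW.
  rewrite /dist2 (bigD1 i)//= lerDl; apply: sumr_ge0 => j _; exact: sqr_ge0.
apply: le_trans (diffs2_flow_weighted s m su sv (sqr_ge0 _) pb) _.
rewrite !exprMn [X in _ <= _ * X]exprVn sqr_sqrtr//.
by rewrite le_eqVlt; apply/orP; left; apply/eqP; ring.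
Qed.

(** The source of time [n'] is added before step [n'] is applied, which matches a sum over [j < n]
    of kernels $G(j,n,\cdot)$ with $n-j \ge 1$. *)
Fixpoint duhamel (psi : nat -> 'rV[int]_d -> R) (n : nat) : 'rV[int]_d -> R :=
  if n is n'.+1 then
    walk_step l rho (W n') (fun x => duhamel psi n' x + psi n' x)
  else fun=> 0.

Lemma duhamelE (psi : nat -> 'rV[int]_d -> R) n x :
  duhamel psi n x = \sum_(j < n) H j (n - j) (psi j) x.
Proof.
elim: n x => [|n IH] x; first by rewrite big_ord0.
rewrite big_ord_recr/= walk_stepD subSnn /H/= addn0; congr (_ + _).
rewrite (_ : duhamel psi n = fun y => \sum_(j < n) H j (n - j) (psi j) y);
  last exact/funext.
rewrite walk_step_sum; apply: eq_bigr => j _.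
have jn : (j <= n)%N by apply: ltnW.
by rewrite subSn//= subnKC.
Qed.

Lemma diffs_duhamel vs (psi : nat -> 'rV[int]_d -> R) n x :
  diffs vs (duhamel psi n) x = \sum_(j < n) diffs vs (H j (n - j) (psi j)) x.
Proof. by rewrite -diffs_sum; congr diffs; apply/funext => y; rewrite duhamelE. Qed.

Lemma duhamelD (psi psi1 psi2 : nat -> 'rV[int]_d -> R) n x :
  (forall j y, psi j y = psi1 j y + psi2 j y) ->
  duhamel psi n x = duhamel psi1 n x + duhamel psi2 n x.
Proof.
move=> psiE; elim: n x => [|n IH] x /=; first by rewrite addr0.
rewrite -walk_stepD; congr (walk_step _ _ _ _ _); apply/funext => y.
by rewrite IH psiE; ring.
Qed.

Lemma diffs_flow_eq0 vs s m phi x : (forall z, phi z = 0) ->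
  diffs vs (H s m phi) x = 0.
Proof.
move=> p0; rewrite -[RHS](diffs0 vs x); congr diffs; apply/funext => y.
rewrite -[RHS](heat_flow_cst l rho W s m 0 y); congr heat_flow.
exact/funext.
Qed.

(** * Oscillation over a parabolic cell of side [h] and duration [h ^ 2] *)

Section Oscillation.
Variables (u v : 'rV[int]_d) (h : nat).
Hypotheses (su : is_step l u) (sv : is_step l v) (h_gt0 : (0 < h)%N).

Let hh := (h ^ 2)%N.
Let hR : 0 < h%:R :> R. Proof. by rewrite ltr0n. Qed.
Let hh_gt0 : (0 < hh)%N. Proof. by rewrite expn_gt0 h_gt0. Qed.
Let ch_ge0 : 0 <= 2 * c / h%:R.
Proof. by rewrite divr_ge0// mulr_ge0// c_ge0. Qed.
Let hhE : hh%:R = h%:R ^+ 2 :> R. Proof. by rewrite /hh natrX. Qed.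

Let c2 := Num.sqrt (flow_const 2).
Let c3 := Num.sqrt (flow_const 3).
Let c4 := Num.sqrt (flow_const 4).

(** Up to age [hh] the vanishing near [x] is used. Beyond it nothing is known to vanish, but the
    plain decay $m^{-1}$ is already at most $h^{-2}$; the sum of the two bounds covers both
    cases. *)
Lemma near_term_bound (psi : nat -> 'rV[int]_d -> R) n x j : (j < n)%N ->
  (forall j y, `|psi j y| <= 1) ->
  (forall z, (n - j <= hh)%N -> (forall i, `|z 0 i - x 0 i| <= h%:Z) -> psi j z = 0) ->
  `|fdiff u (fdiff v (H j (n - j) (psi j))) x| <=
  2 * c / h%:R * (Num.sqrt (n - j).+1%:R)^-1 + c2 / h%:R ^+ 2.
Proof.
move=> jn p1 pv; have c2_ge0 : 0 <= c2 by apply: sqrtr_ge0.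
case: (leqP (n - j) hh) => hj.
  apply: le_trans (diffs2_flow_offdiag _ _ su sv h_gt0 (p1 j) _) _.
    by move=> z; apply: pv.
  by rewrite lerDl divr_ge0 ?exprn_ge0 ?ler0n.
have steps : forall w, w \in [:: u; v] -> is_step l w.
  by move=> w; rewrite !inE => /orP[]/eqP ->.
apply: le_trans (diffs_flow_abs _ _ _ steps (p1 j)) _.
rewrite -[leLHS]add0r lerD//.
  by rewrite mulr_ge0 ?invr_ge0 ?sqrtr_ge0.
rewrite ler_wpM2l// exprVn sqr_sqrtr// lef_pV2 ?posrE ?exprn_gt0 ?ltr0n//.
by rewrite -hhE ler_nat; apply: leq_trans (ltnW hj) _.
Qed.

(** The window has length [2 * hh] because a source of age below [hh] at one time of a cell may have
    any age below [2 * hh] at a later time of it. Over this window $h^{-1}m^{-1/2}$ sums to a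
    constant, and so does $h^{-2}$. *)
Lemma near_sum_bound (psi : nat -> 'rV[int]_d -> R) n x :
  (forall j y, `|psi j y| <= 1) ->
  (forall j z, (j < n)%N -> (n - j <= hh)%N ->
     (forall i, `|z 0 i - x 0 i| <= h%:Z) -> psi j z = 0) ->
  (forall j z, (j + 2 * hh <= n)%N -> psi j z = 0) ->
  `|fdiff u (fdiff v (duhamel psi n)) x| <= 8 * c + 2 * c2.
Proof.
move=> p1 pv p0; have c2_ge0 : 0 <= c2 by apply: sqrtr_ge0.
rewrite -[fdiff u _]/(diffs [:: u; v] _) diffs_duhamel.
pose B m : R := if (m <= 2 * hh)%N then
   2 * c / h%:R * (Num.sqrt m.+1%:R)^-1 + c2 / h%:R ^+ 2 else 0.
have B0 m : 0 <= 2 * c / h%:R * (Num.sqrt m.+1%:R)^-1.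
  by rewrite mulr_ge0 ?invr_ge0 ?sqrtr_ge0.
have B1 : 0 <= c2 / h%:R ^+ 2 by rewrite divr_ge0 ?exprn_ge0 ?ler0n.
apply: (@le_trans _ _ (\sum_(j < n) B (n - j)%N)).
  apply: le_trans (ler_norm_sum _ _ _) _; apply: ler_sum => j _.
  rewrite /B; case: leqP => hj.
    apply: near_term_bound => // z hz zx; exact: pv.
  by rewrite diffs_flow_eq0 ?normr0// => z; apply: p0; lia.
rewrite sum_rev.
apply: (@le_trans _ _ (\sum_(m < 2 * hh) (2 * c / h%:R * (Num.sqrt m.+2%:R)^-1 +
  c2 / h%:R ^+ 2))).
  rewrite (big_ord_widen_cond (maxn n (2 * hh)) xpredT (fun m => B m.+1)) ?leq_maxl//=.
  rewrite (big_ord_widen_cond (maxn n (2 * hh)) xpredT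
    (fun m => 2 * c / h%:R * (Num.sqrt m.+2%:R)^-1 + c2 / h%:R ^+ 2)) ?leq_maxr//=.
  rewrite big_mkcond [leRHS]big_mkcond/=; apply: ler_sum => m _.
  rewrite /B; case: (ltnP m (2 * hh)) => _; case: ifP => // _.
  by rewrite addr_ge0.
rewrite big_split/= -mulr_sumr sumr_const card_ord.
apply: lerD.
  apply: (@le_trans _ _ (2 * c / h%:R * (2 * (2 * h%:R)))); last first.
    by rewrite le_eqVlt; apply/orP; left; apply/eqP; field; rewrite gt_eqF.
  rewrite ler_wpM2l//.
  apply: le_trans (sum_inv_sqrt _) _; rewrite ler_pM2l//.
  rewrite -[leRHS]ger0_norm ?mulr_ge0// -sqrtr_sqr ler_sqrt ?sqr_ge0//.
  by rewrite natrM hhE; have := sqr_ge0 (h%:R : R); lra.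
rewrite -[leLHS]mulr_natr natrM hhE.
by rewrite le_eqVlt; apply/orP; left; apply/eqP; field; rewrite gt_eqF.
Qed.

Lemma far_sum_bound vs (psi : nat -> 'rV[int]_d -> R) n y (g : nat -> R) :
  (forall w, w \in vs -> is_step l w) ->
  (forall j y, `|psi j y| <= 1) ->
  (forall j z, (n < j + hh)%N -> psi j z = 0) ->
  (forall m, (Num.sqrt m.+2%:R)^-1 ^+ size vs <= g m.+1 - g m.+2) ->
  (forall m, 0 <= g m) ->
  `|diffs vs (duhamel psi n) y| <= Num.sqrt (flow_const (size vs)) * g hh.
Proof.
move=> steps p1 p0 tg g0; rewrite diffs_duhamel.
pose B m : R := if (hh <= m)%N then
   Num.sqrt (flow_const (size vs)) * (Num.sqrt m.+1%:R)^-1 ^+ size vs else 0.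
apply: (@le_trans _ _ (\sum_(j < n) B (n - j)%N)).
  apply: le_trans (ler_norm_sum _ _ _) _; apply: ler_sum => j _.
  rewrite /B; case: leqP => hj; first exact: diffs_flow_abs.
  rewrite diffs_flow_eq0 ?normr0// => z; apply: p0.
  by have := ltn_ord j; lia.
rewrite sum_rev /B -big_mkcond/= -mulr_sumr ler_wpM2l ?sqrtr_ge0//.
exact: (telescoping_tail (t := fun m => (Num.sqrt m.+2%:R)^-1 ^+ size vs)).
Qed.

Lemma sqrt_hh : Num.sqrt hh%:R = h%:R :> R.
Proof. by rewrite hhE sqrtr_sqr ger0_norm. Qed.

Lemma far_space_bound w (psi : nat -> 'rV[int]_d -> R) n y : is_step l w ->
  (forall j y, `|psi j y| <= 1) ->
  (forall j z, (n < j + hh)%N -> psi j z = 0) ->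
  `|fdiff w (fdiff u (fdiff v (duhamel psi n))) y| <= 2 * c3 / h%:R.
Proof.
move=> sw p1 p0.
have steps : forall a, a \in [:: w; u; v] -> is_step l a.
  by move=> a; rewrite !inE => /or3P[]/eqP ->.
apply: le_trans (far_sum_bound (g := fun m => 2 * (Num.sqrt m%:R)^-1) y steps p1
  p0 _ _) _.
- exact: inv_sqrt3_tele.
- by move=> m; rewrite mulr_ge0 ?invr_ge0 ?sqrtr_ge0.
by rewrite sqrt_hh -/c3 mulrA [c3 * 2]mulrC.
Qed.

Lemma far_time_bound w w' (psi : nat -> 'rV[int]_d -> R) n y :
  is_step l w -> is_step l w' ->
  (forall j y, `|psi j y| <= 1) ->
  (forall j z, (n < j + hh)%N -> psi j z = 0) ->
  `|fdiff w (fdiff w' (fdiff u (fdiff v (duhamel psi n)))) y| <= c4 / h%:R ^+ 2.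
Proof.
move=> sw sw' p1 p0.
have steps : forall a, a \in [:: w; w'; u; v] -> is_step l a.
  by move=> a; rewrite !inE => /or4P[]/eqP ->.
apply: le_trans (far_sum_bound (g := fun m => m%:R^-1) y steps p1 p0 _ _) _.
- move=> m; apply: le_trans (inv_sqr_tele m).
  by rewrite -[size _]/(2 * 2)%N exprM exprVn sqr_sqrtr.
- by move=> m; rewrite invr_ge0.
by rewrite hhE -/c4.
Qed.

Hypothesis basis_steps : forall i, is_step l (delta_mx 0 i).

Lemma sdiff_fdiff (w : 'rV[int]_d) phi x :
  sdiff w phi x = fdiff w (fdiff w phi) (x - w).
Proof. by rewrite /sdiff /fdiff subrK; ring. Qed.

(** From [x] to [x'] there are at most [d * h] unit steps, each changing the value by a third
    difference of size [2 * c3 / h]. Then come at most [h ^ 2] time steps; with no source active,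
    each is [rho] times a combination of [sdiff], that is two more differences, of size
    [c4 / h ^ 2]. *)
Lemma far_oscillation (psi : nat -> 'rV[int]_d -> R) n k x x' :
  (forall j y, `|psi j y| <= 1) ->
  (forall j z, (n < j + hh)%N -> psi j z = 0) ->
  (k <= hh)%N -> (forall i, `|x' 0 i - x 0 i| <= h%:Z) ->
  `|fdiff u (fdiff v (duhamel psi (n + k))) x' - fdiff u (fdiff v (duhamel psi n)) x|
  <= 2 * d%:R * c3 + rho * d1%:R * ds2 * c4.
Proof.
move=> p1 p0 kh xx'; have c3_ge0 : 0 <= c3 by apply: sqrtr_ge0.
have c4_ge0 : 0 <= c4 by apply: sqrtr_ge0.
pose D n := fdiff u (fdiff v (duhamel psi n)).
have space : `|D n x' - D n x| <= 2 * d%:R * c3.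
  have L i z : `|fdiff (delta_mx 0 i) (D n) z| <= 2 * c3 / h%:R.
    exact: far_space_bound.
  apply: le_trans (lipschitz_lattice x x' L) _.
  apply: (@le_trans _ _ (2 * c3 / h%:R * (d%:R * h%:R))).
    rewrite ler_wpM2l ?divr_ge0 ?mulr_ge0//.
    rewrite mulr_natl -[X in _ *+ X]card_ord -sumr_const.
    by apply: ler_sum => i _; rewrite [leRHS]pmulrn ler_int.
  by rewrite le_eqVlt; apply/orP; left; apply/eqP; field; rewrite gt_eqF.
have time k' : (k' <= k)%N ->
    `|D (n + k')%N x' - D n x'| <= k'%:R * (rho * d1%:R * ds2 * (c4 / h%:R ^+ 2)).
  elim: k' => [|k' IH] hk; first by rewrite addn0 subrr normr0 mul0r.
  apply: le_trans (ler_distD (D (n + k')%N x') _ _) _.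
  rewrite -natr1 mulrDl mul1r addrC lerD ?IH 1?ltnW//.
  have p0' j z : (n + k' < j + hh)%N -> psi j z = 0.
    by move=> hj; apply: p0; apply: leq_ltn_trans hj; apply: leq_addr.
  (* As [hh] is positive, [psi] vanishes at time [n + k'] and the step adds no source. *)
  rewrite addnS /D /= (_ : (fun x => _) = duhamel psi (n + k')); last first.
    by apply/funext => z; rewrite p0' ?addr0// -[ltnLHS]addn0 ltn_add2l.
  rewrite -!walk_step_fdiff /walk_step addrAC subrr add0r normrM gtr0_norm//.
  rewrite -!mulrA ler_pM2l//; apply: le_trans (ler_norm_sum _ _ _) _.
  rewrite mulr_natl -[X in _ *+ X]card_ord -sumr_const; apply: ler_sum => i _.
  have /andP[w1 w2] := aW (n + k') i; rewrite normrM ler_pM//.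
    by rewrite ger0_norm// ltW// (lt_le_trans ds1_gt0).
  rewrite sdiff_fdiff; apply: far_time_bound => //; by exists i; left.
have {time} time := time k (leqnn k).
have : k%:R * (rho * d1%:R * ds2 * (c4 / h%:R ^+ 2)) <= rho * d1%:R * ds2 * c4.
  apply: (@le_trans _ _ (hh%:R * (rho * d1%:R * ds2 * (c4 / h%:R ^+ 2)))).
    rewrite ler_wpM2r ?ler_nat//.
    by rewrite mulr_ge0 ?divr_ge0 ?exprn_ge0// !mulr_ge0// ltW.
  rewrite hhE le_eqVlt; apply/orP; left; apply/eqP; field; rewrite gt_eqF//.
have := ler_distD (D n x') (D (n + k)%N x') (D n x).
rewrite -/(D _) -/(D _); move: time space.
by move: (k%:R * _) => e; lra.
Qed.

(** Twice the bound of [near_sum_bound], once for each of the two points, plus the bound of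
    [far_oscillation]. *)
Definition osc_const : R :=
  16 * c + 4 * c2 + 2 * d%:R * c3 + rho * d1%:R * ds2 * c4.

Lemma duhamel_oscillation (psi : nat -> 'rV[int]_d -> R) n n' x x' :
  (n <= n')%N -> (n' <= n + hh)%N -> (forall i, `|x' 0 i - x 0 i| <= h%:Z) ->
  (forall j y, `|psi j y| <= 1) ->
  (forall j z, (j < n)%N -> (n - j <= hh)%N ->
     (forall i, `|z 0 i - x 0 i| <= h%:Z) -> psi j z = 0) ->
  (forall j z, (j < n')%N -> (n' - j <= hh)%N ->
     (forall i, `|z 0 i - x' 0 i| <= h%:Z) -> psi j z = 0) ->
  `|fdiff u (fdiff v (duhamel psi n')) x' - fdiff u (fdiff v (duhamel psi n)) x|
  <= osc_const.
Proof.
move=> nn' n'h xx' p1 pv pv'.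
(* Both points use the same split, at age [hh] measured from the earlier time [n]. The old part is
   then free of sources from [n] to [n'], and the recent part has age below [2 * hh] even at
   [n']. *)
pose psi1 j z := if (j + hh <= n)%N then psi j z else 0.
pose psi2 j z := if (j + hh <= n)%N then 0 else psi j z.
have p11 j z : `|psi1 j z| <= 1 by rewrite /psi1; case: ifP; rewrite ?normr0.
have p21 j z : `|psi2 j z| <= 1 by rewrite /psi2; case: ifP; rewrite ?normr0.
have split m y : fdiff u (fdiff v (duhamel psi m)) y =
    fdiff u (fdiff v (duhamel psi1 m)) y + fdiff u (fdiff v (duhamel psi2 m)) y.
  rewrite -[fdiff u _]/(diffs [:: u; v] _) -(diffsD [:: u; v]).
  congr diffs; apply/funext => z; apply: duhamelD => j a.
  by rewrite /psi1 /psi2; case: ifP; rewrite ?addr0 ?add0r.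
have far : `|fdiff u (fdiff v (duhamel psi1 n')) x' - fdiff u (fdiff v (duhamel
  psi1 n)) x|
    <= 2 * d%:R * c3 + rho * d1%:R * ds2 * c4.
  rewrite -(subnKC nn'); apply: far_oscillation => //; last by lia.
  by move=> j z hj; rewrite /psi1 leqNgt hj.
have near : `|fdiff u (fdiff v (duhamel psi2 n)) x| <= 8 * c + 2 * c2.
  apply: near_sum_bound => //.
    by move=> j z jn nj zx; rewrite /psi2 pv// if_same.
  move=> j z hj; rewrite /psi2 ifT//.
  by rewrite (leq_trans _ hj)// leq_add2l leq_pmull.
have near' : `|fdiff u (fdiff v (duhamel psi2 n')) x'| <= 8 * c + 2 * c2.
  apply: near_sum_bound => //.
    by move=> j z jn nj zx; rewrite /psi2 pv'// if_same.
  move=> j z hj; rewrite /psi2 ifT//.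
  rewrite -(leq_add2r hh) -addnA addnn -mul2n; exact: leq_trans hj _.
rewrite !split /osc_const; move: far near near'.
move: (fdiff _ _ _) (fdiff _ _ _) (fdiff _ _ _) (fdiff _ _ _) => a a' b b'.
rewrite !ler_norml => /andP[? ?] /andP[? ?] /andP[? ?]; apply/andP; split; lra.
Qed.

Lemma osc_const_ge0 : 0 <= osc_const.
Proof.
have c2_ge0 : 0 <= c2 by apply: sqrtr_ge0.
have c3_ge0 : 0 <= c3 by apply: sqrtr_ge0.
have c4_ge0 : 0 <= c4 by apply: sqrtr_ge0.
have e3 : 0 <= 2 * d%:R * c3 by rewrite mulr_ge0// mulr_ge0.
have e4 : 0 <= rho * d1%:R * ds2 * c4.
  by rewrite mulr_ge0// mulr_ge0 ?(ltW ds2_gt0)// mulr_ge0 ?ler0n// ltW.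
by rewrite /osc_const; have := c_ge0; lra.
Qed.

End Oscillation.
End Flow.
End FlowBounds.

(** * Energy estimate and adjoint *)

Section LatticeSum.
Context {R : realType} {d : nat}.
Implicit Types (f g a b : 'rV[int]_d -> R) (x u v : 'rV[int]_d).

Definition fin_supp f := finite_set [set x | f x != 0].
Definition zsum f : R := \sum_(x \in [set: 'rV[int]_d]) f x.

Lemma fin_supp_sub f g : (forall x, f x = 0 -> g x = 0) -> fin_supp f -> fin_supp g.
Proof.
move=> fg; apply: sub_finite_set => x /=; apply: contra => /eqP/fg ->.
exact: eqxx.
Qed.

Lemma fin_suppP f : fin_supp f ->
  exists A : {fset 'rV[int]_d}, forall x, x \notin A -> f x = 0.
Proof.
move=> /finite_fsetP[A AE]; exists A => x xA; apply/eqP; apply: contraNT xA.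
by move=> fx; have : [set` A] x by rewrite -AE.
Qed.

Lemma fin_supp_fset (A : {fset 'rV[int]_d}) f :
  (forall x, x \notin A -> f x = 0) -> fin_supp f.
Proof.
move=> fA; apply: (sub_finite_set (B := [set` A])); last exact: finite_fset.
by move=> x /=; apply: contraR => /fA ->.
Qed.

Lemma zsum_fset (A : {fset 'rV[int]_d}) f :
  (forall x, x \notin A -> f x = 0) -> zsum f = \sum_(x <- A) f x.
Proof. exact: fsbigTE. Qed.

Lemma fin_supp0 : fin_supp (fun=> 0).
Proof. by apply: (@fin_supp_fset fset0). Qed.

Lemma fin_suppD f g : fin_supp f -> fin_supp g -> fin_supp (fun x => f x + g x).
Proof.
move=> /fin_suppP[A fA] /fin_suppP[B gB]; apply: (@fin_supp_fset (A `|` B)%fset) => x.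
by rewrite inE negb_or => /andP[xA xB]; rewrite fA// gB// addr0.
Qed.

Lemma fin_suppM f g : fin_supp f -> fin_supp (fun x => f x * g x).
Proof. by apply: fin_supp_sub => x ->; rewrite mul0r. Qed.

Lemma fin_suppMr f g : fin_supp g -> fin_supp (fun x => f x * g x).
Proof. by apply: fin_supp_sub => x ->; rewrite mulr0. Qed.

Lemma fin_suppX f : fin_supp f -> fin_supp (fun x => f x ^+ 2).
Proof. by apply: fin_supp_sub => x ->; rewrite expr0n. Qed.

Lemma fin_suppN f : fin_supp f -> fin_supp (fun x => - f x).
Proof. by apply: fin_supp_sub => x ->; rewrite oppr0. Qed.

Lemma fin_suppB f g : fin_supp f -> fin_supp g -> fin_supp (fun x => f x - g x).
Proof. by move=> ff /fin_suppN; exact: fin_suppD. Qed.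

Lemma fin_supp_sum (I : Type) (r : seq I) (P : pred I) (F : I -> 'rV[int]_d -> R) :
  (forall i, fin_supp (F i)) -> fin_supp (fun x => \sum_(i <- r | P i) F i x).
Proof.
move=> Ff; elim: r => [|i r IH].
  by apply: fin_supp_sub fin_supp0 => x _; rewrite big_nil.
case Pi : (P i).
  by apply: fin_supp_sub (fin_suppD (Ff i) IH) => x; rewrite big_cons Pi.
by apply: fin_supp_sub IH => x; rewrite big_cons Pi.
Qed.

Lemma fin_supp_shift f v : fin_supp f -> fin_supp (fun x => f (x + v)).
Proof.
move=> /fin_suppP[A fA].
apply: (@fin_supp_fset [fset y - v | y in A]%fset) => x xA; apply: fA.
apply: contra xA => xA; apply/imfsetP; exists (x + v) => //=.
by rewrite addrK.
Qed.

Lemma fin_supp_fdiff f v : fin_supp f -> fin_supp (fdiff v f).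
Proof. by move=> ff; apply: fin_suppB => //; exact: fin_supp_shift. Qed.

Lemma zsumD f g : fin_supp f -> fin_supp g ->
  zsum (fun x => f x + g x) = zsum f + zsum g.
Proof.
move=> /fin_suppP[A fA] /fin_suppP[B gB].
rewrite (@zsum_fset (A `|` B)%fset); last first.
  by move=> x; rewrite inE negb_or => /andP[xA xB]; rewrite fA// gB// addr0.
rewrite big_split/=; congr (_ + _); rewrite -zsum_fset// => x;
  by rewrite inE negb_or => /andP[xA xB]; rewrite ?fA ?gB.
Qed.

Lemma zsumZ c f : zsum (fun x => c * f x) = c * zsum f.
Proof. by rewrite /zsum mulr_fsumr. Qed.

Lemma zsum0 : zsum (fun=> 0) = 0.
Proof. exact: fsbig1. Qed.

Lemma zsumN f : zsum (fun x => - f x) = - zsum f.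
Proof.
rewrite -mulN1r -zsumZ; congr zsum; apply/funext => x.
by rewrite mulN1r.
Qed.

Lemma zsumB f g : fin_supp f -> fin_supp g ->
  zsum (fun x => f x - g x) = zsum f - zsum g.
Proof. by move=> ff fg; rewrite zsumD ?zsumN//; exact: fin_suppN. Qed.

Lemma zsum_sum (I : Type) (r : seq I) (P : pred I) (F : I -> 'rV[int]_d -> R) :
  (forall i, fin_supp (F i)) ->
  zsum (fun x => \sum_(i <- r | P i) F i x) = \sum_(i <- r | P i) zsum (F i).
Proof.
move=> Ff; elim: r => [|i r IH].
  rewrite big_nil -[RHS]zsum0; congr zsum; apply/funext => x.
  by rewrite big_nil.
rewrite big_cons; case: ifP => Pi; rewrite -IH; last first.
  by congr zsum; apply/funext => x; rewrite big_cons Pi.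
rewrite -zsumD//; last exact: fin_supp_sum.
by congr zsum; apply/funext => x; rewrite big_cons Pi.
Qed.

Lemma zsum_ge0 f : (forall x, 0 <= f x) -> 0 <= zsum f.
Proof. by move=> f0; apply: fsumr_ge0. Qed.

Lemma zsum_le f g : fin_supp f -> fin_supp g -> (forall x, f x <= g x) ->
  zsum f <= zsum g.
Proof.
move=> ff fg fgle; rewrite -subr_ge0 -zsumB//; apply: zsum_ge0 => x.
by rewrite subr_ge0.
Qed.

Lemma zsum_shift f v : zsum (fun x => f (x + v)) = zsum f.
Proof.
rewrite /zsum [RHS](reindex_fsbigT (fun x => x + v))//.
by exists (fun x => x - v) => x; rewrite (addrK, subrK).
Qed.

Lemma zsum_shiftE f g v : (forall x, g x = f (x + v)) -> zsum g = zsum f.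
Proof. by move=> h; rewrite -(zsum_shift f v); congr zsum; exact/funext. Qed.

Definition sqnorm f := zsum (fun x => f x ^+ 2).

Lemma sqnorm_ge0 f : 0 <= sqnorm f.
Proof. by apply: zsum_ge0 => x; exact: sqr_ge0. Qed.

Lemma sqnorm_fdiffN v f : sqnorm (fdiff (- v) f) = sqnorm (fdiff v f).
Proof.
apply: (zsum_shiftE (v := - v)) => x.
by rewrite /fdiff subrK -sqrrN opprB.
Qed.

Lemma sqnorm_sdiff v f : sqnorm (sdiff v f) = sqnorm (fdiff v (fdiff v f)).
Proof.
by apply: (zsum_shiftE (v := - v)) => x; rewrite sdiff_fdiff.
Qed.

Lemma sqnorm_fdiff_le v f : fin_supp f -> sqnorm (fdiff v f) <= 4 * sqnorm f.
Proof.
move=> ff; have fs := fin_suppX (fin_supp_shift v ff).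
have -> : 4 * sqnorm f = zsum (fun x => 2 * f (x + v) ^+ 2 + 2 * f x ^+ 2).
  rewrite zsumD; last 2 first.
  - exact: fin_suppMr.
  - by apply: fin_suppMr; exact: fin_suppX.
  rewrite !zsumZ (zsum_shift (fun x => f x ^+ 2)) -/(sqnorm f); ring.
apply: zsum_le.
- exact/fin_suppX/fin_supp_fdiff.
- by apply: fin_suppD; apply: fin_suppMr => //; exact: fin_suppX.
move=> x; rewrite /fdiff; have := sqr_ge0 (f (x + v) + f x); nra.
Qed.

Lemma zsum_fdiff a b v : fin_supp a ->
  zsum (fun x => fdiff v a x * b x) = zsum (fun x => a x * fdiff (- v) b x).
Proof.
move=> fa.
have -> : (fun x => fdiff v a x * b x) = (fun x => a (x + v) * b x - a x * b x).
  by apply/funext => x; rewrite /fdiff mulrBl.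
have -> : (fun x => a x * fdiff (- v) b x) = (fun x => a x * b (x - v) - a x * b x).
  by apply/funext => x; rewrite /fdiff mulrBr.
rewrite !zsumB; last 4 first.
- exact: fin_suppM.
- exact: fin_suppM.
- exact/fin_suppM/fin_supp_shift.
- exact: fin_suppM.
congr (_ - _); apply: (zsum_shiftE (v := v)) => x.
by rewrite addrK.
Qed.

Lemma zsum_fdiff2 a b v : fin_supp a ->
  zsum (fun x => fdiff v a x * fdiff v b x) = - zsum (fun x => a x * sdiff v b x).
Proof.
move=> fa; rewrite zsum_fdiff// -zsumN; congr zsum; apply/funext => x.
by rewrite /sdiff /fdiff subrK; ring.
Qed.

Lemma zsum_sdiff a b v : fin_supp a -> fin_supp b ->
  zsum (fun x => sdiff v a x * b x) = zsum (fun x => a x * sdiff v b x).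
Proof.
move=> fa fb; apply: oppr_inj; rewrite -zsum_fdiff2//.
have -> : (fun x => sdiff v a x * b x) = (fun x => b x * sdiff v a x).
  by apply/funext => x; rewrite mulrC.
rewrite -zsum_fdiff2//; congr zsum; apply/funext => x; exact: mulrC.
Qed.

End LatticeSum.

Section Energy.
Context {R : realType} {d d1 : nat}.
Variables (l : 'I_d1 -> 'rV[int]_d) (rho ds1 ds2 : R).
Hypotheses (d1_gt0 : (0 < d1)%N) (ds1_gt0 : 0 < ds1) (rho_gt0 : 0 < rho).
Hypotheses (ds2_gt0 : 0 < ds2) (rho_lt : rho < (2 * d1%:R * ds2)^-1).
Implicit Types (f g a b : 'rV[int]_d -> R) (x u v : 'rV[int]_d) (w : 'I_d1 -> R).

Lemma fin_supp_sdiff f v : fin_supp f -> fin_supp (sdiff v f).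
Proof.
move=> ff; apply: fin_suppD; last exact: fin_supp_shift.
by apply: fin_suppB; [exact: fin_supp_shift|exact: fin_suppMr].
Qed.

Lemma fin_supp_walk_step w f : fin_supp f -> fin_supp (walk_step l rho w f).
Proof.
move=> ff; apply: fin_suppD => //; apply: fin_suppMr; apply: fin_supp_sum => k.
by apply: fin_suppMr; exact: fin_supp_sdiff.
Qed.

Lemma walk_step_selfadj w a b : fin_supp a -> fin_supp b ->
  zsum (fun x => walk_step l rho w a x * b x) =
  zsum (fun x => a x * walk_step l rho w b x).
Proof.
move=> fa fb.
have -> : (fun x => walk_step l rho w a x * b x) =
    (fun x => a x * b x + rho * \sum_k w k * (sdiff (l k) a x * b x)).
  apply/funext => x; rewrite /walk_step mulrDl; congr (_ + _).
  by rewrite -mulrA mulr_suml; congr (_ * _); apply: eq_bigr => k _; rewrite mulrA.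
have -> : (fun x => a x * walk_step l rho w b x) =
    (fun x => a x * b x + rho * \sum_k w k * (a x * sdiff (l k) b x)).
  apply/funext => x; rewrite /walk_step mulrDr; congr (_ + _).
  by rewrite mulrCA; congr (_ * _); rewrite mulr_sumr; apply: eq_bigr => k _;
    rewrite mulrCA.
have h1 k : fin_supp (fun x => w k * (sdiff (l k) a x * b x)).
  by apply: fin_suppMr; apply: fin_suppMr.
have h2 k : fin_supp (fun x => w k * (a x * sdiff (l k) b x)).
  by apply: fin_suppMr; apply: fin_suppM.
rewrite !zsumD; [|exact: fin_suppM|by apply: fin_suppMr; exact: fin_supp_sum
  |exact: fin_suppM|by apply: fin_suppMr; exact: fin_supp_sum].
rewrite !zsumZ !zsum_sum//; congr (_ + _ * _); apply: eq_bigr => k _.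
by rewrite !zsumZ zsum_sdiff.
Qed.

Lemma weighted_cauchy (I : finType) (c t : I -> R) : (forall i, 0 <= c i) ->
  (\sum_i c i * t i) ^+ 2 <= (\sum_i c i) * \sum_i c i * t i ^+ 2.
Proof.
move=> c0.
(* Lagrange's identity for the Cauchy-Schwarz defect. *)
suff : 0 <= \sum_i \sum_j c i * c j * (t i - t j) ^+ 2.
  have -> : \sum_i \sum_j c i * c j * (t i - t j) ^+ 2 =
      2 * ((\sum_i c i) * \sum_i c i * t i ^+ 2 - (\sum_i c i * t i) ^+ 2).
    have e1 : (\sum_i c i) * (\sum_i c i * t i ^+ 2) = \sum_i \sum_j c i * (c j
      * t j ^+ 2).
      by rewrite mulr_suml; apply: eq_bigr => i _; rewrite mulr_sumr.
    have e2 : (\sum_i c i) * (\sum_i c i * t i ^+ 2) = \sum_i \sum_j c j * (c i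
      * t i ^+ 2).
      by rewrite e1 exchange_big.
    have e3 : (\sum_i c i * t i) ^+ 2 = \sum_i \sum_j c i * t i * (c j * t j).
      by rewrite expr2 mulr_suml; apply: eq_bigr => i _; rewrite mulr_sumr.
    rewrite mulrBr mulr2n mulrDl mul1r {1}e1 e2 e3 mulr_sumr -big_split/= -sumrB.
    apply: eq_bigr => i _; rewrite mulr_sumr -big_split/= -sumrB.
    by apply: eq_bigr => j _; ring.
  by lra.
by apply: sumr_ge0 => i _; apply: sumr_ge0 => j _; rewrite mulr_ge0 ?sqr_ge0// mulr_ge0.
Qed.

Let hp := @hold_prob R d1 rho ds2.

Definition decay_rate : R := hp * (rho * ds1).

Lemma decay_rate_gt0 : 0 < decay_rate.
Proof. by rewrite /decay_rate !mulr_gt0// hold_prob_gt0. Qed.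

(** With $Pg = g + L$ and $Q = -\langle g, L\rangle$ the Dirichlet form, $|Pg|^2 = |g|^2 - 2Q +
    |L|^2$. Cauchy-Schwarz gives $|L|^2 \le 4\rho d_1\delta_2^* Q = 2(1-hp)Q$, so [2 * hp * Q]
    survives: the holding probability measures the dissipation. *)
Lemma sqnorm_walk_step w g : admissible ds1 ds2 w -> fin_supp g ->
  sqnorm (walk_step l rho w g)
    + 2 * decay_rate * \sum_k sqnorm (fdiff (l k) g) <= sqnorm g.
Proof.
move=> aw fg.
pose L x := \sum_k rho * w k * sdiff (l k) g x.
have w_ge0 k : 0 <= rho * w k.
  by case/andP: (aw k) => /(lt_le_trans ds1_gt0)/ltW h _; rewrite mulr_ge0// ltW.
have stepE x : walk_step l rho w g x = g x + L x.
  rewrite /walk_step /L mulr_sumr; congr (_ + _).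
  by apply: eq_bigr => k _; rewrite mulrA.
have fL : fin_supp L.
  by apply: fin_supp_sum => k; apply: fin_suppMr; exact: fin_supp_sdiff.
pose Q := \sum_k rho * w k * sqnorm (fdiff (l k) g).
have gL : zsum (fun x => g x * L x) = - Q.
  have -> : (fun x => g x * L x) =
      (fun x => \sum_k rho * w k * (g x * sdiff (l k) g x)).
    apply/funext => x; rewrite /L mulr_sumr; apply: eq_bigr => k _.
    by rewrite mulrCA.
  rewrite zsum_sum; last by move=> k; apply: fin_suppMr; exact: fin_suppM.
  rewrite /Q -sumrN; apply: eq_bigr => k _; rewrite zsumZ -mulrN.
  by congr (_ * _); apply: oppr_inj; rewrite opprK -zsum_fdiff2//.
have LL : sqnorm L <= 4 * (rho * (d1%:R * ds2)) * Q.
  have wsum : \sum_k rho * w k <= rho * (d1%:R * ds2).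
    rewrite -mulr_sumr ler_pM2l// mulr_natl -[X in _ *+ X]card_ord -sumr_const.
    by apply: ler_sum => k _; case/andP: (aw k).
  apply: (@le_trans _ _ (zsum (fun x => (rho * (d1%:R * ds2)) *
      \sum_k rho * w k * sdiff (l k) g x ^+ 2))).
    apply: zsum_le; first exact: fin_suppX.
      apply: fin_suppMr; apply: fin_supp_sum => k; apply: fin_suppMr.
      by apply: fin_suppX; exact: fin_supp_sdiff.
    move=> x; apply: le_trans (weighted_cauchy _ w_ge0) _.
    rewrite ler_wpM2r//; apply: sumr_ge0 => k _.
    by rewrite mulr_ge0// sqr_ge0.
  rewrite zsumZ zsum_sum; last first.
    move=> k; apply: fin_suppMr; apply: fin_suppX; exact: fin_supp_sdiff.
  rewrite [leRHS](_ : _ = rho * (d1%:R * ds2) * (4 * Q)); last by ring.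
  rewrite ler_wpM2l//; first by rewrite !mulr_ge0// ltW.
  rewrite /Q mulr_sumr; apply: ler_sum => k _.
  rewrite zsumZ mulrCA ler_wpM2l// -/(sqnorm _) sqnorm_sdiff.
  exact/sqnorm_fdiff_le/fin_supp_fdiff.
have hQ : rho * ds1 * (\sum_k sqnorm (fdiff (l k) g)) <= Q.
  rewrite mulr_sumr; apply: ler_sum => k _; rewrite ler_wpM2r ?sqnorm_ge0//.
  by rewrite ler_pM2l//; case/andP: (aw k).
have E : sqnorm (walk_step l rho w g) = sqnorm g - 2 * Q + sqnorm L.
  have -> : sqnorm (walk_step l rho w g) =
      zsum (fun x => (g x ^+ 2 + 2 * (g x * L x)) + L x ^+ 2).
    by congr zsum; apply/funext => x; rewrite stepE; ring.
  rewrite !zsumD ?zsumZ ?gL.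
  - by rewrite mulrN.
  - exact: fin_suppX.
  - by apply: fin_suppMr; exact: fin_suppM.
  - by apply: fin_suppD; [exact: fin_suppX|apply: fin_suppMr; exact: fin_suppM].
  - exact: fin_suppX.
have hpE : hp = 1 - 2 * (rho * (d1%:R * ds2)) by rewrite /hp /hold_prob; ring.
have hp0 : 0 < hp by apply: hold_prob_gt0.
have := ler_wpM2l (ltW hp0) hQ; rewrite /decay_rate mulrA {2}hpE E.
move: LL; lra.
Qed.

Lemma sqnorm_walk_step_le w g : admissible ds1 ds2 w -> fin_supp g ->
  sqnorm (walk_step l rho w g) <= sqnorm g.
Proof.
move=> aw fg; apply: le_trans (sqnorm_walk_step aw fg).
rewrite lerDl; apply: mulr_ge0; first exact: mulr_ge0 (ltW decay_rate_gt0).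
by apply: sumr_ge0 => k _; exact: sqnorm_ge0.
Qed.

Definition energy g := \sum_k sqnorm (fdiff (l k) g).
Definition dissipation g := \sum_m \sum_k sqnorm (fdiff (l k) (fdiff (l m) g)).

Lemma energy_ge0 g : 0 <= energy g.
Proof. by apply: sumr_ge0 => k _; exact: sqnorm_ge0. Qed.

Lemma energy_le g : fin_supp g -> energy g <= d1%:R * (4 * sqnorm g).
Proof.
move=> fg; rewrite mulr_natl -[X in _ *+ X]card_ord -sumr_const.
by apply: ler_sum => k _; exact: sqnorm_fdiff_le.
Qed.

Definition source_const : R := d1%:R * (decay_rate^-1 + 4).

Lemma source_const_ge0 : 0 <= source_const.
Proof.
by rewrite mulr_ge0 ?addr_ge0// invr_ge0 ltW// decay_rate_gt0.
Qed.

(** The cross term between the differences of [f] and of the step is summed by parts, so that [f]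
    meets a second difference; Young's inequality charges it to half of the dissipation
    [2 * decay_rate] gained by the step. The two summands of [source_const] come from this and from
    $|\delta f|^2 \le 4|f|^2$. *)
Lemma energy_step w g f : admissible ds1 ds2 w -> fin_supp g -> fin_supp f ->
  energy (fun x => walk_step l rho w g x + f x) + decay_rate * dissipation g <=
  energy g + source_const * sqnorm f.
Proof.
move=> aw fg ff; set beta := decay_rate.
have b0 : 0 < beta := decay_rate_gt0.
have one m : sqnorm (fdiff (l m) (fun x => walk_step l rho w g x + f x)) <=
    sqnorm (fdiff (l m) g) - 2 * beta * energy (fdiff (l m) g)
    + beta * sqnorm (fdiff (l m) (fdiff (l m) g)) + (beta^-1 + 4) * sqnorm f.
  pose a := walk_step l rho w (fdiff (l m) g).
  have aE : a = fdiff (l m) (walk_step l rho w g) by rewrite /a walk_step_fdiff.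
  have fP : fin_supp (walk_step l rho w g) by exact: fin_supp_walk_step.
  have fa : fin_supp a by rewrite aE; exact: fin_supp_fdiff.
  have fdf := fin_supp_fdiff (l m) ff.
  have -> : sqnorm (fdiff (l m) (fun x => walk_step l rho w g x + f x)) =
      zsum (fun x => (a x ^+ 2 + 2 * (fdiff (l m) f x * a x)) + fdiff (l m) f x ^+ 2).
    by congr zsum; apply/funext => x; rewrite aE /fdiff; ring.
  rewrite !zsumD ?zsumZ; last 4 first.
  - exact: fin_suppX.
  - by apply: fin_suppMr; exact: fin_suppM.
  - by apply: fin_suppD; [exact: fin_suppX|apply: fin_suppMr; exact: fin_suppM].
  - exact: fin_suppX.
  have h1 : sqnorm a <= sqnorm (fdiff (l m) g) - 2 * beta * energy (fdiff (l m) g).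
    by have := sqnorm_walk_step aw (fin_supp_fdiff (l m) fg);
      rewrite -/a -/beta -/(energy _); lra.
  have h3 : sqnorm (fdiff (l m) f) <= 4 * sqnorm f by exact: sqnorm_fdiff_le.
  have h2 : 2 * zsum (fun x => fdiff (l m) f x * a x) <=
      beta * sqnorm (fdiff (l m) (fdiff (l m) g)) + beta^-1 * sqnorm f.
    rewrite aE zsum_fdiff2//.
    pose s := sdiff (l m) (walk_step l rho w g).
    have fs : fin_supp s by exact: fin_supp_sdiff.
    have hs : sqnorm s <= sqnorm (fdiff (l m) (fdiff (l m) g)).
      rewrite sqnorm_sdiff -!walk_step_fdiff; apply: sqnorm_walk_step_le => //.
      exact/fin_supp_fdiff/fin_supp_fdiff.
    apply: (@le_trans _ _ (beta * sqnorm s + beta^-1 * sqnorm f)); last first.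
      by rewrite lerD2r ler_pM2l.
    rewrite [leLHS](_ : _ = zsum (fun x => - 2 * (f x * s x))); last first.
      by rewrite zsumZ; ring.
    rewrite -!zsumZ -zsumD; last 2 first.
    - by apply: fin_suppMr; exact: fin_suppX.
    - by apply: fin_suppMr; exact: fin_suppX.
    apply: zsum_le.
    - by apply: fin_suppMr; exact: fin_suppM.
    - by apply: fin_suppD; apply: fin_suppMr; exact: fin_suppX.
    move=> x; rewrite -subr_ge0.
    rewrite [leRHS](_ : _ = beta * (s x + beta^-1 * f x) ^+ 2).
      by rewrite mulr_ge0 ?sqr_ge0// ltW.
    by field; rewrite gt_eqF.
  rewrite -/(sqnorm a) -/(sqnorm (fdiff (l m) f)); move: h1 h2 h3.
  by move: beta^-1 => b'; lra.
have diag : \sum_m sqnorm (fdiff (l m) (fdiff (l m) g)) <= dissipation g.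
  apply: ler_sum => m _; rewrite (bigD1 m)//= lerDl.
  by apply: sumr_ge0 => k _; exact: sqnorm_ge0.
have := ler_sum (index_enum 'I_d1) (fun m (_ : true) => one m).
rewrite -/(energy _) !big_split/= sumrN -!mulr_sumr sumr_const card_ord.
rewrite -/(energy g) -/(dissipation g) -[_ *+ d1]mulr_natl mulrA.
rewrite (_ : _ * d1%:R = source_const); last by rewrite mulrC.
have := ler_wpM2l (ltW b0) diag.
lra.
Qed.

Section Duhamel.
Variable W : nat -> 'I_d1 -> R.
Hypothesis aW : forall n, admissible ds1 ds2 (W n).
Variable F : nat -> 'rV[int]_d -> R.
Hypothesis fF : forall n, fin_supp (F n).

Lemma fin_supp_duhamel n : fin_supp (duhamel l rho W F n).
Proof.
elim: n => [|n IH]; first exact: fin_supp0.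
by apply: fin_supp_walk_step; exact: fin_suppD.
Qed.

(** State between the arrival of the source and the step; its recursion is the one treated by
    [energy_step]. *)
Let V n := (fun x => duhamel l rho W F n x + F n x).

Lemma energy_sum n : energy (V n) + decay_rate * \sum_(j < n) dissipation (V j)
  <= source_const * \sum_(j < n.+1) sqnorm (F j).
Proof.
have b0 := decay_rate_gt0.
have fV m : fin_supp (V m) by apply: fin_suppD => //; exact: fin_supp_duhamel.
elim: n => [|n IH].
  rewrite big_ord0 mulr0 addr0 big_ord_recr big_ord0/= add0r.
  apply: le_trans (energy_le (fV 0%N)) _.
  have -> : sqnorm (V 0%N) = sqnorm (F 0%N).
    by congr zsum; apply/funext => x; rewrite /V add0r.
  rewrite mulrA ler_wpM2r ?sqnorm_ge0// ler_wpM2l// lerDr invr_ge0 ltW//.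
rewrite big_ord_recr/= [in leRHS]big_ord_recr/=.
have := energy_step (aW n) (fV n) (fF n.+1).
rewrite -/(V n.+1); move: IH; lra.
Qed.

(** The solution at time [n + 1] is one step applied to [V n]. Steps are contractions and commute
    with differences, so the dissipation of [V] controls all second differences; the signs of [u]
    and [v] do not change the norms. *)
Lemma duhamel_l2 u v A : is_step l u -> is_step l v ->
  \sum_(n < A) sqnorm (fdiff u (fdiff v (duhamel l rho W F n))) <=
  source_const / decay_rate * \sum_(n < A) sqnorm (F n).
Proof.
move=> [a ua] [b vb]; have b0 := decay_rate_gt0.
have fV m : fin_supp (V m) by apply: fin_suppD => //; exact: fin_supp_duhamel.
have zero : sqnorm (fdiff u (fdiff v (duhamel l rho W F 0))) = 0.
  rewrite -[RHS](zsum0 (d := d)); congr zsum; apply/funext => x.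
  by rewrite /= /fdiff !subrr expr0n.
case: A => [|A]; first by rewrite !big_ord0 mulr0.
rewrite big_ord_recl zero add0r mulrAC ler_pdivlMr// mulrC.
apply: le_trans (energy_sum A); rewrite -[leLHS]add0r lerD ?energy_ge0//.
rewrite ler_pM2l//; apply: ler_sum => n _.
rewrite lift0.
apply: (@le_trans _ _ (sqnorm (fdiff u (fdiff v (V n))))).
  rewrite -[duhamel _ _ _ _ _]/(walk_step l rho (W n) (V n)) -!walk_step_fdiff.
  by apply: sqnorm_walk_step_le => //; do 2 apply: fin_supp_fdiff.
have -> : sqnorm (fdiff u (fdiff v (V n))) = sqnorm (fdiff (l a) (fdiff (l b) (V n))).
  have e1 : sqnorm (fdiff u (fdiff v (V n))) = sqnorm (fdiff (l a) (fdiff v (V n))).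
    by case: ua => -> //; exact: sqnorm_fdiffN.
  rewrite e1 fdiffC [in RHS]fdiffC.
  by case: vb => -> //; exact: sqnorm_fdiffN.
rewrite /dissipation (bigD1 b)//= (bigD1 a)//= -addrA lerDl addr_ge0//.
  by apply: sumr_ge0 => k _; exact: sqnorm_ge0.
by apply: sumr_ge0 => k _; exact: energy_ge0.
Qed.

End Duhamel.

Lemma duhamel_fdiff W u F n :
  duhamel l rho W (fun j => fdiff u (F j)) n = fdiff u (duhamel l rho W F n).
Proof.
elim: n => [|n IH] /=; first by apply/funext => x; rewrite /fdiff subrr.
rewrite -walk_step_fdiff; congr walk_step; apply/funext => x.
by rewrite IH /fdiff; ring.
Qed.

(* Reversing time turns the adjoint of a causal solution operator into a
   solution operator of the same kind. *)
Lemma duhamel_adjoint (W : nat -> 'I_d1 -> R) (F G : nat -> 'rV[int]_d -> R) A :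
  (forall n, fin_supp (F n)) -> (forall n, fin_supp (G n)) ->
  \sum_(n < A.+1) zsum (fun x => duhamel l rho W F n x * G n x) =
  \sum_(n < A.+1) zsum (fun x => F n x *
    duhamel l rho (fun s => W (A - s.+1)%N) (fun s => G (A - s)%N) (A - n)%N x).
Proof.
move=> fF fG; set W' := fun s => W _; set G' := fun s => G _.
pose U := duhamel l rho W F; pose V n := duhamel l rho W' G' (A - n)%N.
have fU n : fin_supp (U n) by exact: fin_supp_duhamel.
have fV n : fin_supp (V n) by apply: fin_supp_duhamel => m; exact: fG.
(* Summation by parts in time. One and the same self-adjoint step takes [U n + F n] to [U n.+1] and
   [V n.+1 + G n.+1] to [V n], since reversed step [A - n.+1] uses the rates [W n]. The boundary
   terms vanish because [U] starts from 0 and [V] ends at 0. *)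
pose Q n := zsum (fun x => U n x * V n x).
have step n : (n < A)%N -> zsum (fun x => F n x * V n x) =
    zsum (fun x => U n.+1 x * G n.+1 x) + Q n.+1 - Q n.
  move=> nA.
  have e1 : zsum (fun x => U n.+1 x * G n.+1 x) + Q n.+1 =
      zsum (fun x => walk_step l rho (W n) (fun y => U n y + F n y) x *
        (V n.+1 x + G n.+1 x)).
    rewrite /Q -zsumD; [|exact: fin_suppM|exact: fin_suppM].
    by congr zsum; apply/funext => x; rewrite mulrDr addrC.
  rewrite e1 walk_step_selfadj; [|exact: fin_suppD|exact: fin_suppD].
  have -> : walk_step l rho (W n) (fun y => V n.+1 y + G n.+1 y) = V n.
    rewrite /V -[in RHS](subnSK nA)/= /W' /G'.
    by rewrite (subnSK nA) (subKn (ltnW nA)) subKn.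
  rewrite -[LHS](addrK (Q n)); congr (_ - _).
  rewrite /Q -zsumD; [|exact: fin_suppM|exact: fin_suppM].
  by congr zsum; apply/funext => x; rewrite mulrDl addrC.
have Q0 : Q 0%N = 0 by apply: fsbig1 => x _; rewrite mul0r.
have QA : Q A = 0 by apply: fsbig1 => x _; rewrite /V subnn mulr0.
have FA : zsum (fun x => F A x * V A x) = 0.
  by apply: fsbig1 => x _; rewrite /V subnn mulr0.
have U0 : zsum (fun x => U 0%N x * G 0%N x) = 0.
  by apply: fsbig1 => x _; rewrite mul0r.
rewrite -/U -[in RHS]/(V _) big_ord_recl U0 add0r big_ord_recr/= FA addr0.
under [RHS]eq_bigr do rewrite step// -addrA.
rewrite big_split/= (_ : \sum_(i < A) (Q i.+1 - Q i) = 0) ?addr0//.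
by rewrite -(big_mkord xpredT (fun i => Q i.+1 - Q i)) telescope_sumr// QA Q0 subrr.
Qed.

Lemma second_diff_adjoint (W : nat -> 'I_d1 -> R) (F G : nat -> 'rV[int]_d -> R) A u v :
  (forall n, fin_supp (F n)) -> (forall n, fin_supp (G n)) ->
  \sum_(n < A.+1) zsum (fun x => fdiff u (fdiff v (duhamel l rho W F n)) x * G n x) =
  \sum_(n < A.+1) zsum (fun x => F n x *
    fdiff (- u) (fdiff (- v) (duhamel l rho (fun s => W (A - s.+1)%N)
      (fun s => G (A - s)%N) (A - n)%N)) x).
Proof.
move=> fF fG.
have fU n := fin_supp_duhamel W fF n.
transitivity (\sum_(n < A.+1) zsum (fun x => duhamel l rho W F n x *
    fdiff (- v) (fdiff (- u) (G n)) x)).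
  apply: eq_bigr => n _; rewrite zsum_fdiff; last exact: fin_supp_fdiff.
  by rewrite zsum_fdiff.
rewrite (@duhamel_adjoint W F (fun n => fdiff (- v) (fdiff (- u) (G n))) A fF);
  last first.
  by move=> n; do 2 apply: fin_supp_fdiff.
apply: eq_bigr => n _; congr zsum; apply/funext => x; congr (_ * _).
by rewrite !duhamel_fdiff fdiffC.
Qed.

End Energy.

(** * Dyadic parabolic boxes *)

Section OrdinalBlocks.

Lemma card_ord_pred_le (N a b : nat) (P : pred 'I_N) :
  (forall t, P t -> (a <= t < a + b)%N) -> (#|P| <= b)%N.
Proof.
move=> Pab; rewrite cardE -(size_map val) -(size_iota a b).
apply: uniq_leq_size; first by rewrite map_inj_uniq ?enum_uniq//; exact: val_inj.
move=> t /mapP[s]; rewrite mem_enum => Ps ->.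
by rewrite mem_iota; apply: Pab.
Qed.

Lemma card_ord_block (N m a : nat) : (0 < m)%N -> (a * m + m <= N)%N ->
  #|[pred t : 'I_N | (t %/ m)%N == a]| = m.
Proof.
move=> m0 amN; apply/eqP; rewrite eqn_leq; apply/andP; split.
  apply: (@card_ord_pred_le _ (a * m)) => t /eqP <-.
  by rewrite leq_trunc_div/= {1}(divn_eq t m) ltn_add2l ltn_mod.
rewrite cardE -(size_map val) -{1}(size_iota (a * m) m).
apply: uniq_leq_size; first exact: iota_uniq.
move=> t; rewrite mem_iota => /andP[t1 t2].
have tN : (t < N)%N by apply: leq_trans amN.
apply/mapP; exists (Ordinal tN) => //; rewrite mem_enum inE/=.
by rewrite eqn_leq -ltnS ltn_divLR// mulSn [(m + _)%N]addnC t2 leq_divRL.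
Qed.

Definition adjacent (a b : nat) := (a <= b.+1)%N && (b <= a.+1)%N.

Lemma card_ord_adjacent (N m a : nat) : (0 < m)%N ->
  (#|[pred t : 'I_N | adjacent a (t %/ m)]| <= 3 * m)%N.
Proof.
move=> m0; apply: (@card_ord_pred_le _ (a.-1 * m)) => t /andP[h1 h2].
have e := divn_eq t m; have := ltn_pmod t m0.
move: (t %/ m)%N (t %% m)%N e h1 h2 => q r -> h1 h2 rm.
apply/andP; split.
  apply: leq_trans (leq_addr _ _); rewrite leq_mul2r; apply/orP; right; lia.
rewrite -mulnDl; apply: (@leq_trans (q * m + m)%N); first by rewrite ltn_add2l.
by rewrite -mulSnr leq_mul2r; apply/orP; right; lia.
Qed.

Lemma adjacent_div (m a b : nat) : (0 < m)%N -> (a <= b + m)%N -> (b <= a + m)%N ->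
  adjacent (a %/ m) (b %/ m).
Proof.
move=> m0 h1 h2; rewrite /adjacent.
have e x : ((x + m) %/ m)%N = (x %/ m).+1 by rewrite divnDr// divnn m0 addn1.
by rewrite -!e !leq_div2r.
Qed.

Lemma eq_div_close (m a b : nat) : (0 < m)%N -> (a %/ m = b %/ m)%N ->
  (a <= b + m)%N.
Proof.
move=> m0 e; rewrite (divn_eq a m) e {2}(divn_eq b m) -addnA leq_add2l.
by rewrite (leq_trans (ltnW (ltn_pmod a m0)))// leq_addl.
Qed.

Lemma card_ffun_forall (d N : nat) (F : 'I_d -> pred 'I_N) :
  #|[pred y : {ffun 'I_d -> 'I_N} | [forall i, F i (y i)]]| = (\prod_(i < d) #|F i|)%N.
Proof.
have := card_family (aT := 'I_d) (rT := fun=> 'I_N) F.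
rewrite foldrE big_map big_enum => <-.
by apply: eq_card => y; rewrite !inE.
Qed.

End OrdinalBlocks.

Section DyadicCells.
Variables (d K : nat).

(** Parabolic scaling: time is divided by 4 when space is divided by 2. *)
Definition box := ('I_(4 ^ K) * {ffun 'I_d -> 'I_(2 ^ K)})%type.

Definition cell (k : nat) (z : box) : nat * {ffun 'I_d -> nat} :=
  ((z.1 %/ 4 ^ k)%N, [ffun i => (z.2 i %/ 2 ^ k)%N]).

(** Same or neighbouring block in every coordinate. Past and future enter symmetrically, so one
    relation serves both the operator and its time-reversed adjoint. *)
Definition near (k : nat) : rel box := fun z w =>
  adjacent (z.1 %/ 4 ^ k) (w.1 %/ 4 ^ k)
  && [forall i, adjacent (z.2 i %/ 2 ^ k) (w.2 i %/ 2 ^ k)].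

Definition cell_vol (k : nat) := (4 ^ k * (2 ^ k) ^ d)%N.

Lemma cellP k z z' : cell k z = cell k z' <->
  (z.1 %/ 4 ^ k = z'.1 %/ 4 ^ k)%N /\ forall i, (z.2 i %/ 2 ^ k = z'.2 i %/ 2 ^ k)%N.
Proof.
split=> [[e1 /ffunP e2]|[e1 e2]].
  by split=> // i; have := e2 i; rewrite !ffunE.
by congr pair => //; apply/ffunP => i; rewrite !ffunE.
Qed.

Lemma cell0_inj : injective (cell 0).
Proof.
move=> [t y] [t' y'] /cellP/=[]; rewrite !divn1 => e1 e2; congr pair.
  exact: val_inj.
by apply/ffunP => i; apply: val_inj; have := e2 i; rewrite !divn1.
Qed.

Lemma cell_nested k z z' : cell k z = cell k z' -> cell k.+1 z = cell k.+1 z'.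
Proof.
move=> /cellP[e1 e2]; apply/cellP; split=> [|i].
  by rewrite !expnSr !divnMA e1.
by rewrite !expnSr !divnMA e2.
Qed.

Lemma cell_top z z' : cell K z = cell K z'.
Proof. by apply/cellP; split=> [|i]; rewrite !divn_small. Qed.

Lemma cell_card k z : (k <= K)%N ->
  #|[pred z' | cell k z' == cell k z]| = cell_vol k.
Proof.
move=> kK.
have block (q a : nat) : (0 < q)%N -> (a < q ^ K)%N ->
    (a %/ q ^ k * q ^ k + q ^ k <= q ^ K)%N.
  move=> q0 aq; rewrite -mulSnr -(subnK kK) expnD leq_mul2r; apply/orP; right.
  by rewrite ltn_divLR ?expn_gt0 ?q0// -expnD subnK.
rewrite (@eq_card _ _ [predX [pred t : 'I_(4 ^ K) | t %/ 4 ^ k == z.1 %/ 4 ^ k]%N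
  & [pred y : {ffun 'I_d -> 'I_(2 ^ K)} | [forall i,
    [pred s : 'I_(2 ^ K) | s %/ 2 ^ k == z.2 i %/ 2 ^ k]%N (y i)]]]); last first.
  move=> w; rewrite !inE; apply/eqP/andP => [/cellP[e1 e2]|[/eqP e1 /forallP e2]].
    by rewrite e1 eqxx; split=> //; apply/forallP => i /=; rewrite e2.
  by apply/cellP; split=> // i; apply/eqP/e2.
rewrite cardX (card_ffun_forall (fun i => [pred s : 'I_(2 ^ K) | s %/ 2 ^ k ==
  z.2 i %/ 2 ^ k]%N)).
rewrite card_ord_block ?expn_gt0 ?block//; congr (_ * _)%N.
rewrite (eq_bigr (fun=> 2 ^ k)%N) ?prod_nat_const ?card_ord// => i _.
by rewrite card_ord_block ?expn_gt0 ?block.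
Qed.

Lemma cell_vol_gt0 k : (0 < cell_vol k)%N.
Proof. by rewrite muln_gt0 !expn_gt0. Qed.

Lemma cell_volS k : cell_vol k.+1 = (4 * 2 ^ d * cell_vol k)%N.
Proof. by rewrite /cell_vol !expnS expnMn; lia. Qed.

Lemma cell_vol0 : cell_vol 0 = 1%N.
Proof. by rewrite /cell_vol !expn0 exp1n. Qed.

Lemma near_cell k z z' w : cell k z = cell k z' -> near k z w = near k z' w.
Proof.
move=> /cellP[e1 e2]; rewrite /near e1; congr (_ && _).
by apply: eq_forallb => i; rewrite e2.
Qed.

Lemma near_card k z : (k <= K)%N ->
  (#|[pred w | near k z w]| <= 3 * 3 ^ d * cell_vol k)%N.
Proof.
move=> kK.
rewrite (@eq_card _ _ [predX [pred t : 'I_(4 ^ K) | adjacent (z.1 %/ 4 ^ k) (t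
  %/ 4 ^ k)]
  & [pred y : {ffun 'I_d -> 'I_(2 ^ K)} | [forall i,
    [pred s : 'I_(2 ^ K) | adjacent (z.2 i %/ 2 ^ k) (s %/ 2 ^ k)] (y i)]]]);
      last first.
  by move=> w; rewrite !inE.
rewrite cardX (card_ffun_forall (fun i => [pred s : 'I_(2 ^ K) | adjacent (z.2 i
  %/ 2 ^ k) (s %/ 2 ^ k)])).
rewrite /cell_vol mulnACA -expnMn leq_mul ?card_ord_adjacent ?expn_gt0//.
rewrite -[X in (_ <= _ ^ X)%N]card_ord -prod_nat_const.
by apply: leq_prod => i _; rewrite card_ord_adjacent ?expn_gt0.
Qed.

End DyadicCells.

(** * Second differences of the solution, restricted to a box *)

Section BoxOperators.
Context {R : realType} {d d1 : nat}.
Variables (l : 'I_d1 -> 'rV[int]_d) (rho ds1 ds2 : R).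
Hypotheses (d1_gt0 : (0 < d1)%N) (ds1_gt0 : 0 < ds1) (rho_gt0 : 0 < rho).
Hypotheses (ds2_gt0 : 0 < ds2) (rho_lt : rho < (2 * d1%:R * ds2)^-1).
Hypothesis basis_steps : forall i, is_step l (delta_mx 0 i).
Variables (K L : nat).

Let X := box d K.
Let A := (4 ^ K).-1.
Let AE : A.+1 = (4 ^ K)%N. Proof. by rewrite prednK ?expn_gt0. Qed.

Definition site (y : {ffun 'I_d -> 'I_(2 ^ K)}) : 'rV[int]_d :=
  \row_i ((y i)%:Z - L%:Z).

(** Extension by zero, written as a sum of point masses so that finite support and pairings reduce
    to a single point. *)
Definition extend (f : X -> R) (n : nat) (x : 'rV[int]_d) : R :=
  \sum_(z : X) f z * ((z.1 == n :> nat) && (x == site z.2))%:R.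

Lemma site_inj : injective site.
Proof.
move=> y y' /rowP e; apply/ffunP => i; apply: val_inj.
have := e i; rewrite !mxE => /addIr[].
exact.
Qed.

Lemma extend_in f (z : X) : extend f z.1 (site z.2) = f z.
Proof.
rewrite /extend (bigD1 z)//= !eqxx mulr1 big1 ?addr0// => w wz.
case: eqP => [e1|]; last by rewrite mulr0.
case: eqP => [e2|]; last by rewrite mulr0.
case/eqP: wz; case: w e1 e2 => t y /= e1 e2; case: z e1 e2 => t' y' /= e1 e2.
congr pair; first exact: val_inj.
exact/esym/site_inj.
Qed.

Lemma extend_out f (n : nat) x : (forall z : X, n = z.1 -> x = site z.2 -> f z = 0) ->
  extend f n x = 0.
Proof.
move=> h; apply: big1 => z _; case: eqP => [e1|]; last by rewrite mulr0.
case: eqP => [e2|]; last by rewrite mulr0.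
by rewrite (h z (esym e1) e2) mul0r.
Qed.

Lemma extend_bound f c n x : 0 <= c -> (forall z, `|f z| <= c) ->
  `|extend f n x| <= c.
Proof.
move=> c0 fc.
have [[z [e1 e2]]|no] := pselect (exists z : X, n = z.1 /\ x = site z.2).
  by rewrite e1 e2 extend_in.
rewrite extend_out ?normr0// => z e1 e2; case: no; by exists z.
Qed.

Lemma zsum_delta (Phi : 'rV[int]_d -> R) a : zsum (fun x => Phi x * (x == a)%:R)
  = Phi a.
Proof.
rewrite (@zsum_fset _ _ [fset a]%fset) ?big_seq_fset1 ?eqxx ?mulr1// => x.
by rewrite inE => /negPf ->; rewrite mulr0.
Qed.

Lemma fin_supp_extend f n : fin_supp (extend f n).
Proof.
apply: fin_supp_sum => z; apply: fin_suppMr.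
apply: (@fin_supp_fset _ _ [fset site z.2]%fset) => x.
by rewrite inE => /negPf ->; rewrite andbF.
Qed.

Lemma sum_zsum_extend (Phi : nat -> 'rV[int]_d -> R) f :
  \sum_(n < A.+1) zsum (fun x => Phi n x * extend f n x) =
  \sum_(z : X) Phi z.1 (site z.2) * f z.
Proof.
have e n : zsum (fun x => Phi n x * extend f n x) =
    \sum_(z : X) (z.1 == n :> nat)%:R * (Phi n (site z.2) * f z).
  have -> : (fun x => Phi n x * extend f n x) = (fun x => \sum_(z : X)
      ((z.1 == n :> nat)%:R * f z) * (Phi n x * (x == site z.2)%:R)).
    apply/funext => x; rewrite /extend mulr_sumr; apply: eq_bigr => z _.
    by rewrite -mulnb natrM; ring.
  rewrite zsum_sum; last first.
    move=> z; apply: fin_suppMr; apply: fin_suppMr.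
    apply: (@fin_supp_fset _ _ [fset site z.2]%fset) => x.
    by rewrite inE => /negPf ->.
  by apply: eq_bigr => z _; rewrite zsumZ zsum_delta; ring.
under eq_bigr do rewrite e.
rewrite exchange_big/=; apply: eq_bigr => z _.
have zA : (z.1 < A.+1)%N by rewrite AE.
rewrite (bigD1 (Ordinal zA))//= eqxx mul1r big1 ?addr0// => n nz.
case: eqP => [e1|_]; last by rewrite mul0r.
by case/eqP: nz; apply: val_inj; rewrite /= e1.
Qed.

Variables (W : nat -> 'I_d1 -> R) (u v : 'rV[int]_d).
Hypothesis aW : forall n, admissible ds1 ds2 (W n).
Hypotheses (su : is_step l u) (sv : is_step l v).

Definition box_op (f : X -> R) (z : X) : R :=
  fdiff u (fdiff v (duhamel l rho W (extend f) z.1)) (site z.2).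

Definition box_op_adj (g : X -> R) (z : X) : R :=
  fdiff (- u) (fdiff (- v) (duhamel l rho (fun s => W (A - s.+1)%N)
    (fun s => extend g (A - s)%N) (A - z.1)%N)) (site z.2).

Lemma box_op_adjoint : adjoint_ops box_op box_op_adj.
Proof.
move=> f g; have fE := fin_supp_extend.
rewrite -(sum_zsum_extend (fun n => fdiff u (fdiff v (duhamel l rho W (extend f) n)))).
rewrite (second_diff_adjoint l rho W A u v (fE f) (fE g)).
under eq_bigr => n _ do under [X in zsum X]eq_fun do rewrite mulrC.
rewrite (sum_zsum_extend (fun n => fdiff (- u) (fdiff (- v)
  (duhamel l rho (fun s => W (A - s.+1)%N) (fun s => extend g (A - s)%N) (A - n)%N)))).
by apply: eq_bigr => z _; rewrite mulrC.
Qed.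

Definition l2_const : R := @source_const R d1 rho ds1 ds2 / @decay_rate R d1 rho
  ds1 ds2.

Lemma box_op_l2 f : \sum_z box_op f z ^+ 2 <= l2_const * \sum_z f z ^+ 2.
Proof.
have fE := fin_supp_extend f.
set Phi := fun n => fdiff u (fdiff v (duhamel l rho W (extend f) n)).
have fPhi n : fin_supp (Phi n).
  by do 2 apply: fin_supp_fdiff; exact: fin_supp_duhamel.
apply: (@le_trans _ _ (\sum_(n < A.+1) sqnorm (Phi n))).
  (* Restriction to the box is pairing with the extension of the constant 1, which is at most 1
     everywhere. *)
  rewrite [leLHS](_ : _ = \sum_(z : X) (fun n x => Phi n x ^+ 2) z.1 (site z.2)
    * 1); last first.
    by apply: eq_bigr => z _; rewrite mulr1.
  rewrite -(sum_zsum_extend (fun n x => Phi n x ^+ 2) (fun=> 1)).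
  apply: ler_sum => n _; apply: zsum_le.
  - by apply: fin_suppM; exact: fin_suppX.
  - exact: fin_suppX.
  move=> x; rewrite ler_piMr ?sqr_ge0//; apply: le_trans (ler_norm _) _.
  by apply: extend_bound => // z; rewrite normr1.
apply: le_trans (duhamel_l2 d1_gt0 ds1_gt0 rho_gt0 ds2_gt0 rho_lt aW fE A.+1 su sv) _.
rewrite le_eqVlt; apply/orP; left; apply/eqP; congr (_ * _).
rewrite -[LHS](_ : \sum_(n < A.+1) zsum (fun x => extend f n x * extend f n x) =
  _); last first.
  by [].
rewrite (sum_zsum_extend (extend f)); apply: eq_bigr => z _.
by rewrite extend_in expr2.
Qed.

(* [rv = true] is the time reversal that occurs in the adjoint. *)
Definition flip (rv : bool) (j : nat) := if rv then (A - j)%N else j.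

Definition flip_op rv (W' : nat -> 'I_d1 -> R) (u' v' : 'rV[int]_d) (psi : X
  -> R) (z : X) :=
  fdiff u' (fdiff v' (duhamel l rho W' (fun s => extend psi (flip rv s)) (flip rv z.1)))
    (site z.2).

(** Apply [duhamel_oscillation] with [h = 2 ^ k], for which [h ^ 2] is the duration [4 ^ k] of a
    cell. A box point within [h] in space and [h ^ 2] in time of a point of the cell lies in a near
    block, where [psi] vanishes. The order of the two times is imposed after flipping. *)
Lemma box_oscillation (W' : nat -> 'I_d1 -> R) u' v' (rv : bool) k (psi : X -> R) z z' :
  (forall n, admissible ds1 ds2 (W' n)) -> is_step l u' -> is_step l v' ->
  (forall w, `|psi w| <= 1) -> cell k z = cell k z' ->
  (forall w, near k z w -> psi w = 0) ->
  `|flip_op rv W' u' v' psi z - flip_op rv W' u' v' psi z'| <= osc_const l rho ds1 ds2.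
Proof.
set tau := flip rv; move=> aW' su' sv' p1; wlog le_t : z z' / (tau z'.1 <= tau z.1)%N.
  move=> main czz' vanish.
  case: (leqP (tau z'.1) (tau z.1)) => h; first exact: main.
  rewrite distrC; apply: main => //; first exact: ltnW.
  by move=> w nw; apply: vanish; rewrite (near_cell _ czz').
move=> czz' vanish; have [e1 e2] := (cellP _ _ _).1 czz'.
have h0 : (0 < 2 ^ k)%N by rewrite expn_gt0.
have hhE : ((2 ^ k) ^ 2 = 4 ^ k)%N by rewrite expnAC.
have h40 : (0 < 4 ^ k)%N by rewrite expn_gt0.
have zA (w : X) : (w.1 <= A)%N by rewrite -ltnS AE.
have t1 := eq_div_close h40 e1; have t2 := eq_div_close h40 (esym e1).
have zero (w : X) : cell k z = cell k w -> forall j (y : 'rV[int]_d),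
    (j < tau w.1)%N -> (tau w.1 - j <= (2 ^ k) ^ 2)%N ->
    (forall i, `|y 0 i - site w.2 0 i| <= (2 ^ k)%N%:Z) -> extend psi (tau j) y = 0.
  move=> czw j y jn nj yx; apply: extend_out => b b1 b2; apply: vanish.
  rewrite (near_cell _ czw) /near; rewrite hhE in nj.
  have wA := zA w; have bA := zA b.
  apply/andP; split.
    apply: adjacent_div => //; move: jn nj; rewrite -{}b1 /tau /flip;
      case: ifP => *; lia.
  apply/forallP => i; apply: adjacent_div => //.
    by have := yx i; rewrite b2 !mxE; lia.
  by have := yx i; rewrite b2 !mxE; lia.
apply: (duhamel_oscillation d1_gt0 ds1_gt0 rho_gt0 ds2_gt0 rho_lt aW' su' sv' h0
  basis_steps) => //.
- have za := zA z; have za' := zA z'; rewrite hhE /tau /flip; case: ifP => *; lia.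
- move=> i; rewrite !mxE.
  have := eq_div_close h0 (e2 i); have := eq_div_close h0 (esym (e2 i)); lia.
- by move=> j y; apply: extend_bound.
- exact: zero.
- exact: zero.
Qed.

End BoxOperators.

(** Young's inequality applied to $|T'g|^2 = \langle TT'g, g\rangle$ and absorption; the constant
    [M] is kept. *)
Lemma adjoint_ops_l2 {R : realFieldType} {X : finType} (T T' : (X -> R) -> X
  -> R) (M : R) :
  adjoint_ops T T' -> 0 < M ->
  (forall f, \sum_z T f z ^+ 2 <= M * \sum_z f z ^+ 2) ->
  forall g, \sum_z T' g z ^+ 2 <= M * \sum_z g z ^+ 2.
Proof.
move=> adjT M0 Tl2 g; have := Tl2 (T' g); set N := \sum_z T' g z ^+ 2 => h.
have NE : N = \sum_z T (T' g) z * g z.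
  by rewrite adjT; apply: eq_bigr => z _; rewrite expr2.
have : N <= \sum_z (M^-1 * T (T' g) z ^+ 2 + M * g z ^+ 2) / 2.
  rewrite NE; apply: ler_sum => z _; rewrite -subr_ge0.
  rewrite [leRHS](_ : _ = M^-1 / 2 * (T (T' g) z - M * g z) ^+ 2).
    by rewrite mulr_ge0 ?sqr_ge0// divr_ge0// invr_ge0 ltW.
  by field; rewrite gt_eqF.
rewrite -mulr_suml big_split/= -!mulr_sumr.
have : M^-1 * \sum_z T (T' g) z ^+ 2 <= N.
  by rewrite mulrC ler_pdivrMr// mulrC.
lra.
Qed.

Lemma is_stepN {d d1 : nat} (l : 'I_d1 -> 'rV[int]_d) v : is_step l v
  -> is_step l (- v).
Proof. by move=> [k [->|->]]; exists k; [right|left; rewrite opprK]. Qed.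

(** * Bounds in $\ell^p$ with constants independent of the box *)

Section BoxLp.
Context {R : realType} {d d1 : nat}.
Variables (l : 'I_d1 -> 'rV[int]_d) (rho ds1 ds2 : R).
Hypotheses (d1_gt0 : (0 < d1)%N) (ds1_gt0 : 0 < ds1) (rho_gt0 : 0 < rho).
Hypotheses (ds2_gt0 : 0 < ds2) (rho_lt : rho < (2 * d1%:R * ds2)^-1).
Hypothesis basis_steps : forall i, is_step l (delta_mx 0 i).

(** Dominates both the $\ell^2$ and the oscillation constant; the summand 1 makes it positive, as
    [adjoint_ops_l2] requires. *)
Definition cz_const : R := @l2_const R d1 rho ds1 ds2 + osc_const l rho ds1 ds2 + 1.
Definition weak_const : R :=
  1 + (3 * 3 ^ d)%:R + 4 * cz_const + 12 * (4 * 2 ^ d)%:R * cz_const.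
Definition strong_const (p : R) : R :=
  2 `^ p * (2 * weak_const * geom_const (p - 1) + 4 * cz_const * geom_const (2 - p)).

Lemma l2_const_ge0 : 0 <= @l2_const R d1 rho ds1 ds2.
Proof.
rewrite divr_ge0//; first exact: source_const_ge0.
by rewrite ltW// decay_rate_gt0.
Qed.

Lemma cz_const_gt0 : 0 < cz_const.
Proof.
have h1 := l2_const_ge0.
have h2 := osc_const_ge0 l d1_gt0 ds1_gt0 rho_gt0 ds2_gt0 rho_lt.
by rewrite /cz_const; lra.
Qed.

Lemma weak_const_gt0 : 0 < weak_const.
Proof.
have h := cz_const_gt0; rewrite /weak_const.
have h1 : 0 <= (3 * 3 ^ d)%:R :> R by rewrite ler0n.
have h2 : 0 <= 12 * (4 * 2 ^ d)%:R * cz_const by rewrite !mulr_ge0 ?ler0n ?(ltW h).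
by lra.
Qed.

Lemma strong_const_gt0 p : 1 < p -> p < 2 -> 0 < strong_const p.
Proof.
move=> p1 p2; have h1 := cz_const_gt0; have h2 := weak_const_gt0.
have g1 : 0 < geom_const (p - 1) by apply: geom_const_gt0; lra.
have g2 : 0 < geom_const (2 - p) by apply: geom_const_gt0; lra.
by rewrite /strong_const mulr_gt0 ?powR_gt0// addr_gt0// mulr_gt0// mulr_gt0.
Qed.

Section Operators.
Variables (K L : nat) (W : nat -> 'I_d1 -> R) (u v : 'rV[int]_d).
Hypothesis aW : forall n, admissible ds1 ds2 (W n).
Hypotheses (su : is_step l u) (sv : is_step l v).

Let T := @box_op R d d1 l rho K L W u v.
Let T' := @box_op_adj R d d1 l rho K L W u v.

Let adjT : adjoint_ops T T'.
Proof. exact: box_op_adjoint. Qed.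

Let T_l2 f : \sum_z T f z ^+ 2 <= cz_const * \sum_z f z ^+ 2.
Proof.
apply: le_trans (box_op_l2 d1_gt0 ds1_gt0 rho_gt0 ds2_gt0 rho_lt L aW su sv f) _.
rewrite ler_wpM2r//; first by apply: sumr_ge0 => z _; exact: sqr_ge0.
rewrite /cz_const -addrA lerDl addr_ge0//.
exact: osc_const_ge0.
Qed.

Let T'_l2 f : \sum_z T' f z ^+ 2 <= cz_const * \sum_z f z ^+ 2.
Proof. exact: (adjoint_ops_l2 adjT cz_const_gt0 T_l2). Qed.

Let osc_le : osc_const l rho ds1 ds2 <= cz_const.
Proof. by rewrite /cz_const; have := l2_const_ge0; lra. Qed.

Let T_osc k (psi : box d K -> R) z z' : (forall w, `|psi w| <= 1) ->
  cell k z = cell k z' -> (forall w, near k z w -> psi w = 0) ->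
  `|T psi z - T psi z'| <= cz_const.
Proof.
move=> p1 c0 v0; apply: le_trans osc_le.
exact: (box_oscillation d1_gt0 ds1_gt0 rho_gt0 ds2_gt0 rho_lt basis_steps L
  false aW su sv p1 c0 v0).
Qed.

Let T'_osc k (psi : box d K -> R) z z' : (forall w, `|psi w| <= 1) ->
  cell k z = cell k z' -> (forall w, near k z w -> psi w = 0) ->
  `|T' psi z - T' psi z'| <= cz_const.
Proof.
move=> p1 c0 v0; apply: le_trans osc_le.
exact: (box_oscillation d1_gt0 ds1_gt0 rho_gt0 ds2_gt0 rho_lt basis_steps L
  true (fun n => aW _) (is_stepN su) (is_stepN sv) p1 c0 v0).
Qed.

(** Stated for a pair because it is used in both orders: the weak bound for [T] rests on the
    oscillation of [T'], and that for [T'], needed when [p > 2], on the oscillation of [T]. *)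
Let weak (S S' : (box d K -> R) -> box d K -> R) : adjoint_ops S S' ->
  (forall f, \sum_z S f z ^+ 2 <= cz_const * \sum_z f z ^+ 2) ->
  (forall k psi z z', (forall w, `|psi w| <= 1) ->
    cell k z = cell k z' -> (forall w, near k z w -> psi w = 0) ->
    `|S' psi z - S' psi z'| <= cz_const) ->
  forall f a, 0 < a ->
    a * #|[pred w | a < `|S f w|]|%:R <= weak_const * \sum_z `|f z|.
Proof.
move=> adjS Sl2 S'osc f a a0.
apply: (weak_type_1_1 (@cell0_inj d K) (@cell_nested d K) (@cell_top d K)
  (@cell_card d K) (@cell_vol_gt0 d) (@cell_volS d) (@cell_vol0 d)
  (@near_cell d K) (@near_card d K) adjS Sl2 S'osc (ltW cz_const_gt0)) => //.
by rewrite muln_gt0 expn_gt0.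
Qed.

Lemma box_op_lp p f : 1 < p ->
  \sum_z `|T f z| `^ p <=
  (if p < 2 then strong_const p else if p == 2 then cz_const else
     2 * (2 * strong_const (p / (p - 1))) `^ (p / (p / (p - 1)))) *
  \sum_z `|f z| `^ p.
Proof.
move=> p1; have M0 := ltW cz_const_gt0; have C0 := ltW weak_const_gt0.
case: ltP => [p2|p2].
  exact: (marcinkiewicz adjT (weak adjT T_l2 T'_osc) T_l2).
case: eqP => [->|/eqP pn2].
  under eq_bigr do rewrite powR_mulrn// real_normK ?num_real//.
  by under [X in _ <= _ * X]eq_bigr do rewrite powR_mulrn// real_normK ?num_real//.
have p3 : 2 < p by rewrite lt_neqAle eq_sym pn2.
have p10 : 0 < p - 1 by lra.
have q1 : 1 < p / (p - 1) by rewrite ltr_pdivlMr//; lra.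
have q2 : p / (p - 1) < 2 by rewrite ltr_pdivrMr//; lra.
have adjT' := adjoint_ops_sym adjT.
apply: (lp_duality adjT (strong_const_gt0 q1 q2) p1 erefl).
move=> g; exact: (marcinkiewicz adjT' (weak adjT' T'_l2 T_osc) T'_l2).
Qed.

End Operators.
End BoxLp.

(** * Back to the lattice *)

Section KernelRepresentation.
Context {R : realType} {d d1 : nat}.
Variables (rho : R) (l : 'I_d1 -> 'rV[int]_d) (lambda : 'I_d1 -> int -> R).
Variable G : int -> int -> 'rV[int]_d -> R.
Hypothesis hG : heat_kernel rho l lambda G.
Implicit Types (g : 'rV[int]_d -> R) (x y : 'rV[int]_d).

Lemma zconvE (F : 'rV[int]_d -> R) g (A : {fset 'rV[int]_d}) x :
  (forall y, y \notin A -> g y = 0) ->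
  zconv F g x = \sum_(y <- A) F (x - y) * g y.
Proof.
by move=> gA; rewrite /zconv (fsbigTE A)// => y /gA ->; rewrite mulr0.
Qed.

Lemma zconv0 (F : 'rV[int]_d -> R) g x : (forall y, g y = 0) -> zconv F g x = 0.
Proof. by move=> g0; apply: fsbig1 => y _; rewrite g0 mulr0. Qed.

Lemma zconv_step j n g : fin_supp g -> j <= n ->
  zconv (G j (n + 1)) g = walk_step l rho (lambda^~ n) (zconv (G j n) g).
Proof.
move=> /fin_suppP[A gA] jn; apply/funext => x.
rewrite (zconvE _ _ gA).
have -> : zconv (G j n) g = fun x => \sum_(y <- A) G j n (x - y) * g y.
  by apply/funext => y; exact: zconvE.
rewrite walk_step_sum; apply: eq_bigr => y _.
have -> : (fun x => G j n (x - y) * g y) = (fun x => g y * G j n (x - y)).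
  by apply/funext => z; rewrite mulrC.
rewrite walk_stepZ (walk_step_shift _ _ _ (G j n)) mulrC; congr (_ * _).
by rewrite /walk_step -((hG j).2 n (x - y) jn); ring.
Qed.

Section TimeShift.
Variable A0 : nat.

(** The time origin is moved to [- A0], before the support of the source, so that integer times
    become natural numbers. *)
Definition shifted_rates (n : nat) : 'I_d1 -> R := fun k => lambda k (n%:Z - A0%:Z).

Lemma zconv_heat_flow s m g : fin_supp g ->
  zconv (G (s%:Z - A0%:Z) ((s + m)%N%:Z - A0%:Z)) g =
  heat_flow l rho shifted_rates s m g.
Proof.
move=> fg; elim: m => [|m IH] /=.
  apply/funext => x; rewrite addn0; have /fin_suppP[A gA] := fg.
  rewrite (zconvE _ _ gA).
  under eq_bigr do rewrite (hG _).1 subr_eq0 mulrC eq_sym.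
  rewrite -[RHS](zsum_delta g x) (@zsum_fset _ _ A)// => y /gA ->.
  by rewrite mul0r.
rewrite -IH -zconv_step//; first by rewrite addnS -[(s + m).+1]addn1 PoszD addrAC.
by rewrite lerD2r lez_nat leq_addr.
Qed.

Variable f : int -> 'rV[int]_d -> R.
Hypothesis fin_f : forall j, fin_supp (f j).
Hypothesis f_past : forall j x, j < - A0%:Z -> f j x = 0.

(** Times before [- A0] contribute zero, so the sum over the infinite past reduces to finitely many
    terms; each is a propagator by [zconv_heat_flow]. *)
Lemma solution_duhamel (n : nat) :
  (fun x => \sum_(j \in [set j : int | j < n%:Z - A0%:Z]) zconv (G j (n%:Z -
    A0%:Z)) (f j) x)
  = duhamel l rho shifted_rates (fun s => f (s%:Z - A0%:Z)) n.
Proof.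
apply/funext => x; rewrite duhamelE.
have inj_shift : injective (fun s : nat => s%:Z - A0%:Z).
  by move=> s s' /addIr[].
rewrite (fsbigE [seq s%:Z - A0%:Z | s <- iota 0 n]); last first.
- move=> j /= jn jr; apply: zconv0 => y; apply: f_past.
  rewrite ltNge; apply: contra jr => Aj; apply/mapP.
  exists (absz (j + A0%:Z)); last by lia.
  by rewrite mem_iota; lia.
- by move=> j /= /mapP[s]; rewrite mem_iota => sn ->; lia.
- by rewrite map_inj_uniq ?iota_uniq.
rewrite big_map big_mkcond -(big_mkord xpredT (fun s => heat_flow l rho
  shifted_rates s (n - s) (f (s%:Z - A0%:Z)) x)) /index_iota subn0.
apply: eq_big_seq => s; rewrite mem_iota => /= sn.
rewrite ifT; last by apply/mem_set => /=; lia.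
by rewrite -zconv_heat_flow// subnKC// ltnW.
Qed.

End TimeShift.
End KernelRepresentation.

Lemma mdiff_seq {R : realType} {d : nat} (alpha : 'I_d -> nat) :
  exists2 t : seq 'I_d, size t = (\sum_i alpha i)%N &
  forall f : 'rV[int]_d -> R,
    mdiff alpha f = foldr (fun i g => fdiff (delta_mx 0 i) g) f t.
Proof.
have -> : (\sum_i alpha i = \sum_(i <- enum 'I_d) alpha i)%N by rewrite big_enum.
rewrite /mdiff; elim: (enum _) => [|i s [t st tE]].
  by exists [::]; rewrite ?big_nil.
exists (nseq (alpha i) i ++ t).
  by rewrite size_cat size_nseq st big_cons.
by move=> f; rewrite foldr_cat -tE /=; elim: (alpha i) => //= n ->.
Qed.

Lemma mdiff2 {R : realType} {d : nat} (alpha : 'I_d -> nat) :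
  (\sum_i alpha i = 2)%N -> exists i j, forall f : 'rV[int]_d -> R,
    mdiff alpha f = fdiff (delta_mx 0 i) (fdiff (delta_mx 0 j) f).
Proof.
move=> a2; have [[|i [|j [|//]]]] := mdiff_seq (R := R) alpha; rewrite a2// => _ E.
by exists i, j => f; rewrite E.
Qed.

Section ReindexSums.
Context {R : realType} {X : finType} {Y : choiceType} (e : X -> Y).
Hypothesis e_inj : injective e.

Lemma sum_in_image (s : seq Y) (phi : Y -> R) : uniq s ->
  \sum_(z | e z \in s) phi (e z) = \sum_(y <- s | y \in codom e) phi y.
Proof.
move=> us; rewrite -[in RHS]big_filter -[LHS]big_filter.
rewrite -(big_map e xpredT phi); apply: perm_big; apply: uniq_perm.
- by rewrite map_inj_uniq// filter_uniq// index_enum_uniq.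
- exact: filter_uniq.
move=> y; rewrite mem_filter; apply/mapP/andP => [[z]|[/codomP[z ->] ys]].
  by rewrite mem_filter => /andP[zs _] ->; rewrite codom_f.
by exists z => //; rewrite mem_filter ys mem_index_enum.
Qed.

Lemma sum_le_image (s : seq Y) (phi : Y -> R) : uniq s -> (forall y, 0 <= phi y) ->
  (forall y, y \in s -> y \in codom e) ->
  \sum_(y <- s) phi y <= \sum_z phi (e z).
Proof.
move=> us phi0 se; rewrite big_seq [leLHS](eq_bigl (fun y => (y \in s) && (y \in
  codom e))); last first.
  by move=> y; case: (boolP (y \in s)) => //= /se ->.
rewrite -big_seq_cond -sum_in_image// [leRHS](bigID (fun z => e z \in s))/=.
by rewrite lerDl; apply: sumr_ge0.
Qed.

Lemma sum_image_le (s : seq Y) (phi : Y -> R) : uniq s -> (forall y, 0 <= phi y) ->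
  (forall y, y \notin s -> phi y = 0) ->
  \sum_z phi (e z) <= \sum_(y <- s) phi y.
Proof.
move=> us phi0 phis; rewrite (bigID (fun z => e z \in s))/= [X in _ + X]big1;
  last first.
  by move=> z /phis.
rewrite addr0 sum_in_image// [leRHS](bigID (fun y => y \in codom e))/= lerDl.
exact: sumr_ge0.
Qed.

End ReindexSums.

Section LatticeLp.
Context {R : realType} {d d1 : nat}.
Variables (l : 'I_d1 -> 'rV[int]_d) (rho ds1 ds2 : R).
Hypotheses (d1_gt0 : (0 < d1)%N) (ds1_gt0 : 0 < ds1) (rho_gt0 : 0 < rho).
Hypotheses (ds2_gt0 : 0 < ds2) (rho_lt : rho < (2 * d1%:R * ds2)^-1).
Hypothesis basis_steps : forall i, is_step l (delta_mx 0 i).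

Definition lp_const (p : R) : R :=
  if p < 2 then strong_const l rho ds1 ds2 p
  else if p == 2 then cz_const l rho ds1 ds2
  else 2 * (2 * strong_const l rho ds1 ds2 (p / (p - 1))) `^ (p / (p / (p - 1))).

Lemma lp_const_ge0 p : 1 < p -> 0 <= lp_const p.
Proof.
move=> p1; rewrite /lp_const; case: ltP => [p2|_].
  by rewrite ltW// strong_const_gt0.
case: eqP => _; first by rewrite ltW// cz_const_gt0.
by rewrite mulr_ge0// powR_ge0.
Qed.

Variables (lambda : 'I_d1 -> int -> R) (G : int -> int -> 'rV[int]_d -> R).
Hypothesis lambda_bounds : forall k t, ds1 <= lambda k t <= ds2.
Hypothesis hG : heat_kernel rho l lambda G.
Variable f : int -> 'rV[int]_d -> R.

Definition solution (n : int) : 'rV[int]_d -> R :=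
  fun x => \sum_(j \in [set j : int | j < n]) zconv (G j n) (f j) x.

Lemma lattice_box (E : seq (int * 'rV[int]_d)) : exists B K : nat,
  forall tx, tx \in E -> exists z : box d K,
    tx = (z.1%:Z - B%:Z, site B z.2).
Proof.
pose m (tx : int * 'rV[int]_d) := (absz tx.1 + \sum_(i < d) absz (tx.2 0%R i))%N.
pose B := (\max_(tx <- E) m tx)%N.
(* After the shift by [B] all coordinates lie in $[0, 2B]$, and $2B < 2^{2B+1} \le 4^{2B+1}$. *)
exists B, (2 * B).+1 => tx txE.
have mB : (m tx <= B)%N by apply: leq_bigmax_seq.
have tB : (absz tx.1 <= B)%N by apply: leq_trans mB; apply: leq_addr.
have xB i : (absz (tx.2 0%R i) <= B)%N.
  apply: leq_trans mB; rewrite /m (bigD1 i)//= addnCA; apply: leq_addr.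
have B2 : (2 * B < 2 ^ (2 * B).+1)%N.
  by apply: ltn_trans (ltnSn _) _; apply: ltn_expl.
have B4 : (2 * B < 4 ^ (2 * B).+1)%N.
  by apply: leq_trans B2 _; rewrite leq_exp2r.
have h1 : (absz (tx.1 + B%:Z)%R < 4 ^ (2 * B).+1)%N by apply: leq_ltn_trans B4; lia.
have h2 i : (absz (tx.2 0 i + B%:Z)%R < 2 ^ (2 * B).+1)%N.
  by apply: leq_ltn_trans B2; have := xB i; lia.
exists (Ordinal h1, [ffun i => Ordinal (h2 i)]);
  case: tx txE mB tB xB h1 h2 => t x /= _ _ tB xB _ h2.
congr pair; first by lia.
apply/rowP => i; rewrite mxE ffunE /=; have := xB i; lia.
Qed.

(** The solution need not have finite support, so its size is tested on an arbitrary finite set [E].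
    The box is chosen to contain both [E] and [D], and its size does not enter the constant. *)
Lemma finite_lp p (D E : {fset int * 'rV[int]_d}) u v : 1 < p ->
  is_step l u -> is_step l v ->
  (forall t x, (t, x) \notin D -> f t x = 0) ->
  \sum_(nx <- E) `|fdiff u (fdiff v (solution nx.1)) nx.2| `^ p <=
  lp_const p * \sum_(tx <- D) `|f tx.1 tx.2| `^ p.
Proof.
move=> p1 su sv fD; have p0 : p != 0 by rewrite gt_eqF//; lra.
have [B [K inbox]] := lattice_box (E ++ D).
pose e (z : box d K) : int * 'rV[int]_d := (z.1%:Z - B%:Z, site B z.2).
have e_inj : injective e.
  move=> [t y] [t' y'] [/addIr[]/val_inj -> /site_inj ->]; exact: erefl.
pose fb (z : box d K) := f (e z).1 (e z).2.
have fin_f j : fin_supp (f j).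
  apply: (@fin_supp_fset _ _ [fset tx.2 | tx in D]%fset) => x xD; apply: fD.
  by apply: contra xD => jx; apply/imfsetP; exists (j, x).
have f_out t x : (forall z, (t, x) <> e z) -> f t x = 0.
  move=> no; apply: fD; apply/negP => tD.
  have [|z ze] := inbox (t, x); first by rewrite mem_cat tD orbT.
  exact: (no z).
have f_past j x : j < - B%:Z -> f j x = 0.
  by move=> jB; apply: f_out => z [jE _]; move: jB; rewrite jE; lia.
have extE : extend B fb = fun s => f (s%:Z - B%:Z).
  apply/funext => n; apply/funext => x.
  have [[z [e1 e2]]|no] := pselect (exists z : box d K, n = z.1 /\ x = site B z.2).
    by rewrite e1 e2 extend_in.
  rewrite extend_out; last by move=> z e1 e2; case: no; exists z.
  rewrite f_out// => z [/addIr[] e1 e2]; case: no; by exists z.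
have aW n : admissible ds1 ds2 (shifted_rates lambda B n).
  by move=> k; exact: lambda_bounds.
have opE z : box_op l rho B (shifted_rates lambda B) u v fb z =
    fdiff u (fdiff v (solution (e z).1)) (e z).2.
  by rewrite /box_op extE -(solution_duhamel hG fin_f f_past).
apply: (@le_trans _ _ (\sum_z `|fdiff u (fdiff v (solution (e z).1)) (e z).2| `^ p)).
  apply: (sum_le_image e_inj (phi := fun nx => `|fdiff u (fdiff v (solution
    nx.1)) nx.2| `^ p)).
  - exact: fset_uniq.
  - by move=> y; exact: powR_ge0.
  - move=> y yE; have [|z ->] := inbox y; first by rewrite mem_cat yE.
    exact: (codom_f e).
under eq_bigr do rewrite -opE.
apply: le_trans (box_op_lp d1_gt0 ds1_gt0 rho_gt0 ds2_gt0 rho_lt basis_steps B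
  aW su sv fb p1) _.
rewrite -/(lp_const p) ler_wpM2l ?lp_const_ge0//.
apply: (sum_image_le e_inj (phi := fun tx => `|f tx.1 tx.2| `^ p)).
- exact: fset_uniq.
- by move=> y; exact: powR_ge0.
- by move=> [t x] /fD /= ->; rewrite normr0 powR0.
Qed.

End LatticeLp.

(** Every summand is at most the total [S] to the power [p^-1]. This removes the roots from the sum
    of norms over multi-indices, with a crude constant. *)
Lemma sume_poweR_le {R : realType} (I : finType) (P : pred I) (a : I
  -> \bar R) (p : R) :
  0 < p -> (forall i, 0 <= a i)%E ->
  ((\sum_(i | P i) a i `^ p^-1) `^ p <= (#|I|%:R `^ p)%:E * \sum_(i | P i) a i)%E.
Proof.
move=> p0 a0; set S := (\sum_(i | P i) a i)%E.
have S0 : (0 <= S)%E by apply: sume_ge0.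
have nonneg (x : \bar R) : (0 <= x)%E -> x \in `[0%E, +oo%E].
  by move=> x0; rewrite in_itv/= x0 leey.
have pV0 : 0 <= p^-1 by rewrite invr_ge0 ltW.
have le_sum : (\sum_(i | P i) a i `^ p^-1 <= #|I|%:R%:E * S `^ p^-1)%E.
  apply: (@le_trans _ _ (\sum_(i in I) S `^ p^-1)%E); last first.
    by rewrite sumr_const mule_natl.
  rewrite big_mkcond/=; apply: lee_sum => i _; case: ifP => Pi; last exact: poweR_ge0.
  apply: gt0_ler_poweR => //; rewrite ?nonneg//.
  by rewrite /S (bigD1 i)//= leeDl// sume_ge0.
apply: (@le_trans _ _ ((#|I|%:R%:E * S `^ p^-1) `^ p)%E).
  apply: gt0_ler_poweR => //; first exact: ltW.
  - by apply: nonneg; apply: sume_ge0 => i _; exact: poweR_ge0.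
  - by apply: nonneg; rewrite mule_ge0// poweR_ge0.
rewrite poweRM ?poweR_ge0// -poweRrM mulVf ?gt_eqF// poweRe1//.
Qed.

(** The iterated sum is a sum over pairs, hence a supremum of finite sums, the form in which
    [finite_lp] gives its bound. *)
Lemma esum_pair_le {R : realType} {T1 T2 : choiceType} (F : set T1)
    (g : T1 -> T2 -> R) (c : \bar R) : finite_set F ->
  (forall i j, 0 <= g i j) ->
  (forall E : {fset T1 * T2}, (\sum_(ij <- E) g ij.1 ij.2)%:E <= c)%E ->
  (\sum_(i \in F) \esum_(j in [set: T2]) (g i j)%:E <= c)%E.
Proof.
move=> finF g0 gc; rewrite -esum_fset//; last first.
  by move=> i _; apply: esum_ge0 => j _; rewrite lee_fin.
rewrite esum_esum; last by move=> i j _ _; rewrite lee_fin.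
apply: ge_ereal_sup => _ /= [E [finE _]] <-.
by rewrite fsbig_finite//= sumEFin gc.
Qed.

Theorem theorem4p8 (R : realType) (d d1 : nat) (d_gt0 : (0 < d)%N)
    (le_d_d1 : (d <= d1)%N) (l : 'I_d1 -> 'rV[int]_d)
    (l_basis : forall i : 'I_d, l (widen_ord le_d_d1 i) = delta_mx 0 i)
    (ds1 ds2 : R) (ds1_gt0 : 0 < ds1) (le_ds : ds1 <= ds2)
    (rho : R) (rho_gt0 : 0 < rho) (rho_lt : rho < (2 * d1%:R * ds2)^-1)
    (p : R) (p_gt1 : 1 < p) :
  exists N : R,
    forall (lambda : 'I_d1 -> int -> R),
      (forall k t, ds1 <= lambda k t <= ds2) ->
    forall delta1 delta2 : R, 0 < delta1 -> 0 < delta2 ->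
      (forall (t : int) (xi : 'rV[R]_d),
         delta1 * (\sum_(i < d) xi 0 i ^+ 2)
           <= \sum_(i < d) \sum_(j < d)
                diffusion_mx l lambda t i j * xi 0 i * xi 0 j
           <= delta2 * (\sum_(i < d) xi 0 i ^+ 2)) ->
    forall G : int -> int -> 'rV[int]_d -> R, heat_kernel rho l lambda G ->
    forall f : int -> 'rV[int]_d -> R,
      finite_set [set tx : int * 'rV[int]_d | f tx.1 tx.2 != 0] ->
    (\esum_(n in [set: int])
        (seminorm2 p (fun x =>
           \sum_(j \in [set j : int | (j < n)%R]) zconv (G j n) (f j) x)%R
         `^ p)%E
     <= N%:E * (\esum_(tx in [set: int * 'rV[int]_d])
                 (`|f tx.1 tx.2| `^ p)%:E)%R)%E.
Proof.
have d1_gt0 : (0 < d1)%N by apply: (leq_trans d_gt0).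
have ds2_gt0 : 0 < ds2 := lt_le_trans ds1_gt0 le_ds.
have p0 : 0 < p by lra.
have basis i : is_step l (delta_mx 0 i).
  by exists (widen_ord le_d_d1 i); left; rewrite l_basis.
pose I : finType := {ffun 'I_d -> 'I_3}.
pose m : R := #|I|%:R.
(* One factor comes from taking the power [p] of a sum of at most [m] norms, the second [m] from
   adding the same bound over the multi-indices. *)
exists (m `^ p * (m * lp_const l rho ds1 ds2 p)) => lambda lambda_bounds _ _ _ _
  _ G hG f fin_f.
set Q := esum [set: int * 'rV[int]_d] _.
have Q0 : (0 <= Q)%E by apply: esum_ge0 => tx _; rewrite lee_fin powR_ge0.
have C0 : 0 <= lp_const l rho ds1 ds2 p by apply: lp_const_ge0.
have [D DE] : exists D : {fset int * 'rV[int]_d}, forall t x, (t, x) \notin D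
  -> f t x = 0.
  have /finite_fsetP[D DE] := fin_f; exists D => t x; apply: contraNeq => ftx.
  by have : [set` D] (t, x) by rewrite -DE.
have DQ : ((\sum_(tx <- D) `|f tx.1 tx.2| `^ p)%:E <= Q)%E.
  apply: esum_ge; exists [set` D]; first by split=> //; exact: finite_fset.
  by rewrite -sumEFin -fsbig_seq// fset_uniq.
pose g (alpha : I) n x := `|mdiff (fun i => alpha i) (solution G f n) x| `^ p.
have g0 alpha n x : 0 <= g alpha n x by exact: powR_ge0.
apply: ge_ereal_sup => _ /= [F [finF _]] <-.
apply: (@le_trans _ _ (\sum_(n \in F) (m `^ p)%:E *
   \sum_(alpha : I | (\sum_(i < d) alpha i == 2)%N) \esum_(x in [set:
     'rV[int]_d]) (g alpha n x)%:E)%E).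
  apply: lee_fsum => // n _; apply: sume_poweR_le => // alpha.
  by apply: esum_ge0 => x _; rewrite lee_fin.
rewrite -ge0_mule_fsumr; last first.
  move=> n; apply: sume_ge0 => alpha _; apply: esum_ge0 => x _; rewrite lee_fin//.
rewrite EFinM -muleA lee_wpmul2l ?lee_fin ?powR_ge0//.
rewrite fsbig_finite//= exchange_big/=.
apply: (@le_trans _ _ (\sum_(alpha in I) (lp_const l rho ds1 ds2 p)%:E * Q)%E);
  last first.
  by rewrite sumr_const EFinM -muleA mule_natl.
rewrite big_mkcond/=; apply: lee_sum => alpha _; case: ifP => [/eqP a2|_]; last first.
  by rewrite mule_ge0.
rewrite -fsbig_finite//; apply: esum_pair_le => // E.
have [i [j ijE]] := mdiff2 (R := R) a2.
apply: (@le_trans _ _ ((lp_const l rho ds1 ds2 p * \sum_(tx <- D) `|f tx.1 tx.2|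
  `^ p)%:E)); last first.
  by rewrite EFinM lee_wpmul2l// lee_fin.
rewrite lee_fin; under eq_bigr do rewrite /g ijE.
exact: (finite_lp d1_gt0 ds1_gt0 rho_gt0 ds2_gt0 rho_lt basis lambda_bounds hG).
Qed.
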